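(* Let $M$ be a compact metrizable space, let $G_0 < \mathrm{Homeo}(M)$ be a discrete convergence group acting on $M$, and suppose that $J_1, J_{-1} < G_0$ are both geometrically finite. Let $G_1 = \langle f \rangle<\mathrm{Homeo}(M)$ be an infinite cyclic discrete convergence group also acting on $M$, where $fJ_{-1}f^{-1} = J_1$ in $\mathrm{Homeo}(M)$. Suppose $G_0$ is in HNN ping-pong position with respect to $f$, $J_1$ and $J_{-1}$. Let $G = \langle G_0, G_1 \rangle < \mathrm{Homeo}(M)$, and suppose $G$ acts on $M$ as a convergence group. Then the following hold: (i) $G = G_0 *_f$, i.e. the natural homomorphism $G_0 *_f\to G$ is an isomorphism. (ii) $G$ is discrete, i.e. $G$ is a discrete convergence group. (iii) Every element of $G$ which is not conjugate in $G$ into $G_0$ is loxodromic. (iv) $G$ is geometrically finite if and only if $G_0$ is geometrically finite.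
   Context: Convergence groups. A group $G$ acting by homeomorphisms on a compact metrizable space $M$ is a convergence group if every sequence $(g_k)$ of pairwise distinct elements of $G$ has a subsequence such that either (1) it converges to a homeomorphism in the compact-open topology on $\mathrm{Homeo}(M)$, or (2) there are points $z_+, z_- \in M$ (not necessarily distinct) such that $g_k|_{M \setminus \{z_-\}}$ converges to the constant map $z \mapsto z_+$ uniformly on compact sets. $G$ is a discrete convergence group if it is a convergence group for which only alternative (2) occurs (equivalently, when $G<\mathrm{Homeo}(M)$, it is a convergence group that is a discrete subgroup of $\mathrm{Homeo}(M)$). A sequence satisfying (2) without passing to a subsequence is a convergence sequence, with attracting point $z_+$ and repelling point $z_-$. The limit set $\Lambda(G)\subset M$ of a discrete convergence group $G$ is the set of attracting points of convergence sequences in $G$. Elements. An element $g$ of a convergence group is elliptic if the closure of $\langle g\rangle$ in $\mathrm{Homeo}(M)$ is compact; parabolic if it is not elliptic and fixes exactly one point of $M$; loxodromic if it is not elliptic and fixes exactly two points of $M$. Geometrical finiteness. Let $G$ be a discrete convergence group on $M$. A point $x\in\Lambda(G)$ is a conical limit point if there is a sequence $(g_k)$ of distinct elements of $G$ such that for every $z \in M\setminus\{x\}$ the pairs $(g_kx,g_kz)$ stay in a compact subset of $(M\times M)\setminus\Delta$, $\Delta$ the diagonal. A point $x\in\Lambda(G)$ is a parabolic point if it is the fixed point of a parabolic element of $G$; it is bounded if $(\Lambda(G)\setminus\{x\})/\mathrm{Stab}_G(x)$ is compact. $G$ is geometrically finite if every point of $\Lambda(G)$ is a conical limit point or a bounded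 parabolic point. Precise invariance. For subgroups $J_1,\dots,J_n$ of a group $G$ acting on $M$, a tuple $(U_1,\dots,U_n)$ of subsets of $M$ is precisely invariant under $(J_1,\dots,J_n)$ in $G$ if each $U_i$ is $J_i$-invariant, $gU_i\cap U_i=\varnothing$ for every $g\in G\setminus J_i$, and $gU_i\cap U_j=\varnothing$ for all $i\ne j$ and every $g\in G$. HNN ping-pong position. With $G_0, J_1, J_{-1}, f$ as in the claim, $G_0$ is in HNN ping-pong position with respect to $f$, $J_1$ and $J_{-1}$ if there exist closed sets $B_1,B_{-1}\subset M$ with nonempty disjoint interiors such that: (1) $(B_1,B_{-1})$ is precisely invariant under $(J_1,J_{-1})$ in $G_0$; (2) if $A=M\setminus(B_1\cup B_{-1})$, then $f(A\cup B_1)=\mathrm{Int}(B_1)$; (3) for $i\in\{\pm1\}$, $\Lambda(G_0)\cap B_i=\Lambda(J_i)$; (4) the set $A_0=M\setminus G_0(B_1\cup B_{-1})$ is nonempty, where $G_0(U)=\bigcup_{g\in G_0}gU$. $G_0 *_f$ denotes the HNN extension of $G_0$ with stable letter $f$ and relations $fjf^{-1}=f_*(j)$ for $j\in J_{-1}$, where $f_*:J_{-1}\to J_1$ is the isomorphism given by conjugation by $f$ in $\mathrm{Homeo}(M)$; the natural homomorphism to $G$ restricts to the inclusion on $G_0$ and sends the stable letter to $f$. *)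

(* Defs.v *)
From HB Require Import structures.
From mathcomp Require Import all_boot.
From mathcomp Require Import all_classical all_reals all_analysis.

Set Implicit Arguments.
Unset Strict Implicit.
Unset Printing Implicit Defensive.

Local Open Scope classical_set_scope.
Local Open Scope group_scope.
Local Open Scope quotient_scope.

Section Subgroups.
Variable gT : groupType.

Definition subgroup (G : set gT) : Prop := group_closed [in G].

Definition generated (A : set gT) : set gT := smallest subgroup A.

End Subgroups.

(* The group with generators X and relations u = v whenever rels u v. A word is
   a sequence of letters (true, x), standing for x, and (false, x), standing
   for x^-1. *)
Section Presentation.
Variables (X : choiceType) (rels : seq (bool * X) -> seq (bool * X) -> Prop).

Local Notation word := (seq (bool * X)).

Inductive word_eq : word -> word -> Prop :=
| word_eq_refl u : word_eq u u
| word_eq_sym u v : word_eq u v -> word_eq v u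
| word_eq_trans v u w : word_eq u v -> word_eq v w -> word_eq u w
| word_eq_cat u u' v v' :
    word_eq u u' -> word_eq v v' -> word_eq (u ++ v) (u' ++ v')
| word_eq_cancel b x : word_eq [:: (b, x); (~~ b, x)] [::]
| word_eq_rel u v : rels u v -> word_eq u v.

Definition word_eqb : rel word := fun u v => `[< word_eq u v >].

Lemma word_eqb_refl : reflexive word_eqb.
Proof. by move=> u; apply/asboolP; exact: word_eq_refl. Qed.

Lemma word_eqb_sym : symmetric word_eqb.
Proof. by move=> u v; apply/asboolP/asboolP; exact: word_eq_sym. Qed.

Lemma word_eqb_trans : transitive word_eqb.
Proof.
by move=> v u w /asboolP uv /asboolP vw; apply/asboolP; exact: word_eq_trans vw.
Qed.

Canonical word_eqb_equiv :=
  EquivRel word_eqb word_eqb_refl word_eqb_sym word_eqb_trans.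

Definition presented := {eq_quot word_eqb}.
HB.instance Definition _ := Choice.on presented.
HB.instance Definition _ := Quotient.on presented.

Definition pres_class (w : word) : presented := \pi_presented w.

Lemma pres_classP u v : pres_class u = pres_class v <-> word_eq u v.
Proof. by split=> [/eqmodP/asboolP | uv]; [|apply/eqmodP/asboolP]. Qed.

Lemma pres_classK u : word_eq (repr (pres_class u)) u.
Proof. by apply/pres_classP; rewrite /pres_class reprK. Qed.

Definition winv (u : word) : word := rev [seq (~~ l.1, l.2) | l <- u].

Lemma winv_cat u v : winv (u ++ v) = winv v ++ winv u.
Proof. by rewrite /winv map_cat rev_cat. Qed.

Lemma winvK : involutive winv.
Proof.
move=> u; rewrite /winv map_rev revK -map_comp map_id_in// => -[b x] _ /=.
by rewrite negbK.
Qed.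

Lemma word_eq_mulV u : word_eq (u ++ winv u) [::].
Proof.
elim: u => [|[b x] u IHu]; first exact: word_eq_refl.
rewrite -[_ :: u]cat1s winv_cat -catA (catA u).
apply: word_eq_trans (word_eq_cancel b x).
apply: (@word_eq_cat [:: (b, x)] [:: (b, x)] _ [:: (~~ b, x)]).
  exact: word_eq_refl.
by apply: (@word_eq_cat _ [::] _ [:: (~~ b, x)]); last exact: word_eq_refl.
Qed.

Lemma word_eq_mulVl u : word_eq (winv u ++ u) [::].
Proof. by have := word_eq_mulV (winv u); rewrite winvK. Qed.

Lemma word_eq_catE u v w : word_eq u v -> word_eq (u ++ w) (v ++ w).
Proof. by move=> uv; exact: word_eq_cat uv (word_eq_refl _). Qed.

Lemma word_eq_inv u v : word_eq u v -> word_eq (winv u) (winv v).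
Proof.
move=> uv; apply: (@word_eq_trans (winv u ++ (v ++ winv v))).
  rewrite -[X in word_eq X _]cats0; apply: word_eq_cat (word_eq_refl _) _.
  exact/word_eq_sym/word_eq_mulV.
rewrite catA -[X in word_eq _ X]cat0s; apply: word_eq_catE.
apply: word_eq_trans (word_eq_mulVl u).
exact: word_eq_cat (word_eq_refl _) (word_eq_sym uv).
Qed.

Definition pres_one := pres_class [::].
Definition pres_mul (x y : presented) := pres_class (repr x ++ repr y).
Definition pres_inv (x : presented) := pres_class (winv (repr x)).

Lemma pres_mulE u v : pres_mul (pres_class u) (pres_class v) = pres_class (u ++ v).
Proof. by apply/pres_classP; apply: word_eq_cat; exact: pres_classK. Qed.

Lemma pres_invE u : pres_inv (pres_class u) = pres_class (winv u).
Proof. by apply/pres_classP; apply: word_eq_inv; exact: pres_classK. Qed.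

Lemma pres_ind (P : presented -> Prop) :
  (forall u, P (pres_class u)) -> forall x, P x.
Proof. by move=> Pu x; rewrite -[x]reprK; exact: Pu. Qed.

Lemma pres_mulA : associative pres_mul.
Proof.
by elim/pres_ind=> u; elim/pres_ind=> v; elim/pres_ind=> w; rewrite !pres_mulE catA.
Qed.

Lemma pres_mul1g : left_id pres_one pres_mul.
Proof. by elim/pres_ind=> u; rewrite pres_mulE. Qed.

Lemma pres_mulg1 : right_id pres_one pres_mul.
Proof. by elim/pres_ind=> u; rewrite pres_mulE cats0. Qed.

Lemma pres_mulVg : left_inverse pres_one pres_inv pres_mul.
Proof.
elim/pres_ind=> u; rewrite pres_invE pres_mulE.
exact/pres_classP/word_eq_mulVl.
Qed.

Lemma pres_mulgV : right_inverse pres_one pres_inv pres_mul.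
Proof.
elim/pres_ind=> u; rewrite pres_invE pres_mulE.
exact/pres_classP/word_eq_mulV.
Qed.

HB.instance Definition _ := isGroup.Build presented
  pres_mulA pres_mul1g pres_mulg1 pres_mulVg pres_mulgV.

Variables (gT : groupType) (h : X -> gT).

Definition letter_val (l : bool * X) : gT := if l.1 then h l.2 else (h l.2)^-1.

Definition word_val (w : word) : gT := \prod_(l <- w) letter_val l.

(* Evaluation of a representative; it is the homomorphism extending h as soon as
   h satisfies the relations. *)
Definition pres_lift (x : presented) : gT := word_val (repr x).

Hypothesis hrels : forall u v, rels u v -> word_val u = word_val v.

Lemma word_val_eq u v : word_eq u v -> word_val u = word_val v.
Proof.
elim=> {u v} //.
- by move=> v u w _ -> _ ->.
- by move=> u u' v v' _ uu' _ vv'; rewrite /word_val !big_cat /= -!/(word_val _) uu' vv'.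
- by move=> [] x; rewrite /word_val !big_cons !big_nil /letter_val /= mulg1 ?mulgV ?mulVg.
Qed.

Lemma pres_liftE u : pres_lift (pres_class u) = word_val u.
Proof. exact/word_val_eq/pres_classK. Qed.

Lemma pres_liftM : {morph pres_lift : x y / x * y}.
Proof.
elim/pres_ind=> u; elim/pres_ind=> v.
rewrite [_ * _ in LHS]pres_mulE !pres_liftE.
by rewrite /word_val big_cat.
Qed.

End Presentation.

(* The HNN extension of G0 with stable letter t and relations
   t j t^-1 = f j f^-1 for j in J; here f j f^-1 is meant to lie in G0. *)
Section HNN.
Variables (gT : groupType) (G0 J : set gT) (f : gT).

(* Some a is the element a of G0, None is the stable letter. *)
Definition hnn_gen : choiceType := option (set_type G0).

Definition hnn_of (a : set_type G0) : bool * hnn_gen := (true, Some a).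
Definition hnn_t : bool * hnn_gen := (true, None).
Definition hnn_tV : bool * hnn_gen := (false, None).

Inductive hnn_rels : seq (bool * hnn_gen) -> seq (bool * hnn_gen) -> Prop :=
| hnn_rel_mul (a b c : set_type G0) : val a * val b = val c ->
    hnn_rels [:: hnn_of a; hnn_of b] [:: hnn_of c]
| hnn_rel_conj (j k : set_type G0) : J (val j) -> f * val j * f^-1 = val k ->
    hnn_rels [:: hnn_t; hnn_of j; hnn_tV] [:: hnn_of k].

Definition hnn := presented hnn_rels.
HB.instance Definition _ := Group.on hnn.

Definition hnn_gen_val (x : hnn_gen) : gT := if x is Some a then val a else f.

(* The natural homomorphism to the ambient group: it extends the inclusion of G0
   and maps the stable letter to f. *)
Definition hnn_nat (x : hnn) : gT := pres_lift hnn_gen_val x.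

Lemma hnn_gen_val_rels u v : hnn_rels u v ->
  word_val hnn_gen_val u = word_val hnn_gen_val v.
Proof.
rewrite /word_val; case=> [a b c abc|j k _ jk];
  rewrite !big_cons !big_nil /letter_val /= !mulg1 //.
by rewrite mulgA.
Qed.

Lemma hnn_natM : {morph hnn_nat : x y / x * y}.
Proof. exact/pres_liftM/hnn_gen_val_rels. Qed.

Lemma hnn_natF : {morph hnn_nat : x y / x / y}.
Proof. by move=> x y; apply: (mulIg (hnn_nat y)); rewrite -hnn_natM !mulgVK. Qed.

HB.instance Definition _ :=
  isGroupMorphism.Build hnn gT hnn_nat hnn_natF.

Lemma hnn_nat_of a : hnn_nat (pres_class hnn_rels [:: hnn_of a]) = val a.
Proof.
rewrite /hnn_nat pres_liftE; last exact: hnn_gen_val_rels.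
by rewrite /word_val big_seq1.
Qed.

Lemma hnn_nat_t : hnn_nat (pres_class hnn_rels [:: hnn_t]) = f.
Proof.
rewrite /hnn_nat pres_liftE; last exact: hnn_gen_val_rels.
by rewrite /word_val big_seq1.
Qed.

End HNN.

Section Homeo.
Variable M : topologicalType.

Definition is_homeo (f : M -> M) : Prop :=
  continuous f /\ exists g : M -> M, [/\ continuous g, cancel f g & cancel g f].

Record homeo := Homeo { homeo_fun :> M -> M; _ : `[< is_homeo homeo_fun >] }.

HB.instance Definition _ := [isSub for homeo_fun].
HB.instance Definition _ := [Choice of homeo by <:].

Lemma homeoP (f : homeo) : is_homeo f.
Proof. exact/asboolP/(valP f). Qed.

Lemma homeo_ext (f g : homeo) : f =1 g -> f = g.
Proof. by move=> fg; apply/val_inj/funext. Qed.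

Lemma is_homeo_id : is_homeo idfun.
Proof. by split=> [x|]; [|exists idfun; split=> // x]; exact: cvg_id. Qed.

Lemma is_homeo_comp (f g : homeo) : is_homeo (f \o g).
Proof.
have [cf [f' [cf' fK f'K]]] := homeoP f; have [cg [g' [cg' gK g'K]]] := homeoP g.
split; first by move=> x; apply: continuous_comp; [exact: cg|exact: cf].
exists (g' \o f'); split; last by exact: can_comp.
  by move=> x; apply: continuous_comp; [exact: cf'|exact: cg'].
exact: can_comp.
Qed.

Definition homeo_inv_fun (f : homeo) : M -> M := projT1 (cid (homeoP f).2).

Lemma homeo_inv_funP (f : homeo) : [/\ continuous (homeo_inv_fun f),
  cancel f (homeo_inv_fun f) & cancel (homeo_inv_fun f) f].
Proof. exact: projT2 (cid (homeoP f).2). Qed.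

Lemma is_homeo_inv (f : homeo) : is_homeo (homeo_inv_fun f).
Proof.
have [cg fK gK] := homeo_inv_funP f; split=> //.
by exists f; split=> //; exact: (homeoP f).1.
Qed.

Definition homeo_one := Homeo (asboolT is_homeo_id).
Definition homeo_mul (f g : homeo) := Homeo (asboolT (is_homeo_comp f g)).
Definition homeo_inv (f : homeo) := Homeo (asboolT (is_homeo_inv f)).

Lemma homeo_mulA : associative homeo_mul.
Proof. by move=> f g h; apply: homeo_ext. Qed.

Lemma homeo_mul1g : left_id homeo_one homeo_mul.
Proof. by move=> f; apply: homeo_ext. Qed.

Lemma homeo_mulg1 : right_id homeo_one homeo_mul.
Proof. by move=> f; apply: homeo_ext. Qed.

Lemma homeo_mulVg : left_inverse homeo_one homeo_inv homeo_mul.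
Proof. by move=> f; apply: homeo_ext => x; have [_ fK _] := homeo_inv_funP f; exact: fK. Qed.

Lemma homeo_mulgV : right_inverse homeo_one homeo_inv homeo_mul.
Proof. by move=> f; apply: homeo_ext => x; have [_ _ fK] := homeo_inv_funP f; exact: fK. Qed.

HB.instance Definition _ := isGroup.Build homeo
  homeo_mulA homeo_mul1g homeo_mulg1 homeo_mulVg homeo_mulgV.

HB.instance Definition _ := Topological.copy homeo
  (initial_topology (homeo_fun : homeo -> {compact-open, M -> M})).

Definition orbit (H : set homeo) (x : M) : set M := [set h x | h in H].

Definition stabilizer (G : set homeo) (x : M) : set homeo :=
  [set g | G g /\ g x = x].

Definition fixed_points (g : homeo) : set M := [set x | g x = x].

End Homeo.

(* The quotient A / H, for a subgroup H preserving A, with the quotient of the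
   subspace topology on A. *)
Section OrbitSpace.
Variables (M : topologicalType) (H : set (homeo M)) (A : set M).

Definition same_orbit : rel (set_type A) :=
  fun y z => `[< orbit H (val y) = orbit H (val z) >].

Lemma same_orbit_refl : reflexive same_orbit.
Proof. by move=> y; apply/asboolP. Qed.

Lemma same_orbit_sym : symmetric same_orbit.
Proof. by move=> y z; apply/asboolP/asboolP. Qed.

Lemma same_orbit_trans : transitive same_orbit.
Proof. by move=> y x z /asboolP xy /asboolP yz; apply/asboolP; rewrite xy. Qed.

Canonical same_orbit_equiv :=
  EquivRel same_orbit same_orbit_refl same_orbit_sym same_orbit_trans.

Definition orbit_space : topologicalType :=
  quotient_topology {eq_quot same_orbit}.

End OrbitSpace.

Section ConvergenceGroups.
Variables (R : realType) (M : metricType R).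
Implicit Types (G J H : set (homeo M)) (g h : homeo M) (x z : M).

Definition distinct_seq G (s : nat -> homeo M) : Prop :=
  injective s /\ forall k, G (s k).

Definition converges_to_homeo (s : nat -> homeo M) : Prop :=
  exists h : homeo M, s @ \oo --> h.

(* Uniform convergence on the compact subsets of M \ {zm} to the constant zp. *)
Definition attracts (s : nat -> homeo M) (zp zm : M) : Prop :=
  {family [set K : set M | compact K /\ K `<=` ~` [set zm]],
    (fun k => s k : M -> M) @ \oo --> (cst zp : M -> M)}.

Definition convergence_group G : Prop :=
  forall s, distinct_seq G s ->
    exists2 phi : nat -> nat, {homo phi : i j / (i < j)%N} &
      converges_to_homeo (s \o phi) \/
      exists zp zm : M, attracts (s \o phi) zp zm.

Definition discrete_convergence_group G : Prop :=
  convergence_group G /\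
  forall s, distinct_seq G s -> ~ converges_to_homeo s.

Definition limit_set G : set M :=
  [set zp | exists s zm, distinct_seq G s /\ attracts s zp zm].

Definition elliptic g : Prop := compact (closure (generated [set g])).

Definition parabolic g : Prop :=
  ~ elliptic g /\ exists x, fixed_points g = [set x].

Definition loxodromic g : Prop :=
  ~ elliptic g /\ exists x y, x <> y /\ fixed_points g = [set x; y].

Definition conical_limit_point G x : Prop :=
  limit_set G x /\
  exists2 s, distinct_seq G s &
    forall z, z <> x -> exists K : set (M * M),
      [/\ compact K, K `&` diagonal = set0 & forall k, K (s k x, s k z)].

Definition parabolic_point G x : Prop :=
  limit_set G x /\ exists g, [/\ G g, parabolic g & g x = x].

Definition bounded_parabolic_point G x : Prop :=
  parabolic_point G x /\
  compact [set: orbit_space (stabilizer G x) (limit_set G `\ x)].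

Definition geometrically_finite G : Prop :=
  forall x, limit_set G x ->
    conical_limit_point G x \/ bounded_parabolic_point G x.

Definition precisely_invariant (I : Type) G
    (J : I -> set (homeo M)) (U : I -> set M) : Prop :=
  [/\ forall i g, J i g -> g @` U i = U i,
      forall i g, G g -> ~ J i g -> (g @` U i) `&` U i = set0 &
      forall i j g, i <> j -> G g -> (g @` U i) `&` U j = set0].

(* The index 1 is true and the index -1 is false. *)
Definition hnn_ping_pong G0 (f : homeo M) J1 Jm1 : Prop :=
  let J (i : bool) := if i then J1 else Jm1 in
  exists B : bool -> set M,
  let A := ~` (B true `|` B false) in
  [/\ [/\ forall i, closed (B i), forall i, (B i)° !=set0 &
          (B true)° `&` (B false)° = set0],
      precisely_invariant G0 J B,
      f @` (A `|` B true) = (B true)°,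
      forall i, limit_set G0 `&` B i = limit_set (J i) &
      ~` (\bigcup_(g in G0) g @` (B true `|` B false)) !=set0].

End ConvergenceGroups.

(* Main.v *)
(* Limits are taken along a fixed nonprincipal ultrafilter on nat, which replaces
   the passage to subsequences: a sequence in a discrete convergence group is
   constant along it, or maps M \ {b} uniformly towards a point a.

   (i)-(iii) A reduced word h1 f^e1 h2 f^e2 ... maps the complement of a
   translate k B_{e0}, determined by its last letters, into the translate
   h1 B_{e1} (ping-pong). Points of A0 lie in no translate, whence (i).
   Quotients of consecutive terms of a convergent sequence tend to the identity,
   so if they were not in G0 the point of A0 and two interior points of the B_i
   would be in incompatible positions, whence (ii). If h1 B_{e1} and k B_{e0}
   are disjoint, the word is loxodromic; otherwise a conjugation shortens it.

   (iv) The key is J_push: for g_k in G0 there are j_k in J_e such that j_k g_k is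
   constant or attracts to a point outside B_e. It rests on the geometrical
   finiteness of J_e through a potential argument. Weigh the chains of nested
   separators from a base point y0 to a point x outside L(J_e), and choose j_k
   minimizing the supremum of these weights at j_k y_k. Conical and
   parabolic points of J_e are surrounded by arbitrarily heavy chains, so that near
   them a further element of J_e would decrease the minimum: hence j_k y_k
   accumulates only outside L(J_e). It follows that the translates of B_e form a
   null family, so that a limit point of G outside the orbit of L(G0) lies
   in an infinite nested sequence of translates, hence is conical, while conical and bounded
   parabolic points in L(G0) are the same for G0 and for G. *)
Require Import Defs.
From HB Require Import structures.
From mathcomp Require Import all_boot all_order all_algebra.
From mathcomp Require Import all_classical all_reals all_analysis.
From mathcomp Require Import lra.

Set Implicit Arguments.
Unset Strict Implicit.
Unset Printing Implicit Defensive.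

Import Order.TTheory GRing.Theory Num.Theory.

Local Open Scope classical_set_scope.
Local Open Scope group_scope.

(** * Limits along an ultrafilter *)

(** Geometrical finiteness is a condition on single limit points, while [J_push] asks for
    compactness off the limit set. In the presence of parabolic points [J e] need not even act
    cocompactly there. What is missing is borrowed from [G0]: in both directions of (iv) a parabolic
    point of [J e] is bounded parabolic for [G0] (the hypothesis [J_bp]), and precise invariance
    puts its [G0]-stabilizer inside [J e]. The potential has to drop. Passing from [x] to [s x] can
    add separators that cut [y0] off from two points at distance 1/(m+1), and removes a chain that
    is long but lies in one class. So each class needs a positive weight, while for every [m] the
    separators of the first kind must have bounded total weight. Sparse annuli make them finitely
    many in each class; as there are countably many classes, parabolic points being countable, and
    countably many [m], a diagonal choice of weights meets all the bounds. *)

Definition Uf : set_system nat :=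
  sval (cid (ultraFilterLemma eventually_filter)).

#[global] Instance Uf_ultra : UltraFilter Uf.
Proof. exact: (svalP (cid (ultraFilterLemma eventually_filter))).1. Qed.

Lemma Uf_eventually : \oo `<=` Uf.
Proof. exact: (svalP (cid (ultraFilterLemma eventually_filter))).2. Qed.

Lemma Uf_ge n : \forall k \near Uf, (n <= k)%N.
Proof. by apply: Uf_eventually; exists n. Qed.

Lemma Uf_N (P : nat -> Prop) :
  ~ (\forall k \near Uf, P k) -> \forall k \near Uf, ~ P k.
Proof. by move=> nP; have [|//] := in_ultra_setVsetC P Uf_ultra. Qed.

Lemma Uf_contra (P : nat -> Prop) :
  ((\forall k \near Uf, ~ P k) -> False) -> \forall k \near Uf, P k.
Proof. by move=> H; apply: contrapT => /Uf_N. Qed.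

Lemma Uf_ex (P : nat -> Prop) : (\forall k \near Uf, P k) -> exists k, P k.
Proof. exact: filter_ex. Qed.

Lemma Uf_ex2 (P Q : nat -> Prop) : (\forall k \near Uf, P k) ->
  (\forall k \near Uf, Q k) -> exists k, P k /\ Q k.
Proof. by move=> HP HQ; apply: Uf_ex; apply: filterS2 HP HQ. Qed.

Lemma Uf_ex3 (P Q S : nat -> Prop) : (\forall k \near Uf, P k) ->
  (\forall k \near Uf, Q k) -> (\forall k \near Uf, S k) ->
  exists k, [/\ P k, Q k & S k].
Proof. by move=> HP HQ HS; apply: Uf_ex; apply: filterS3 HP HQ HS. Qed.

Lemma Uf_or (P Q : nat -> Prop) : (\forall k \near Uf, P k \/ Q k) ->
  (\forall k \near Uf, P k) \/ (\forall k \near Uf, Q k).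
Proof.
move=> PQ; have [|/Uf_N nP] := EM (\forall k \near Uf, P k); first by left.
by right; apply: filterS2 nP PQ => k nP [].
Qed.

Lemma Uf_bool (b : nat -> bool) : exists c, \forall k \near Uf, b k = c.
Proof.
have [H|H] : (\forall k \near Uf, b k = true) \/ (\forall k \near Uf, b k = false).
  by apply: Uf_or; apply: nearW => k; case: (b k); [left|right].
- by exists true.
- by exists false.
Qed.

Lemma Uf_fin (T : choiceType) (A : set T) (s : nat -> T) : finite_set A ->
  (\forall k \near Uf, A (s k)) -> exists2 a, A a & \forall k \near Uf, s k = a.
Proof.
move=> /finite_seqP[l ->]; elim: l => [/Uf_ex[]//|a l IHl] /= H.
have /Uf_or[Ha|/IHl[b bl Hb]] : \forall k \near Uf, s k = a \/ s k \in l.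
  by apply: filterS H => k /=; rewrite inE => /orP[/eqP|]; [left|right].
- by exists a => //=; rewrite inE eqxx.
- by exists b => //=; rewrite inE bl orbT.
Qed.

(* The counterpart of sequences of distinct elements: see [inj_free] and
   [free_extract]. *)
Definition ufree (T : Type) (s : nat -> T) : Prop :=
  forall a, \forall k \near Uf, s k <> a.

Lemma free_or_const (T : Type) (s : nat -> T) :
  ufree s \/ exists a, \forall k \near Uf, s k = a.
Proof.
have [|/existsNP[a /Uf_N na]] := EM (ufree s); first by left.
by right; exists a; apply: filterS na => k /contrapT.
Qed.

Lemma inj_free (T : Type) (s : nat -> T) : injective s -> ufree s.
Proof.
move=> si a; apply: Uf_contra => H.
have [k0 /contrapT k0a] : exists k0, ~ s k0 <> a by exact: Uf_ex H.
have [k [kk0 /contrapT ka]] := Uf_ex2 (Uf_ge k0.+1) H.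
have kk : k = k0 by apply: si; rewrite ka k0a.
by move: kk0; rewrite kk ltnn.
Qed.

Lemma inj_choice (T : choiceType) (S : nat -> set T) :
  (forall n, infinite_set (S n)) ->
  exists t : nat -> T, injective t /\ forall n, S n (t n).
Proof.
move=> Sinf.
have pick (l : seq T) n : {x | S n x /\ x \notin l}.
  apply: cid; apply: contrapT => H; apply: (Sinf n).
  apply: (sub_finite_set _ (finite_seq l)) => x Sx; rewrite /=.
  by apply: contrapT => /negP xl; apply: H; exists x.
pose fix L n : seq T := if n is m.+1 then sval (pick (L m) m) :: L m else [::].
pose t n := sval (pick (L n) n).
have LS m n : (m < n)%N -> t m \in L n.
  elim: n => // n IHn; rewrite ltnS leq_eqVlt => /orP[/eqP->|/IHn mn] /=.
    by rewrite inE eqxx.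
  by rewrite inE mn orbT.
exists t; split; last by move=> n; exact: (svalP (pick (L n) n)).1.
have H m n : (m < n)%N -> t m <> t n.
  by move=> /LS tL tt; have := (svalP (pick (L n) n)).2; rewrite -/(t n) -tt tL.
by move=> m n tt; case: (ltngtP m n) => // /H; rewrite tt.
Qed.

(** Returns from the ultrafilter to a sequence of distinct elements: for each [n] there are
    infinitely many admissible values, since finitely many would make [s] constant along [Uf]. *)
Lemma free_extract (T : choiceType) (s : nat -> T) (P : nat -> T -> Prop) :
  ufree s -> (forall n, \forall k \near Uf, P n (s k)) ->
  exists t : nat -> T, injective t /\ forall n, P n (t n) /\ exists k, t n = s k.
Proof.
move=> fs sP; apply: (@inj_choice _ (fun n => [set x | P n x /\ exists k, x = s k])).
move=> n fin; have [|a _] := @Uf_fin _ _ s fin.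
  by apply: filterS (sP n) => k ?; split => //; exists k.
by move=> sa; have [k []] := Uf_ex2 (fs a) sa.
Qed.

Lemma infinite_inj (T : choiceType) (A : set T) : infinite_set A ->
  exists t : nat -> T, injective t /\ forall n, A (t n).
Proof. by move=> Ai; apply: (inj_choice (S := fun=> A)). Qed.

Lemma ultra_img (T : Type) (u : nat -> T) : UltraFilter (u @ Uf).
Proof.
apply: Build_UltraFilter => G GF sG; apply/seteqP; split=> // A GA.
have [//|nA] := in_ultra_setVsetC (u @^-1` A) Uf_ultra.
have GnA : G (~` A) by apply: sG.
by have [x []] := filter_ex (filterI GA GnA).
Qed.

(** * Ultralimits of points in a metric space *)

Section MetricUlim.
Variables (R : realType) (M : metricType R).
Implicit Types (u v : nat -> M) (x y z : M).
Local Open Scope ring_scope.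

Definition tends u x := forall e, 0 < e -> \forall k \near Uf, mdist (u k) x < e.

Lemma mdistC x y : mdist x y = mdist y x. Proof. exact: metric_sym. Qed.

Lemma mdist_tri y x z : mdist x z <= mdist x y + mdist y z.
Proof. exact: metric_triangle. Qed.

Lemma mdist_pos x y : x <> y -> 0 < mdist x y.
Proof. by move=> /eqP xy; rewrite mdist_gt0. Qed.

Lemma tendsP u x : tends u x <-> u @ Uf --> x.
Proof.
split=> [H|H e e0].
  apply/cvg_ballP => e e0; apply: filterS (H e e0) => k.
  by rewrite ballEmdist/= mdistC.
move/cvg_ballP: H => /(_ e e0); apply: filterS => k.
by rewrite ballEmdist/= mdistC.
Qed.

Lemma tends_cst x : tends (fun=> x) x.
Proof. by move=> e e0; apply: nearW => k; rewrite mdistxx. Qed.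

Lemma tends_eq u v x : (\forall k \near Uf, u k = v k) -> tends u x -> tends v x.
Proof. by move=> uv ux e e0; apply: filterS2 uv (ux e e0) => k ->. Qed.

Lemma tends_const u x a : tends u x -> (\forall k \near Uf, u k = a) -> x = a.
Proof.
move=> ux ua; apply: contrapT => /mdist_pos xa.
have [k [->]] := Uf_ex2 ua (ux _ xa).
by rewrite mdistC ltxx.
Qed.

Lemma tends_uniq u x y : tends u x -> tends u y -> x = y.
Proof.
move=> ux uy; apply: contrapT => /mdist_pos xy.
have e0 : 0 < mdist x y / 2 by rewrite divr_gt0.
have [k [kx ky]] := Uf_ex2 (ux _ e0) (uy _ e0).
have := mdist_tri (u k) x y; rewrite (mdistC x (u k)); lra.
Qed.

Lemma tends_cont u x (h : M -> M) : continuous h -> tends u x -> tends (h \o u) (h x).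
Proof.
move=> ch /tendsP ux; apply/tendsP.
by apply: cvg_comp ux _; exact: ch.
Qed.

Lemma tends_closed u x (A : set M) : closed A -> (\forall k \near Uf, A (u k)) ->
  tends u x -> A x.
Proof. by move=> cA uA /tendsP ux; exact: (closed_cvg _ cA uA _ ux). Qed.

Lemma tends_far u v x y e : tends u x -> tends v y ->
  (\forall k \near Uf, e <= mdist (u k) (v k)) -> e <= mdist x y.
Proof.
move=> ux vy H; rewrite leNgt; apply/negP => xy.
have e0 : 0 < (e - mdist x y) / 2 by rewrite divr_gt0// subr_gt0.
have [k [kx ky kk]] := Uf_ex3 (ux _ e0) (vy _ e0) H.
have := mdist_tri x (u k) (v k); have := mdist_tri y x (v k).
rewrite (mdistC y (v k)); lra.
Qed.

Lemma tends_neq u x e : 0 < e -> (\forall k \near Uf, e <= mdist (u k) x) ->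
  forall y, tends u y -> y <> x.
Proof.
move=> e0 H y uy yx; have := tends_far uy (tends_cst x) H.
by rewrite yx mdistxx leNgt e0.
Qed.

Lemma closedP_mdist (A : set M) :
  (forall x, (forall e, 0 < e -> exists2 y, A y & mdist y x < e) -> A x) -> closed A.
Proof.
move=> H x cx; apply: H => e e0.
have [y [Ay]] := cx _ (nbhsx_ballx x e e0).
by rewrite ballEmdist/= => xy; exists y => //; rewrite mdistC.
Qed.

Lemma closed_far x e : closed [set y | e <= mdist y x].
Proof.
apply: closedP_mdist => y H /=; rewrite leNgt; apply/negP => yx.
have [|z /= ez zy] := H (e - mdist y x); first by rewrite subr_gt0.
have := mdist_tri y z x; lra.
Qed.

Lemma closed_sep (A : set M) x : closed A -> ~ A x ->
  exists2 e, 0 < e & forall y, A y -> e <= mdist y x.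
Proof.
move=> cA nAx; apply: contrapT => H; apply: nAx; apply: cA => B /nbhs_ballP[e /= e0 eB].
apply: contrapT => nAB; apply: H; exists e => // y Ay; rewrite leNgt; apply/negP => yx.
by apply: nAB; exists y; split => //; apply: eB; rewrite ballEmdist/= mdistC.
Qed.

Lemma inv_small e : 0 < e -> exists n, forall m, (n <= m)%N -> (m.+1%:R^-1 : R) < e.
Proof.
move=> e0; have [n ne] := ltr_add_invr e0; exists n => m nm.
rewrite add0r in ne; apply: le_lt_trans ne.
by rewrite lef_pV2 ?posrE ?ltr0n// ler_nat ltnS.
Qed.

Lemma Uf_inv_small e : 0 < e -> \forall k \near Uf, (k.+1%:R^-1 : R) < e.
Proof. by move=> /inv_small[n H]; apply: filterS (Uf_ge n) => k /H. Qed.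

Hypothesis Mc : compact [set: M].

Lemma Uconv u : exists x, tends u x.
Proof.
have := Mc; rewrite compact_ultra => /(_ _ (ultra_img u) filterT)[x [_ /= H]].
by exists x; apply/tendsP.
Qed.

End MetricUlim.

(** * Convergence groups *)

Section Subgroup.
Variables (gT : groupType) (G : set gT) (sG : subgroup G).
Implicit Types g h : gT.

Lemma subg1 : G 1. Proof. by have [/set_mem] := sG. Qed.

Lemma subgF g h : G g -> G h -> G (g * h^-1).
Proof. by move=> Gg Gh; have [_ H] := sG; apply/set_mem/H; exact/mem_set. Qed.

Lemma subgV g : G g -> G g^-1.
Proof. by move=> Gg; rewrite -[g^-1]mul1g; apply: subgF => //; exact: subg1. Qed.

Lemma subgM g h : G g -> G h -> G (g * h).
Proof. by move=> Gg /subgV Gh; rewrite -[h]invgK; exact: subgF. Qed.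

Lemma subgVK g : G g^-1 -> G g. Proof. by move=> /subgV; rewrite invgK. Qed.

Lemma subgX g n : G g -> G (g ^+ n).
Proof.
by move=> Gg; elim: n => [|n IHn]; [rewrite expg0; exact: subg1|rewrite expgS; exact: subgM].
Qed.

Lemma subgMl g h : G g -> (G (g * h) <-> G h).
Proof.
move=> Gg; split=> [Ggh|]; last exact: subgM.
by rewrite -[h](mulKg g); apply: subgM => //; exact: subgV.
Qed.

End Subgroup.

Lemma generated_subgroup (gT : groupType) (A : set gT) : subgroup (generated A).
Proof.
split; first by apply/mem_set => B [sB _]; exact: subg1.
move=> g h /set_mem Ag /set_mem Ah; apply/mem_set => B /[dup] BB [sB _].
by apply: subgF => //; [exact: Ag|exact: Ah].
Qed.

Lemma sub_gen (gT : groupType) (A : set gT) : A `<=` generated A.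
Proof. by move=> a Aa B [_]; apply. Qed.

Lemma gen_subP (gT : groupType) (A H : set gT) : subgroup H -> A `<=` H ->
  generated A `<=` H.
Proof. by move=> sH AH g; apply. Qed.

Section HomeoBasics.
Variables (M : topologicalType).
Implicit Types (g h : homeo M) (x : M).

Lemma hM g h x : (g * h) x = g (h x). Proof. by []. Qed.
Lemma h1 x : (1 : homeo M) x = x. Proof. by []. Qed.
Lemma hK g x : g^-1 (g x) = x. Proof. by rewrite -hM mulVg. Qed.
Lemma hVK g x : g (g^-1 x) = x. Proof. by rewrite -hM mulgV. Qed.
Lemma h_inj g : injective g. Proof. by move=> x y /(congr1 (homeo_fun (g^-1)%g)); rewrite !hK. Qed.
Lemma h_cont g : continuous g. Proof. exact: (homeoP g).1. Qed.
Lemma him g (A : set M) x : (g @` A) x <-> A (g^-1 x).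
Proof. by split=> [[y Ay <-]|Ax]; [rewrite hK|exists (g^-1 x); rewrite ?hVK]. Qed.

Lemma him_mul g h (A : set M) : (g * h) @` A = g @` (h @` A).
Proof. by apply/seteqP; split=> x /him; [move=> H; apply/him/him; move: H; rewrite invgM|move/him => H; apply/him; rewrite invgM]. Qed.

Lemma him1 (A : set M) : (1 : homeo M) @` A = A.
Proof. by apply/seteqP; split=> [x [y Ay <-]|x Ax]; [|exists x]. Qed.

Lemma closed_him g (A : set M) : closed A -> closed (g @` A).
Proof.
move=> cA; have -> : g @` A = (g^-1)%g @^-1` A by apply/seteqP; split=> x /him.
by apply: closed_comp => // x _; exact: h_cont.
Qed.

End HomeoBasics.

(** * Attracting sequences and limit sets *)

Section Convergence.
Variables (R : realType) (M : metricType R) (Mc : compact [set: M]).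
Implicit Types (s t : nat -> homeo M) (u v : nat -> M) (x y z a b : M) (g h : homeo M).
Implicit Types (G J : set (homeo M)).
Local Open Scope ring_scope.
Local Open Scope group_scope.

(** One [e] measures both the ball removed at [b] and the target ball at [a], so that inverting [g]
    just exchanges [a] and [b] ([eattV]). *)
Definition eatt (e : R) a b g := forall z, (e <= mdist z b)%R -> (mdist (g z) a < e)%R.

Definition attU s a b := forall e : R, (0 < e)%R -> \forall k \near Uf, eatt e a b (s k).

Lemma attractsP s a b : attracts s a b <->
  forall e : R, (0 < e)%R -> \forall k \near \oo, eatt e a b (s k).
Proof.
split=> [/fam_cvgP H e e0|H].
  have /H : [set K : set M | compact K /\ K `<=` ~` [set b]] [set z | (e <= mdist z b)%R].
    split; first by apply: subclosed_compact Mc _ => //; exact: closed_far.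
    by move=> z /= ez zb; move: ez; rewrite zb mdistxx leNgt e0.
  move=> /(_ [set h | forall z, (e <= mdist z b)%R -> ball a e (h z)]).
  have : nbhs (cst a : {uniform` [set z | (e <= mdist z b)%R] -> M})
     [set h | forall z, (e <= mdist z b)%R -> ball a e (h z)].
    apply/uniform_nbhs; exists [set xy : M * M | ball xy.1 e xy.2]; split=> //.
    by rewrite -(@entourage_ballE R M); exists e.
  move=> N H1; have H2 : \forall k \near \oo, forall z, (e <= mdist z b)%R -> ball a e (s k z).
    exact: H1 N.
  apply: filterS H2 => k Hk z /Hk.
  by rewrite ballEmdist/= mdistC.
apply/fam_cvgP => K [cK Kb] P /uniform_nbhs[E [entE EP]].
have [e /= e0 eE] : exists2 e : R, (0 < e)%R & [set xy : M * M | ball xy.1 e xy.2] `<=` E.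
  by move: entE; rewrite -entourage_ballE => -[e e0 eE]; exists e.
have [d d0 dK] : exists2 d : R, (0 < d)%R & forall z, K z -> (d <= mdist z b)%R.
  apply: closed_sep; last by move=> /Kb; exact.
  exact: compact_closed (@metric_hausdorff _ _) cK.
have m0 : (0 < Num.min d e)%R by rewrite lt_min d0 e0.
apply: filterS (H _ m0) => k Hk; apply: EP => z Kz; apply: eE => /=.
rewrite ballEmdist/= mdistC; have := Hk z; rewrite ge_min (dK _ Kz) => /(_ isT).
by rewrite lt_min => /andP[].
Qed.

Lemma attracts_attU s a b : attracts s a b -> attU s a b.
Proof. by move=> /attractsP H e /H /Uf_eventually. Qed.

Lemma eattS (e e' : R) a b g : (e <= e')%R -> eatt e a b g -> eatt e' a b g.
Proof.
by move=> ee H z zb; exact: lt_le_trans (H z (le_trans ee zb)) ee.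
Qed.

Lemma eattV e a b g : eatt e a b g -> eatt e b a g^-1.
Proof.
move=> H z za; rewrite ltNge; apply/negP => /H; rewrite hVK.
by rewrite ltNge za.
Qed.

Lemma attUV s a b : attU s a b -> attU (fun k => (s k)^-1) b a.
Proof. by move=> H e /H; apply: filterS => k; exact: eattV. Qed.

Lemma attU_eq s t a b : (\forall k \near Uf, s k = t k) -> attU s a b -> attU t a b.
Proof. by move=> st H e e0; apply: filterS2 st (H e e0) => k ->. Qed.

Lemma attU_lim s a b u x : attU s a b -> tends u x -> x <> b ->
  tends (fun k => s k (u k)) a.
Proof.
move=> sab ux /mdist_pos xb e e0.
have m0 : (0 < Num.min (mdist x b / 2) e)%R by rewrite lt_min e0 andbT divr_gt0.
have x0 : (0 < mdist x b / 2)%R by rewrite divr_gt0.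
apply: filterS2 (sab _ m0) (ux _ x0) => k Hk kx.
have := Hk (u k); rewrite ge_min lt_min.
have -> : (mdist x b / 2 <= mdist (u k) b)%R.
  by have := mdist_tri (u k) x b; rewrite (mdistC x (u k)); lra.
by move=> /(_ isT)/andP[].
Qed.

Lemma attU_pt s a b x : attU s a b -> x <> b -> tends (fun k => s k x) a.
Proof. by move=> sab xb; apply: attU_lim sab (tends_cst x) xb. Qed.

Lemma tends_him u x g : tends u x -> tends (fun k => g (u k)) (g x).
Proof. by move=> ux; apply: tends_cont ux; exact: h_cont. Qed.

Lemma attU_rep s a b u x y : attU s a b -> tends u x ->
  tends (fun k => s k (u k)) y -> y <> a -> x = b.
Proof.
move=> sab ux sy ya; apply: contrapT => /(attU_lim sab ux) sa.
by apply: ya; exact: tends_uniq sy sa.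
Qed.

Lemma attU_extract s a b : ufree s -> attU s a b ->
  exists t, [/\ injective t, attracts t a b & forall n, exists k, t n = s k].
Proof.
move=> fs sab.
have [|t [ti H]] := @free_extract _ s (fun n g => eatt (n.+1%:R^-1) a b g) fs.
  by move=> n; apply: sab; rewrite invr_gt0 ltr0n.
exists t; split=> // [|n]; last exact: (H n).2.
apply/attractsP => e /inv_small[n ne]; exists n => // m /= nm.
by apply: eattS (H m).1; exact/ltW/ne.
Qed.

Section DiscreteGroup.
Variables (G : set (homeo M)) (dG : discrete_convergence_group G).

(** Infinitely many exceptions would contain a sequence of distinct elements, and the subsequence
    supplied by the convergence property would eventually satisfy [eatt e]. *)
Lemma fin_not_eatt (e : R) : (0 < e)%R ->
  finite_set [set g | G g /\ ~ exists a b, eatt e a b g].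
Proof.
move=> e0; apply: contrapT => /infinite_inj[t [ti tG]].
have [|phi phi_incr [tc|[a [b /attractsP H]]]] := dG.1 t.
- by split=> // k; exact: (tG k).1.
- apply: dG.2 tc; split=> [i j /= /ti ij|k]; last exact: (tG _).1.
  case: (ltngtP i j) => // /phi_incr; by rewrite ij ltnn.
- have [k Hk] := filter_ex (H _ e0).
  by apply: (tG (phi k)).2; exists a, b.
Qed.

Lemma conv_free s : (forall k, G (s k)) -> ufree s -> exists a b, attU s a b.
Proof.
move=> Gs fs.
have H n : exists ab : nat -> M * M,
    \forall k \near Uf, eatt (n.+1%:R^-1) (ab k).1 (ab k).2 (s k).
  have n0 : (0 < n.+1%:R^-1 :> R)%R by rewrite invr_gt0 ltr0n.
  have [x0 _] : exists x0 : M, True.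
    apply: contrapT => nM; have := fs (s 0%N); rewrite /ufree => /Uf_ex[k]; apply.
    by apply: homeo_ext => x; exfalso; apply: nM; exists x.
  have /choice[ab Hab] : forall k, exists ab : M * M,
      (exists a b, eatt (n.+1%:R^-1) a b (s k)) -> eatt (n.+1%:R^-1) ab.1 ab.2 (s k).
    move=> k; have [[a [b ab]]|nab] := EM (exists a b, eatt (n.+1%:R^-1) a b (s k)).
      by exists (a, b).
    by exists (x0, x0).
  exists ab; apply: Uf_contra => nab.
  have [|g _ sg] := Uf_fin (s := s) (fin_not_eatt n0).
    by apply: filterS nab => k nab; split=> // H; apply: nab; apply: Hab.
  by have [k []] := Uf_ex2 (fs g) sg.
have {H}/choice[ab Hab] := H.
have /choice[an Han] : forall n, exists x, tends (fun k => (ab n k).1) x.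
  by move=> n; exact: Uconv.
have /choice[bn Hbn] : forall n, exists x, tends (fun k => (ab n k).2) x.
  by move=> n; exact: Uconv.
have [a Ha] := Uconv Mc an; have [b Hb] := Uconv Mc bn.
exists a, b => e e0.
have e3 : (0 < e / 3)%R by rewrite divr_gt0.
have [n [na nb ne]] := Uf_ex3 (Ha _ e3) (Hb _ e3) (Uf_inv_small e3).
apply: filterS3 (Hab n) (Han n _ e3) (Hbn n _ e3) => k Hk; rewrite /= => ka kb z zb.
have zk : (n.+1%:R^-1 <= mdist z (ab n k).2)%R.
  apply: le_trans (ltW ne) _.
  have := mdist_tri (ab n k).2 z b; have := mdist_tri (bn n) (ab n k).2 b; lra.
have := lt_trans (Hk _ zk) ne; have := mdist_tri (ab n k).1 (s k z) a.
by have := mdist_tri (an n) (ab n k).1 a; lra.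
Qed.

Lemma conv_dich s : (forall k, G (s k)) ->
  (exists2 g, G g & \forall k \near Uf, s k = g) \/
  (ufree s /\ exists a b, attU s a b).
Proof.
move=> Gs; have [fs|[g sg]] := free_or_const s; [right|left].
  by split=> //; exact: conv_free.
by exists g => //; have [k <-] := Uf_ex sg.
Qed.

Lemma fin_by_att (A : set (homeo M)) : A `<=` G ->
  (forall s, (forall k, A (s k)) -> ufree s -> forall a b, attU s a b -> False) ->
  finite_set A.
Proof.
move=> AG H; apply: contrapT => /infinite_inj[t [ti tA]].
have ft := inj_free ti.
have [a [b tab]] := conv_free (fun k => AG _ (tA k)) ft.
exact: H tA ft a b tab.
Qed.

End DiscreteGroup.

Lemma discrete_sub G J : J `<=` G -> discrete_convergence_group G ->
  discrete_convergence_group J.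
Proof.
move=> JG [cG dG]; split=> s [si sJ]; first by apply: cG; split=> // k; exact: JG.
by apply: dG; split=> // k; exact: JG.
Qed.

Lemma limit_setP G x : limit_set G x <->
  exists s b, [/\ forall k, G (s k), ufree s & attU s x b].
Proof.
split=> [[s [b [[si sG] /attracts_attU sx]]]|[s [b [sG fs sx]]]].
  by exists s, b; split=> //; exact: inj_free.
have [t [ti tx ts]] := attU_extract fs sx.
by exists t, b; split=> //; split=> // k; have [j ->] := ts k.
Qed.

Lemma limit_setS G J : J `<=` G -> limit_set J `<=` limit_set G.
Proof.
by move=> JG x [s [b [[si sJ] sx]]]; exists s, b; split=> //; split=> // k; exact: JG.
Qed.

(** Stated one scale at a time, the condition passes to limits of [x], which gives
    [limit_set_closed]. For the converse, distinct elements are picked scale by scale and their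
    repelling points converge along [Uf]. *)
Lemma limit_setP_inf G x : limit_set G x <->
  forall e : R, (0 < e)%R -> infinite_set [set g | G g /\ exists b, eatt e x b g].
Proof.
split=> [/limit_setP[s [b [sG fs sx]]] e e0 fin|H].
  have [|g _ sg] := Uf_fin (s := s) fin.
    by apply: filterS (sx e e0) => k ?; split=> //; exists b.
  by have [k []] := Uf_ex2 (fs g) sg.
have [|t [ti tH]] := @inj_choice _ (fun n => [set g | G g /\ exists b, eatt (n.+1%:R^-1) x b g]).
  by move=> n; apply: H; rewrite invr_gt0 ltr0n.
have /choice[bn Hbn] := fun n => (tH n).2.
have [b Hb] := Uconv Mc bn.
apply/limit_setP; exists t, b; split; [by move=> k; exact: (tH k).1|exact: inj_free|].
move=> e e0; have e2 : (0 < e / 2)%R by rewrite divr_gt0.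
apply: filterS2 (Hb _ e2) (Uf_inv_small e2) => k kb ke z zb.
have zk : (k.+1%:R^-1 <= mdist z (bn k))%R.
  by apply: le_trans (ltW ke) _; have := mdist_tri (bn k) z b; lra.
by apply: lt_trans (lt_trans (Hbn k z zk) ke) _; lra.
Qed.

Lemma limit_set_closed G : closed (limit_set G).
Proof.
apply: closedP_mdist => x Hx; apply/limit_setP_inf => e e0.
have e2 : (0 < e / 2)%R by rewrite divr_gt0.
have [y /limit_setP_inf/(_ _ e2) + yx] := Hx _ e2.
apply: sub_infinite_set => g [Gg [b gb]]; split=> //; exists b => z zb.
have ez : (e / 2 <= mdist z b)%R by lra.
by have := gb z ez; have := mdist_tri y (g z) x; lra.
Qed.

Lemma free_comp (T T' : Type) (F : T -> T') (r : nat -> T) :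
  injective F -> ufree r -> ufree (F \o r).
Proof.
move=> Fi fr a; apply: Uf_contra => H.
have [k /contrapT ka] : exists k, ~ (F \o r) k <> a by exact: Uf_ex H.
have [j [H1 /contrapT]] := Uf_ex2 (fr (r k)) H.
by move=> /=; rewrite -ka /= => /Fi.
Qed.

Lemma free_inv s : ufree s -> ufree (fun k => (s k)^-1).
Proof. by apply: (@free_comp _ _ (fun g : homeo M => g^-1)); exact: invg_inj. Qed.

Lemma rep_limit_set G s a b : subgroup G -> (forall k, G (s k)) -> ufree s ->
  attU s a b -> limit_set G b.
Proof.
move=> sG Gs fs sab; apply/limit_setP; exists (fun k => (s k)^-1), a.
by split; [move=> k; exact: subgV|exact: free_inv|exact: attUV].
Qed.

Lemma att_limit_set G s a b : (forall k, G (s k)) -> ufree s ->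
  attU s a b -> limit_set G a.
Proof. by move=> Gs fs sab; apply/limit_setP; exists s, b. Qed.

Lemma h_unif g (e : R) x : (0 < e)%R -> exists2 d : R, (0 < d)%R &
  forall z, (mdist z x < d)%R -> (mdist (g z) (g x) < e)%R.
Proof.
move=> e0; have /cvg_ballP/(_ e e0) := @h_cont _ g x.
move=> /nbhs_ballP[d /= d0 H]; exists d => // z zx.
by have := H z; rewrite ballEmdist/= mdistC => /(_ zx); rewrite ballEmdist/= mdistC.
Qed.

Lemma attU_mull s a b g : attU s a b -> attU (fun k => g * s k) (g a) b.
Proof.
move=> sab e e0; have [d d0 H] := h_unif g a e0.
have m0 : (0 < Num.min d e)%R by rewrite lt_min e0 d0.
apply: filterS (sab _ m0) => k Hk z zb; rewrite hM; apply: H.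
by have := Hk z; rewrite ge_min zb orbT lt_min => /(_ isT)/andP[].
Qed.

Lemma attU_mulr s a b g : attU s a b -> attU (fun k => s k * g) a (g^-1 b).
Proof.
move=> sab; have := attUV (attU_mull g^-1 (attUV sab)).
by apply: attU_eq; apply: nearW => k; rewrite invgM !invgK.
Qed.

Lemma limit_set_conj G g : limit_set [set g * h * g^-1 | h in G] = g @` limit_set G.
Proof.
have sub (K : set (homeo M)) c x : limit_set K x ->
    limit_set [set c * h * c^-1 | h in K] (c x).
  move=> /limit_setP[s [b [sK fs sx]]]; apply/limit_setP.
  exists (fun k => c * s k * c^-1), (c b); split.
  - by move=> k; exists (s k).
  - apply: (@free_comp _ _ (fun h : homeo M => c * h * c^-1)) fs.
    by move=> h h' /mulIg/mulgI.
  - by have := attU_mulr c^-1 (attU_mull c sx); rewrite invgK.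
apply/seteqP; split=> [x Lx|_ [x Lx <-]]; last exact: sub.
apply/him; have := sub _ g^-1 _ Lx; congr limit_set.
apply/seteqP; split=> [_ [_ [h Gh <-] <-]|h Gh].
  by rewrite invgK !mulgA mulVg mul1g mulgVK.
by exists (g * h * g^-1); [exists h|rewrite invgK !mulgA mulVg mul1g mulgVK].
Qed.

Lemma conj_subg G g : subgroup G -> G g -> [set g * h * g^-1 | h in G] = G.
Proof.
move=> sG Gg; apply/seteqP; split=> [_ [h Gh <-]|h Gh].
  by apply: subgM => //; [exact: subgM|exact: subgV].
exists (g^-1 * h * g); last by rewrite !mulgA mulgV mul1g mulgK.
by apply: subgM => //; apply: subgM => //; exact: subgV.
Qed.

Lemma limit_set_inv G g x : subgroup G -> G g -> limit_set G (g x) <-> limit_set G x.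
Proof.
move=> sG Gg; rewrite -{1}(conj_subg sG Gg) limit_set_conj; split=> [/him|].
  by rewrite hK.
by exists x.
Qed.

End Convergence.

Lemma img_Uf (T : Type) (u : nat -> T) (A : set T) : (forall k, A (u k)) -> (u @ Uf) A.
Proof. by move=> uA; have : \forall k \near Uf, A (u k) by exact: nearW. Qed.

Section HomeoTopology.
Variables (R : realType) (M : metricType R).

Lemma homeo_ev_cvg (F : set_system (homeo M)) (h : homeo M) :
  Filter F -> F --> h -> forall K O, compact K -> open O ->
  h @` K `<=` O -> F [set g : homeo M | g @` K `<=` O].
Proof.
move=> FF Fh K O cK oO hKO.
have /compact_open_cvgP : ((fun g : homeo M => g : {compact-open, M -> M}) @ F)
    --> (h : {compact-open, M -> M}).
  by move=> A HA; apply: Fh; exact: (@initial_continuous _ _ (@homeo_fun M : homeo M -> {compact-open, M -> M})).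
by apply.
Qed.

Lemma homeo_ev_pt (F : set_system (homeo M)) (h : homeo M) x :
  Filter F -> F --> h -> (fun g : homeo M => g x) @ F --> h x.
Proof.
move=> FF Fh A; rewrite nbhsE => -[V [opV Vhx] VA].
have := homeo_ev_cvg FF Fh (@compact_set1 _ x) opV.
have hV : h @` [set x] `<=` V by move=> _ [_ -> <-].
move=> /(_ hV) H; change (F [set g : homeo M | A (g x)]).
by apply: filterS H => g gV; apply: VA; apply: gV; exists x.
Qed.

Lemma homeo_hausdorff : hausdorff_space (homeo M).
Proof.
move=> p q pq; apply: homeo_ext => x; apply: (@metric_hausdorff _ M) => A B pA qB.
have ev (h : homeo M) : (fun g : homeo M => g x) @ h --> h x.
  by apply: homeo_ev_pt => //; exact: nbhs_filter.
have [h [hA hB]] := pq _ _ (ev p A pA) (ev q B qB).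
by exists (h x).
Qed.

End HomeoTopology.

(** * Elliptic, parabolic and loxodromic elements; conical points *)

Section Elements.
Variables (R : realType) (M : metricType R) (Mc : compact [set: M]).
Implicit Types (s t : nat -> homeo M) (u v : nat -> M) (x y z a b : M) (g h : homeo M).
Variable M3 : exists x y z : M, [/\ x <> y, y <> z & x <> z].
Variables (G : set (homeo M)) (sG : subgroup G) (dG : discrete_convergence_group G).

Lemma pick_neq2 a b : exists x, x <> a /\ x <> b.
Proof.
have [x [y [z [xy yz xz]]]] := M3.
have [xa|xa] := EM (x = a); last first.
  have [xb|xb] := EM (x = b); last by exists x.
  have [ya|ya] := EM (y = a); last by exists y; split=> //; rewrite -xb; exact/nesym.
  by exists z; split; [rewrite -ya|rewrite -xb]; exact/nesym.
have [yb|yb] := EM (y = b); last by exists y; split=> //; rewrite -xa; exact/nesym.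
by exists z; split; [rewrite -xa|rewrite -yb]; exact/nesym.
Qed.

Lemma finite_order_elliptic g n : g ^+ n.+1 = 1 -> elliptic g.
Proof.
move=> gn1; have gm m : g ^+ m = g ^+ (m %% n.+1).
  by rewrite {1}(divn_eq m n.+1) expgnDr mulnC expgnA gn1 expg1n mul1g.
have fin : finite_set [set g ^+ i | i in `I_n.+1] by apply: finite_image; exact: finite_II.
have sH : subgroup [set g ^+ i | i in `I_n.+1].
  split; first by apply/mem_set; exists 0%N => //; rewrite expg0.
  move=> _ _ /set_mem[i _ <-] /set_mem[j jn <-]; apply/mem_set.
  exists ((i + (n.+1 - j)) %% n.+1)%N; first by rewrite /= ltn_mod.
  rewrite -gm expgnDr; congr (_ * _).
  apply: (@mulIg _ (g ^+ j)); rewrite mulVg -expgnDr subnK ?gn1//.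
  exact: ltnW.
have cl : closed [set g ^+ i | i in `I_n.+1].
  by apply: compact_closed; [exact: homeo_hausdorff|exact: finite_compact].
have sub : closure (generated [set g]) `<=` [set g ^+ i | i in `I_n.+1].
  move=> h Hh; apply: cl; apply: closure_subset Hh; apply: gen_subP => //.
  by move=> _ ->; exists (1 %% n.+1)%N; [rewrite /= ltn_mod|rewrite -gm expg1].
apply: subclosed_compact (finite_compact fin) sub; exact: closed_closure.
Qed.

Lemma infinite_order_inj g : (forall n, g ^+ n.+1 <> 1) -> injective (fun k => g ^+ k).
Proof.
move=> ng; have H i j : (i < j)%N -> g ^+ i <> g ^+ j.
  move=> ij gij; apply: (ng (j - i).-1); rewrite prednK ?subn_gt0//.
  by apply: (@mulIg _ (g ^+ i)); rewrite -expgnDr subnK 1?ltnW// mul1g.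
by move=> i j gij; case: (ltngtP i j) => // /H []; rewrite gij.
Qed.

(** Distinct powers would attract to a point [a]; a limit of them in the compact closure would then
    be a homeomorphism taking two different points to [a]. *)
Lemma elliptic_finite_order g : G g -> elliptic g -> exists n, g ^+ n.+1 = 1.
Proof.
move=> Gg eg; apply: contrapT => ng.
have inj := infinite_order_inj (fun n gn => ng (ex_intro _ n gn)).
have [a [b ab]] := conv_free Mc dG (fun k => subgX sG k Gg) (inj_free inj).
have := eg; rewrite /elliptic compact_ultra => /(_ _ (ultra_img (fun k => g ^+ k))).
case=> [|h [_ /= cvh]].
  apply: img_Uf => k; apply: subset_closure.
  by apply: (subgX (generated_subgroup _)); exact: sub_gen.
have ha x : x <> b -> h x = a.
  move=> xb; apply: (@tends_uniq _ _ (fun k => (g ^+ k) x)); last exact: attU_pt ab xb.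
  by apply/tendsP; exact: (homeo_ev_pt _ cvh).
have [x [xb _]] := pick_neq2 b b; have [y [yb yx]] := pick_neq2 b x.
by apply: yx; apply: (@h_inj _ h); rewrite !ha.
Qed.

Section PingPong.
Variables (g : homeo M) (U V : set M) (x0 : M).
Hypotheses (Gg : G g) (cU : closed U) (cV : closed V).
Hypotheses (UV : forall x, U x -> V x -> False) (gVU : forall x, ~ V x -> U (g x)).
Hypotheses (Ux0 : ~ U x0) (Vx0 : ~ V x0).

Lemma pp_pow n x : ~ V x -> U ((g ^+ n.+1) x).
Proof.
elim: n x => [|n IHn] x Vx; first by rewrite expg1; exact: gVU.
by rewrite expgSr hM; apply: IHn => Vg; apply: UV Vg; exact: gVU.
Qed.

Lemma pp_infinite_order n : g ^+ n.+1 <> 1.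
Proof. by move=> gn1; apply: Ux0; have := pp_pow n Vx0; rewrite gn1. Qed.

Lemma pp_att : exists a b, attU (fun k => g ^+ k) a b /\ U a.
Proof.
have [a [b ab]] := conv_free Mc dG (fun k => subgX sG k Gg)
                     (inj_free (infinite_order_inj pp_infinite_order)).
exists a, b; split=> //.
(* The repelling point may be [x0] itself; then [g x0] is another point outside [V], different from
   [x0] because it lies in [U]. *)
have [x [xb Vx]] : exists x, x <> b /\ ~ V x.
  have [x0b|] := EM (x0 = b); last by exists x0.
  exists (g x0); split; last by move=> Vg; apply: UV Vg; exact: gVU.
  by move=> gb; apply: Ux0; rewrite x0b -gb; exact: gVU.
apply: (tends_closed cU _ (attU_pt ab xb)).
by apply: filterS (Uf_ge 1%N) => -[//|k] _; exact: pp_pow.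
Qed.

End PingPong.

(** For [x] and [g x] both different from [b], the powers of [g] at [x] and at [g x] tend to [a],
    while the second sequence is the image under [g] of the first. *)
Lemma att_pow_fixed g a b : attU (fun k => g ^+ k) a b -> g a = a.
Proof.
move=> ab; have [x [xb xgb]] := pick_neq2 b (g^-1 b).
have gxb : g x <> b by move=> gxb; apply: xgb; rewrite -gxb hK.
apply: tends_uniq (tends_him g (attU_pt ab xb)) _.
apply: tends_eq (attU_pt ab gxb).
by apply: nearW => k; rewrite -!hM -expgS -expgSr.
Qed.

(** The powers of [g] attract to a point of [U], those of [g^-1] to a point of [V], and the latter
    is the repelling point of the former. Any other fixed point would be its own limit under the
    powers. *)
Lemma pp_loxodromic g (U V : set M) (x0 : M) : G g -> closed U -> closed V ->
  (forall x, U x -> V x -> False) -> (forall x, ~ V x -> U (g x)) ->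
  ~ U x0 -> ~ V x0 -> loxodromic g.
Proof.
move=> Gg cU cV UV gVU Ux0 Vx0.
have gUV x : ~ U x -> V (g^-1 x).
  by move=> Ux; apply: contrapT => /gVU; rewrite hVK.
have VU x : V x -> U x -> False by move=> Vx Ux; exact: UV Ux Vx.
have [a [b [ab Ua]]] := pp_att Gg cU UV gVU Ux0 Vx0.
have [b' [a' [ba Vb]]] := pp_att (subgV sG Gg) cV VU gUV Vx0 Ux0.
have ba2 : attU (fun k => g^-1 ^+ k) b a.
  by have := attUV ab; apply: attU_eq; apply: nearW => k; rewrite expVgn.
have bb' : b = b'.
  by have [x [xa xa']] := pick_neq2 a a'; exact: tends_uniq (attU_pt ba2 xa) (attU_pt ba xa').
have {}Vb : V b by rewrite bb'.
split; first by move=> /(elliptic_finite_order Gg)[n]; exact: (pp_infinite_order UV gVU Ux0 Vx0).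
exists a, b; split; first by move=> e; apply: UV Ua _; rewrite e.
apply/seteqP; split=> [x /= gx|x /= [->|->]].
- have [->|xb] := EM (x = b); [by right|left].
  have gkx k : (g ^+ k) x = x by elim: k => // k IHk; rewrite expgSr hM gx.
  by apply: tends_uniq (tends_cst x) _; apply: tends_eq (attU_pt ab xb); apply: nearW.
- exact: att_pow_fixed ab.
- by apply: (@h_inj _ g^-1); rewrite hK; exact/esym/(att_pow_fixed ba2).
Qed.

(* Small balls around [a] and [b] are in ping-pong position for [s k]. *)
Lemma att_loxodromic s a b : (forall k, G (s k)) -> attU s a b -> a <> b ->
  \forall k \near Uf, loxodromic (s k).
Proof.
move=> Gs sab ab; have [x [xa xb]] := pick_neq2 a b.
have [/mdist_pos xa0 /mdist_pos xb0 /mdist_pos ab0] := And3 xa xb ab.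
pose r := (Num.min (mdist a b) (Num.min (mdist x a) (mdist x b)) / 3)%R.
have r0 : (0 < r)%R by rewrite divr_gt0// !lt_min xa0 xb0 ab0.
have [rab rxa rxb] : [/\ (3 * r <= mdist a b)%R, (3 * r <= mdist x a)%R
                      & (3 * r <= mdist x b)%R].
  by rewrite /r mulrC mulfVK// !ge_min !lexx !orbT.
have cl (c : M) : closed [set z | (mdist z c <= r)%R].
  apply: closedP_mdist => y H /=; rewrite leNgt; apply/negP => yc.
  have [|z /= zr zy] := H (mdist y c - r)%R; first by rewrite subr_gt0.
  by have := mdist_tri z y c; rewrite (mdistC y z); lra.
apply: filterS (sab r r0) => k sk.
apply: (@pp_loxodromic _ _ _ x (Gs k) (cl a) (cl b)) => /=.
- move=> z za zb; have := mdist_tri z a b; rewrite (mdistC a z); lra.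
- move=> z /negP; rewrite -ltNge => /ltW /sk/ltW //.
- by apply/negP; rewrite -ltNge; lra.
- by apply/negP; rewrite -ltNge; lra.
Qed.

Lemma conjXg' g h n : (h * g * h^-1) ^+ n = h * g ^+ n * h^-1.
Proof.
elim: n => [|n IHn]; first by rewrite !expg0 mulg1 mulgV.
by rewrite !expgS IHn !mulgA mulgVK.
Qed.

Lemma elliptic_conj g h : G g -> elliptic g -> elliptic (h * g * h^-1).
Proof.
move=> Gg /(elliptic_finite_order Gg)[n gn]; apply: (@finite_order_elliptic _ n).
by rewrite conjXg' gn mulg1 mulgV.
Qed.

Lemma fixed_points_conj g h : fixed_points (h * g * h^-1) = h @` fixed_points g.
Proof.
apply/seteqP; split=> [x gx|_ [y gy <-]].
  have {}gx : h (g (h^-1 x)) = x := gx.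
  by exists (h^-1 x); rewrite ?hVK//; apply: (@h_inj _ h); rewrite hVK.
by change (h (g (h^-1 (h y))) = h y); rewrite hK gy.
Qed.

Lemma parabolic_conj g h : G g -> G h -> parabolic g -> parabolic (h * g * h^-1).
Proof.
move=> Gg Gh [eg [x gx]]; split.
  move=> /(@elliptic_conj _ h^-1); rewrite invgK !mulgA mulVg mul1g mulgVK.
  by move=> H; apply: eg; apply: H; apply: subgM (subgV _ _) => //; exact: subgM.
exists (h x); rewrite fixed_points_conj gx.
by apply/seteqP; split=> [_ [_ -> <-]|_ ->]; [|exists x].
Qed.

Lemma loxodromic_not_parabolic g : loxodromic g -> ~ parabolic g.
Proof.
move=> [_ [x [y [xy gxy]]]] [_ [z gz]]; apply: xy.
have: fixed_points g x by rewrite gxy; left.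
have: fixed_points g y by rewrite gxy; right.
by rewrite gz => -> ->.
Qed.

(** Compactness of [K] keeps the limits of [s k x] and [s k z] apart; the second is the attracting
    point, so [x] must be the repelling one. Conversely, convergence separates the images from some
    index on, and the finitely many earlier terms are handled by injectivity of homeomorphisms. *)
Lemma conicalP x : conical_limit_point G x <->
  limit_set G x /\ exists s b c, [/\ forall k, G (s k), ufree s, attU s b x,
     tends (fun k => s k x) c & b <> c].
Proof.
split=> [[Lx [s [si Gs] H]]|[Lx [s [b [c [Gs fs sbx sc bc]]]]]]; split=> //.
  have fs := inj_free si.
  have [a [b sab]] := conv_free Mc dG Gs fs.
  have [z [zx zb]] := pick_neq2 x b.
  have [K [cK Kd Ks]] := H _ zx.
  have sz := attU_pt sab zb.
  have := cK; rewrite compact_ultra => /(_ _ (ultra_img (fun k => (s k x, s k z)))).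
  case=> [|[p q] [/= Kpq cvpq]]; first by apply: img_Uf => k; exact: Ks.
  have sp : tends (fun k => s k x) p.
    apply/tendsP => A pA; have : nbhs (p, q) [set w | A w.1].
      by exists (A, setT) => /=; [split=> //; exact: filterT|move=> w []].
    by move=> /cvpq.
  have sq : tends (fun k => s k z) q.
    apply/tendsP => A qA; have : nbhs (p, q) [set w | A w.2].
      by exists (setT, A) => /=; [split=> //; exact: filterT|move=> w []].
    by move=> /cvpq.
  have qa : q = a := tends_uniq sq sz.
  have pa : p <> a.
    move=> pa; have : (K `&` diagonal) (p, q) by split=> //; rewrite /diagonal/= pa qa.
    by rewrite Kd.
  have xb : x = b := attU_rep sab (tends_cst x) sp pa.
  by exists s, a, p; split=> //; [rewrite xb|exact/nesym].
have H n : \forall k \near Uf, eatt (n.+1%:R^-1) b x (s k) /\ (mdist (s k x) c < n.+1%:R^-1)%R.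
  have n0 : (0 < n.+1%:R^-1 :> R)%R by rewrite invr_gt0 ltr0n.
  by apply: filterS2 (sbx _ n0) (sc _ n0) => k.
have [t [ti Ht]] := free_extract (P := fun n g => eatt (n.+1%:R^-1) b x g /\
    (mdist (g x) c < n.+1%:R^-1)%R) fs H.
have Gt k : G (t k) by have [_ [j ->]] := Ht k.
exists t => [//|z zx].
have /mdist_pos bc0 := bc; have /mdist_pos zx0 := zx.
have [N HN] : exists N, forall n, (N <= n)%N ->
    (mdist b c / 3 <= mdist (t n x) (t n z))%R.
  have m0 : (0 < Num.min (mdist b c / 3) (mdist z x))%R by rewrite lt_min zx0 andbT divr_gt0.
  have [N HN] := inv_small m0; exists N => n /HN; rewrite lt_min => /andP[n1 n2].
  have [[t1 t2] _] := Ht n.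
  have := lt_trans (t1 z (ltW n2)) n1; have := lt_trans t2 n1.
  have := mdist_tri (t n x) b c; have := mdist_tri (t n z) b (t n x).
  by rewrite (mdistC b (t n z)) (mdistC (t n z) (t n x)); lra.
have [e e0 He] : exists2 e : R, (0 < e)%R & forall k, (e <= mdist (t k x) (t k z))%R.
  have tk0 k : (0 < mdist (t k x) (t k z))%R.
    by apply: mdist_pos => /h_inj; exact/nesym.
  have [e e0 He] : exists2 e : R, (0 < e)%R &
      forall k, (k < N)%N -> (e <= mdist (t k x) (t k z))%R.
    elim: (N) => [|m [e e0 He]]; first by exists 1%R.
    exists (Num.min e (mdist (t m x) (t m z))); first by rewrite lt_min e0 tk0.
    move=> k; rewrite ltnS leq_eqVlt => /orP[/eqP->|/He ek].
      by rewrite ge_min lexx orbT.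
    by rewrite ge_min ek.
  exists (Num.min e (mdist b c / 3)%R); first by rewrite lt_min e0 divr_gt0.
  move=> k; rewrite ge_min; have [Nk|kN] := leqP N k; first by rewrite HN ?orbT.
  by rewrite He.
exists [set p : M * M | (e <= mdist p.1 p.2)%R]; split.
- have MM : compact [set: M * M] by rewrite -setXTT; exact: compact_setX.
  rewrite compact_ultra => F FU FK.
  have := MM; rewrite compact_ultra => /(_ _ FU filterT)[[p q] [_ /= Fpq]].
  exists (p, q); split=> //=; rewrite leNgt; apply/negP => pq.
  have r0 : (0 < (e - mdist p q) / 2)%R by rewrite divr_gt0// subr_gt0.
  have : nbhs (p, q) (ball p ((e - mdist p q) / 2)%R `*` ball q ((e - mdist p q) / 2)%R).
    by exists (ball p ((e - mdist p q) / 2)%R, ball q ((e - mdist p q) / 2)%R) => //=;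
      split; exact: nbhsx_ballx.
  move=> /Fpq/(filterI FK)/filter_ex[[p' q'] /= [pq' []]].
  rewrite !ballEmdist /= => pp qq.
  have := mdist_tri p p' q'; have := mdist_tri q p q'.
  by rewrite (mdistC p' p); lra.
- apply/seteqP; split=> // -[p q] [/= epq]; rewrite /diagonal/= => pq.
  by move: epq; rewrite pq mdistxx leNgt e0.
- by [].
Qed.

(** The conjugates [h k] fix [s k x], which tends to [c], and carry [s k z] to [s k (g z)], both
    tending to [b]. If [h] is constant along [Uf], a parabolic element fixes both [b] and [c].
    Otherwise [b] and [c] are, in some order, the attracting and repelling points of [h], which
    makes [h k] loxodromic by [att_loxodromic]. *)
Lemma parabolic_not_conical x : parabolic_point G x -> ~ conical_limit_point G x.
Proof.
move=> [_ [g [Gg pg gx]]] /conicalP[_ [s [b [c [Gs fs sbx sc bc]]]]].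
have fg y : g y = y -> y = x.
  have [_ [z gz]] := pg; move=> gy.
  have: fixed_points g x by []; have: fixed_points g y by [].
  by rewrite gz => -> ->.
pose h k := s k * g * (s k)^-1.
have Gh k : G (h k) by apply: subgM (subgV _ _) => //; exact: subgM.
have hpar k : parabolic (h k) by exact: parabolic_conj.
have hx k : h k (s k x) = s k x by rewrite /h !hM hK gx.
have [z [zx _]] := pick_neq2 x x.
have gzx : g z <> x by move=> gzx; apply: zx; apply: (@h_inj _ g); rewrite gzx gx.
have sz := attU_pt sbx zx; have hsz : tends (fun k => h k (s k z)) b.
  by apply: tends_eq (attU_pt sbx gzx); apply: nearW => k; rewrite /h !hM hK.
have hsx : tends (fun k => h k (s k x)) c by apply: tends_eq sc; apply: nearW.
have [[h0 _ hh0]|[_ [a [d had]]]] := conv_dich Mc dG Gh.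
  have fix_lim u y : tends u y -> tends (fun k => h k (u k)) y -> h0 y = y.
    move=> uy huy; apply: tends_uniq (tends_him h0 uy) _.
    by apply: tends_eq huy; apply: filterS hh0 => k ->.
  have [k hk] := Uf_ex hh0; have [_ [p hp]] := hpar k.
  have: fixed_points (h k) b by rewrite hk; exact: fix_lim sz hsz.
  have: fixed_points (h k) c by rewrite hk; exact: fix_lim sc hsx.
  by rewrite hp => cp bp; apply: bc; rewrite cp bp.
have ad : a <> d.
  have [cd|cd] := EM (c = d); last first.
    have ca := tends_uniq hsx (attU_lim had sc cd).
    have [bd|bd] := EM (b = d); first by rewrite -ca -bd; exact/nesym.
    by have := tends_uniq hsz (attU_lim had sz bd); rewrite -ca.
  have bd : b <> d by rewrite -cd.
  by rewrite -(tends_uniq hsz (attU_lim had sz bd)).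
have [k lk] := Uf_ex (att_loxodromic Gh had ad).
exact: loxodromic_not_parabolic lk (hpar k).
Qed.

Lemma conical_transl x g : G g -> conical_limit_point G x -> conical_limit_point G (g x).
Proof.
move=> Gg /conicalP[Lx [s [b [c [Gs fs sbx sc bc]]]]].
apply/conicalP; split; first exact/limit_set_inv.
exists (fun k => s k * g^-1), b, c; split=> //.
- by move=> k; apply: subgM => //; exact: subgV.
- by apply: (@free_comp _ _ (fun h : homeo M => h * g^-1)) fs => h h' /mulIg.
- by have := attU_mulr g^-1 sbx; rewrite invgK.
- by apply: tends_eq sc; apply: nearW => k; rewrite hM hK.
Qed.

Lemma parabolic_point_transl x g : G g -> parabolic_point G x -> parabolic_point G (g x).
Proof.
move=> Gg [Lx [h [Gh ph hx]]]; split; first exact/limit_set_inv.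
exists (g * h * g^-1); split; [|exact: parabolic_conj|by rewrite !hM hK hx].
by apply: subgM (subgV _ _) => //; exact: subgM.
Qed.

End Elements.

Lemma openP_mdist (R : realType) (M : metricType R) (W : set M) :
  (forall w, W w -> exists2 e : R, (0 < e)%R & forall w', (mdist w' w < e)%R -> W w') ->
  open W.
Proof.
move=> H; rewrite openE => w /H[e e0 He]; apply/nbhs_ballP; exists e => // w'.
by rewrite ballEmdist/= mdistC => /He.
Qed.

(** * Bounded parabolic points without quotient spaces *)

Section Bounded.
Local Open Scope quotient_scope.
Variables (R : realType) (M : metricType R) (Mc : compact [set: M]).
Implicit Types (x y z : M) (g h : homeo M).
Variables (G : set (homeo M)) (sG : subgroup G).

(* For a parabolic point [x], this is the compactness of (L(G) \ x) / Stab(x). *)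
Definition bdd x := exists2 d : R, (0 < d)%R &
  forall y, limit_set G y -> y <> x -> exists t, [/\ G t, t x = x & (d <= mdist (t y) x)%R].

Lemma h_away g (d : R) x : (0 < d)%R -> exists2 e : R, (0 < e)%R &
  forall z, (d <= mdist z x)%R -> (e <= mdist (g z) (g x))%R.
Proof.
move=> d0; have [e e0 H] := h_unif g^-1 (g x) d0; exists e => // z dz.
by rewrite leNgt; apply/negP => /H; rewrite !hK ltNge dz.
Qed.

Let A x := limit_set G `\ x.
Let piA x (y : set_type (A x)) : orbit_space (stabilizer G x) (A x) :=
  \pi_(orbit_space (stabilizer G x) (A x)) y.

Let stab_subgroup x : subgroup (stabilizer G x).
Proof.
split; first by apply/mem_set; split=> //; exact: subg1.
move=> g h /set_mem[Gg gx] /set_mem[Gh hx]; apply/mem_set; split; first exact: subgF.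
by rewrite hM -{1}hx hK.
Qed.

Let piAP x (y z : set_type (A x)) : piA y = piA z <->
  exists2 t, stabilizer G x t & t (val y) = val z.
Proof.
split=> [/eqmodP/asboolP H|[t tS tyz]].
  have : Defs.orbit (stabilizer G x) (val z) (val z) by exists 1 => //; exact: subg1.
  by rewrite -H => -[t tS <-]; exists t.
apply/eqmodP/asboolP; apply/seteqP; split=> _ [h hS <-].
  exists (h * t^-1); first exact: subgF.
  by rewrite hM -tyz hK.
by exists (h * t); [exact: subgM|rewrite hM tyz].
Qed.

Lemma bddP x : compact [set: orbit_space (stabilizer G x) (A x)] <-> bdd x.
Proof.
split=> [cO|[d d0 H]].
  apply: contrapT => nb.
  have /choice[y Hy] : forall n, exists y : set_type (A x),
      forall t, G t -> t x = x -> (mdist (t (val y)) x < n.+1%:R^-1)%R.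
    move=> n; apply: contrapT => nH; apply: nb.
    exists (n.+1%:R^-1)%R; first by rewrite invr_gt0 ltr0n.
    move=> y Ly yx; apply: contrapT => nt; apply: nH.
    have Ay : A x y by [].
    exists (SigSub (mem_set Ay)) => t Gt tx /=; rewrite ltNge; apply/negP => ty.
    by apply: nt; exists t.
  have := cO; rewrite compact_ultra => /(_ _ (ultra_img (fun n => piA (y n))) filterT).
  move=> [q [_ /= cvq]].
  have [z qz] : exists z : set_type (A x), q = piA z by exists (repr q); rewrite /piA reprK.
  have Az : A x (val z) by exact: set_valP.
  have zx0 : (0 < mdist (val z) x / 2)%R by rewrite divr_gt0// mdist_pos//; exact: Az.2.
  pose r := (mdist (val z) x / 2)%R.
  (* The orbits having a point at distance more than [r] from [x] form an open neighbourhood of [q];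
     the orbit of [y n] is not among them once 1/(n+1) < [r]. *)
  pose W := [set q' : orbit_space (stabilizer G x) (A x) |
     exists2 y' : set_type (A x), q' = piA y' &
       exists t, [/\ G t, t x = x & (r < mdist (t (val y')) x)%R]].
  have openW : open W.
    exists [set w | exists t, [/\ G t, t x = x & (r < mdist (t w) x)%R]].
      apply: openP_mdist => w [t [Gt tx rt]].
      have e0 : (0 < mdist (t w) x - r)%R by rewrite subr_gt0.
      have [e e1 He] := h_unif t w e0; exists e => // w' /He tw'.
      exists t; split=> //; have := mdist_tri (t w') (t w) x.
      by rewrite (mdistC (t w) (t w')); lra.
    apply/seteqP; split=> w /=.
      by move=> [t Ht]; exists w => //; exists t.
    move=> [y' /piAP[t [Gt tx] tyw] [t' [Gt' t'x rt']]].
    by exists (t' * t); split; [exact: subgM|rewrite hM tx|rewrite hM tyw].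
  have nW : nbhs q W.
    apply: open_nbhs_nbhs; split=> //; exists z => //; exists 1; split=> //.
      exact: subg1.
    by rewrite h1 /r ltr_pdivrMr// ltr_pMr ?mdist_pos ?ltr1n//; exact: Az.2.
  have r0 : (0 < r)%R by [].
  have [n [Wn nr]] := Uf_ex2 (cvq _ nW) (Uf_inv_small r0).
  have [y' /piAP[t [Gt tx] ty] [t' [Gt' t'x rt']]] := Wn.
  have := Hy n (t' * t) (subgM sG Gt' Gt); rewrite !hM tx ty => /(_ t'x) H.
  by have := lt_trans rt' (lt_trans H nr); rewrite ltxx.
(* The hypothesis makes this compact set meet every orbit, so it maps onto the orbit space. *)
pose C := [set y : set_type (A x) | (d <= mdist (val y) x)%R].
have cC : compact C.
  rewrite compact_ultra => F FU FC.
  have UF : UltraFilter ((val : set_type (A x) -> M) @ F).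
    apply: Build_UltraFilter => K KF sK; apply/seteqP; split=> // B KB.
    have [//|nB] := in_ultra_setVsetC (val @^-1` B) FU.
    have KnB : K (~` B) by apply: sK.
    by have [w []] := filter_ex (filterI KB KnB).
  have := Mc; rewrite compact_ultra => /(_ _ UF filterT)[m [_ /= Fm]].
  have Lm : limit_set G m.
    apply: (closed_cvg _ (limit_set_closed Mc (G := G)) _ _ Fm).
    by apply: filterE => w; have [] := set_valP w.
  have dm : (d <= mdist m x)%R.
    exact: (closed_cvg (fun m => d <= mdist m x)%R (closed_far (e := d)) FC _ Fm).
  have Am : A x m by split=> // mx; move: dm; rewrite mx mdistxx leNgt d0.
  exists (SigSub (mem_set Am)); split=> // B [/= _ [[V opV <-] /= Vm] VB].
  apply: filterS VB _; apply: Fm; exact: open_nbhs_nbhs.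
have -> : [set: orbit_space (stabilizer G x) (A x)] = @piA x @` C.
  apply/seteqP; split=> // q _.
  have [z qz] : exists z : set_type (A x), q = piA z by exists (repr q); rewrite /piA reprK.
  have [Lz zx] := set_valP z; have [t [Gt tx dt]] := H _ Lz zx.
  have At : A x (t (val z)).
    by split; [exact/limit_set_inv|move=> tz; move: dt; rewrite tz mdistxx leNgt d0].
  exists (SigSub (mem_set At)) => //; rewrite qz; apply/esym/piAP.
  by exists t.
apply: continuous_compact cC; apply: continuous_subspaceT; exact: pi_continuous.
Qed.

Lemma boundedP x : bounded_parabolic_point G x <-> parabolic_point G x /\ bdd x.
Proof. by split=> -[px H]; split=> //; exact/bddP. Qed.

Lemma bdd_transl x g : G g -> bdd x -> bdd (g x).
Proof.
move=> Gg [d d0 H]; have [e e0 He] := h_away g x d0; exists e => // y Ly ygx.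
have Lgy : limit_set G (g^-1 y) by apply/(limit_set_inv Mc _ sG Gg); rewrite hVK.
have [|t [Gt tx dt]] := H _ Lgy; first by move=> gy; apply: ygx; rewrite -gy hVK.
exists (g * t * g^-1); split; [|by rewrite !hM hK tx|by rewrite !hM; exact: He].
by apply: subgM (subgV _ _) => //; exact: subgM.
Qed.

End Bounded.

Section Parabolic.
Variables (R : realType) (M : metricType R) (Mc : compact [set: M]).
Implicit Types (x y z : M) (g h : homeo M).
Variable M3 : exists x y z : M, [/\ x <> y, y <> z & x <> z].
Variables (G : set (homeo M)) (sG : subgroup G) (dG : discrete_convergence_group G).

(** The elements that keep a fixed triple 1/(n+1)-separated are finite in number: an attracting
    sequence brings together the images of any two of the three points that avoid its repelling
    point. *)
Lemma discrete_countable : countable G.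
Proof.
have [x [y [z [xy yz xz]]]] := M3.
pose A (n : nat) := [set g | [/\ G g, (n.+1%:R^-1 <= mdist (g x) (g y))%R,
  (n.+1%:R^-1 <= mdist (g y) (g z))%R & (n.+1%:R^-1 <= mdist (g x) (g z))%R]].
have -> : G = \bigcup_n A n.
  apply/seteqP; split=> [g Gg|g [n _ []]//].
  have gne a b : a <> b -> (0 < mdist (g a) (g b))%R by move=> ab; apply: mdist_pos => /h_inj.
  pose e := Num.min (mdist (g x) (g y)) (Num.min (mdist (g y) (g z)) (mdist (g x) (g z))).
  have e0 : (0 < e)%R by rewrite !lt_min !gne.
  have [n /(_ n (leqnn n)) /ltW] := inv_small e0.
  by rewrite !le_min => /and3P[? ? ?]; exists n.
apply: bigcup_countable => // n _; apply: finite_set_countable.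
have n0 : (0 < n.+1%:R^-1 :> R)%R by rewrite invr_gt0 ltr0n.
apply: (fin_by_att Mc dG) => [g []//|s sA fs a b sab].
have far c d : c <> b -> d <> b ->
    (forall k, (n.+1%:R^-1 <= mdist (s k c) (s k d))%R) -> False.
  move=> cb db H; have := tends_far (attU_pt sab cb) (attU_pt sab db).
  by move=> /(_ n.+1%:R^-1%R); rewrite mdistxx leNgt n0 => H'; suff: false by []; apply: H'; exact: nearW.
have sxy k : (n.+1%:R^-1 <= mdist (s k x) (s k y))%R by have [] := sA k.
have syz k : (n.+1%:R^-1 <= mdist (s k y) (s k z))%R by have [] := sA k.
have sxz k : (n.+1%:R^-1 <= mdist (s k x) (s k z))%R by have [] := sA k.
have [xb|xb] := EM (x = b).
  by apply: (far _ _ _ _ syz); rewrite -xb; exact/nesym.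
have [yb|yb] := EM (y = b); last exact: far xb yb sxy.
by apply: far xb _ sxz; rewrite -yb; exact/nesym.
Qed.

(** A parabolic element determines its fixed point. Countability is what allows parabolic points to
    number separator classes. *)
Lemma parabolic_countable : countable [set x | parabolic_point G x].
Proof.
have /countable_injP[c cinj] := discrete_countable.
have /choice[F HF] : forall x, exists g, parabolic_point G x -> G g /\ fixed_points g = [set x].
  move=> x; have [[_ [g [Gg [_ [y gy]] gx]]]|np] := EM (parabolic_point G x).
    exists g => _; split=> //; have : fixed_points g x by [].
    by rewrite gy => ->.
  by exists 1.
apply/countable_injP; exists (c \o F) => x y /set_mem/HF[Gx xE] /set_mem/HF[Gy yE] /= cxy.
have xy := cinj _ _ (mem_set Gx) (mem_set Gy) cxy.
have : fixed_points (F x) x by rewrite xE.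
by rewrite xy yE.
Qed.

(* Tracking a parabolic, hence not conical, point among [x] and [g x] keeps the
   attracting point of the adjusted sequence away from [x]. *)
Lemma bdd_push x g (s : nat -> homeo M) : parabolic_point G x -> bdd G x ->
  G g -> g x <> x -> (forall k, G (s k)) ->
  exists t : nat -> homeo M, [/\ forall k, G (t k), forall k, t k x = x &
    (exists2 h, G h & \forall k \near Uf, t k * s k = h) \/
    (exists a b, [/\ ufree (fun k => t k * s k), attU (fun k => t k * s k) a b & a <> x])].
Proof.
move=> px [d d0 Hd] Gg gx Gs; have [Lx _] := px.
pose pt (b : bool) := if b then x else g x.
have Lpt b : limit_set G (pt b) by case: b => //=; exact/limit_set_inv.
have ppt b : parabolic_point G (pt b) by case: b => //=; exact: parabolic_point_transl.
have /choice[bt Hbt] : forall k, exists bt : bool * homeo M,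
    [/\ G bt.2, bt.2 x = x & (d <= mdist (bt.2 (s k (pt bt.1))) x)%R].
  move=> k; have [b sb] : exists b, s k (pt b) <> x.
    have [sx|sx] := EM (s k x = x); last by exists true.
    by exists false => /= sgx; apply: gx; apply: (@h_inj _ (s k)); rewrite sgx sx.
  have Lb : limit_set G (s k (pt b)) by apply/limit_set_inv.
  by have [t [Gt tx dt]] := Hd _ Lb sb; exists (b, t).
pose t k := (bt k).2; have Gt k : G (t k) by have [] := Hbt k.
exists t; split=> // [k|]; first by have [] := Hbt k.
have Gts k : G (t k * s k) by exact: subgM.
have [|[fts [a [r ar]]]] := conv_dich Mc dG Gts; first by left.
right; exists a, r; split=> // ax.
have [b bE] := Uf_bool (fun k => (bt k).1).
have [c tc] := Uconv Mc (fun k => (t k * s k) (pt b)).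
have cx : c <> x.
  apply: (tends_neq d0 _ tc); apply: filterS bE => k kb.
  by have [_ _] := Hbt k; rewrite kb.
have ptr : pt b = r by apply: (attU_rep ar (tends_cst _) tc); rewrite ax.
apply: (parabolic_not_conical Mc M3 sG dG (ppt b)); apply/conicalP => //.
split=> //; exists (fun k => t k * s k), a, c; split=> //; first by rewrite ptr.
by rewrite ax; exact/nesym.
Qed.

End Parabolic.

(** * Cocompactness outside the limit set *)

Section Weights.
Variable R : realType.
Local Open Scope ring_scope.

(** A diagonal choice: [D i] dominates [C m i] as soon as [m <= i], so those terms are at most 2^-i
    and sum to at most 2. The first [m] terms are bounded by [C m i] because [w i <= 1]. *)
Lemma weights_exist (C : nat -> nat -> nat) : exists2 w : nat -> R,
  (forall i, 0 < w i <= 1) &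
  forall m, exists2 B, 0 <= B & forall N, \sum_(i < N) w i * (C m i)%:R <= B.
Proof.
pose D i := (1 + \sum_(m < i.+1) C m i)%N.
pose w i : R := 2^-1 ^+ i / (D i)%:R.
have D0 i : 0 < (D i)%:R :> R by rewrite ltr0n.
have p0 i : 0 < 2^-1 ^+ i :> R by rewrite exprn_gt0// invr_gt0.
have p1 i : 2^-1 ^+ i <= 1 :> R by rewrite exprn_ile1// ?invr_ge0// invf_le1// ler1n.
exists w => [i|m].
  rewrite divr_gt0//= ler_pdivrMr// mul1r (le_trans (p1 i))// ler1n.
  by rewrite /D addSn.
exists (2 + \sum_(i < m) (C m i)%:R); first by rewrite addr_ge0// sumr_ge0.
have bound i : w i * (C m i)%:R <= 2^-1 ^+ i + (if (i < m)%N then (C m i)%:R else 0).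
  have [im|mi] := ltnP i m.
    apply: ler_wpDl; first exact: ltW.
    rewrite ler_piMl// /w ler_pdivrMr// mul1r (le_trans (p1 i))// ler1n.
    by rewrite /D addSn.
  rewrite addr0 /w mulrAC ler_pdivrMr// ler_pM2l// ler_nat /D.
  rewrite (bigD1 (Ordinal (mi : m < i.+1)%N))//= addnCA.
  exact: leq_addr.
move=> N; apply: (le_trans (ler_sum _ (fun i _ => bound (val i)))).
rewrite big_split/= lerD//.
  have -> : \sum_(i < N) 2^-1 ^+ i = 2 - 2 * 2^-1 ^+ N :> R.
    elim: N => [|N IHN]; first by rewrite big_ord0 expr0 mulr1 subrr.
    by rewrite big_ord_recr/= IHN exprS; set q := _ ^+ N; lra.
  by rewrite gerBl mulr_ge0// ltW.
rewrite -big_mkcond/= -(big_mkord (fun i => i < m)%N (fun i => (C m i)%:R)).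
rewrite -(big_mkord xpredT (fun i => (C m i)%:R)).
rewrite (big_nat_widen _ _ (N + m))?leq_addr// [leRHS](big_nat_widen _ _ (N + m)) ?leq_addl//.
rewrite big_mkcond [leRHS]big_mkcond/=; apply: ler_sum => i _.
by case: (i < m)%N => //=; case: ifP.
Qed.

Lemma fin_card (T : choiceType) (A : set T) : finite_set A ->
  exists N, forall l : seq T, uniq l -> (forall x, x \in l -> A x) -> (size l <= N)%N.
Proof.
move=> /finite_seqP[l ->]; exists (size l) => l' ul' sub.
by apply: uniq_leq_size => // x /sub.
Qed.

End Weights.

(** * Separators, chains and the potential *)

Section Separators.
Variables (R : realType) (M : metricType R) (Mc : compact [set: M]).
Implicit Types (x z a b p q u v : M) (g h : homeo M).
Variables (J : set (homeo M)) (sJ : subgroup J) (dJ : discrete_convergence_group J).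
Let L := limit_set J.
Variables (y : nat -> M) (yL : forall k, ~ L (y k)).
Let y0 := y 0%N.

Lemma LinvP g x : J g -> L (g x) <-> L x. Proof. exact: limit_set_inv. Qed.

Lemma fin_move2 x z (e : R) : ~ L x -> ~ L z -> (0 < e)%R ->
  finite_set [set g | J g /\ (e <= mdist ((g^-1)%g x) ((g^-1)%g z))%R].
Proof.
move=> xL zL e0; apply: (fin_by_att Mc dJ) => [g []//|s sA fs a b sab].
have La : L a by apply: att_limit_set sab => // k; have [] := sA k.
have ne w : ~ L w -> w <> a by move=> wL wa; apply: wL; rewrite wa.
have := tends_far (attU_pt (attUV sab) (ne x xL)) (attU_pt (attUV sab) (ne z zL)).
move=> /(_ e); rewrite mdistxx leNgt e0 => H; suff: false by [].
by apply: H; apply: nearW => k; have [] := sA k.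
Qed.

(** As [z] and [w] vary with the element, their limits stay [d] apart, so at least one of them
    differs from the attracting point [a]. The inverses then bring it together with [x], which is
    not [a] either, being outside [L]. *)
Lemma fin_move3 x (e d : R) : ~ L x -> (0 < e)%R -> (0 < d)%R ->
  finite_set [set g | J g /\ exists z w, [/\ (d <= mdist z w)%R,
     (e <= mdist ((g^-1)%g x) ((g^-1)%g z))%R & (e <= mdist ((g^-1)%g x) ((g^-1)%g w))%R]].
Proof.
move=> xL e0 d0; apply: (fin_by_att Mc dJ) => [g []//|s sA fs a b sab].
have La : L a by apply: att_limit_set sab => // k; have [] := sA k.
have xa : x <> a by move=> xa; apply: xL; rewrite xa.
have /choice[z /choice[w Hzw]] := fun k => (sA k).2.
have [z' zz'] := Uconv Mc z; have [w' ww'] := Uconv Mc w.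
have zw' : (d <= mdist z' w')%R.
  by apply: tends_far zz' ww' _; apply: nearW => k; have [] := Hzw k.
have far c c' : tends c c' -> c' <> a ->
    (\forall k \near Uf, (e <= mdist ((s k)^-1%g x) ((s k)^-1%g (c k)))%R) -> False.
  move=> cc' c'a /(tends_far (attU_pt (attUV sab) xa) (attU_lim (attUV sab) cc' c'a)).
  by rewrite mdistxx leNgt e0.
have [za|za] := EM (z' = a).
  apply: (far _ _ ww') => [wa|].
    by move: zw'; rewrite za wa mdistxx leNgt d0.
  by apply: nearW => k; have [] := Hzw k.
by apply: (far _ _ zz' za); apply: nearW => k; have [] := Hzw k.
Qed.

(* How deep a ball around [p] must be for it to be insensitive to all the
   translates keeping [y0] at distance at least [r] from [p]. *)
Definition sparse p (r r' : R) n := [/\ (0 < r' < r)%R,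
  forall g, J g -> (r <= mdist (g y0) p)%R ->
    forall z w, (n.+1%:R^-1 <= mdist z w)%R ->
      (mdist (g z) p <= r')%R -> (mdist (g w) p <= r')%R -> False,
  forall g, J g -> (r <= mdist (g y0) p)%R ->
    forall i, (i <= n)%N -> (mdist (g (y i)) p <= r')%R -> False &
  exists z, (r' < mdist z p < r)%R].

Lemma tends_small (u : nat -> M) p : (forall k, (mdist (u k) p <= k.+1%:R^-1)%R) ->
  tends u p.
Proof.
by move=> H e /Uf_inv_small; apply: filterS => k; exact: le_lt_trans.
Qed.

(** If no radius worked, some [g k] would bring to [p] two sequences with distinct limits, or one of
    the finitely many [y i]. Then [p] is the attracting point, so [g k y0] tends to [p] too, against
    the distance [r]. *)
Lemma sparse_exists p r n : L p -> (0 < r)%R -> exists r', sparse p r r' n.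
Proof.
move=> Lp r0.
have y0b b : L b -> y0 <> b by move=> Lb yb; apply: (yL (k := 0%N)); rewrite -/y0 yb.
have [r1 r10 H1] : exists2 r1 : R, (0 < r1)%R & forall g, J g ->
    (r <= mdist (g y0) p)%R -> forall z w, (n.+1%:R^-1 <= mdist z w)%R ->
      (mdist (g z) p <= r1)%R -> (mdist (g w) p <= r1)%R -> False.
  apply: contrapT => H.
  have /choice[g /choice[z /choice[w Hw]]] : forall k : nat, exists g z w,
      [/\ J g, (r <= mdist (g y0) p)%R, (n.+1%:R^-1 <= mdist z w)%R,
          (mdist (g z) p <= k.+1%:R^-1)%R & (mdist (g w) p <= k.+1%:R^-1)%R].
    move=> k; apply: contrapT => nk; apply: H.
    exists (k.+1%:R^-1)%R; first by rewrite invr_gt0 ltr0n.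
    by move=> g Jg gr z w zw gz gw; apply: nk; exists g, z, w.
  have gz : tends (fun k => g k (z k)) p by apply: tends_small => k; have [] := Hw k.
  have gw : tends (fun k => g k (w k)) p by apply: tends_small => k; have [] := Hw k.
  have [z' zz'] := Uconv Mc z; have [w' ww'] := Uconv Mc w.
  have zw' : z' <> w'.
    move=> zw'; have : (n.+1%:R^-1 <= mdist z' w')%R.
      by apply: tends_far zz' ww' _; apply: nearW => k; have [] := Hw k.
    by rewrite zw' mdistxx leNgt invr_gt0 ltr0n.
  have Jg k : J (g k) by have [] := Hw k.
  have [[g0 Jg0 gg0]|[fg [a [b gab]]]] := conv_dich Mc dJ Jg.
    apply: zw'; apply: (@h_inj _ g0).
    have lim c c' : tends c c' -> tends (fun k => g k (c k)) p -> g0 c' = p.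
      move=> cc' gc; apply: tends_uniq (tends_him g0 cc') _.
      by apply: tends_eq gc; apply: filterS gg0 => k ->.
    by rewrite (lim _ _ zz' gz) (lim _ _ ww' gw).
  have pa : p = a.
    have [zb|zb] := EM (z' = b); last exact: tends_uniq gz (attU_lim gab zz' zb).
    by apply: tends_uniq gw (attU_lim gab ww' _); rewrite -zb; exact/nesym.
  have Lb : L b by exact: rep_limit_set gab.
  apply: (tends_neq r0 _ (attU_pt gab (y0b b Lb)) (esym pa)).
  by apply: nearW => k; have [] := Hw k.
have [r2 r20 H2] : exists2 r2 : R, (0 < r2)%R & forall g, J g ->
    (r <= mdist (g y0) p)%R -> forall i, (i <= n)%N -> (mdist (g (y i)) p <= r2)%R -> False.
  apply: contrapT => H.
  have /choice[g /choice[i Hi]] : forall k : nat, exists g i,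
      [/\ J g, (r <= mdist (g y0) p)%R, (i <= n)%N & (mdist (g (y i)) p <= k.+1%:R^-1)%R].
    move=> k; apply: contrapT => nk; apply: H.
    exists (k.+1%:R^-1)%R; first by rewrite invr_gt0 ltr0n.
    by move=> g Jg gr i ni gy; apply: nk; exists g, i.
  have gy : tends (fun k => g k (y (i k))) p by apply: tends_small => k; have [] := Hi k.
  have Jg k : J (g k) by have [] := Hi k.
  have [|i0 _ ii0] := @Uf_fin _ `I_n.+1 i (finite_II n.+1).
    by apply: nearW => k; have [_ _ ? _] := Hi k; rewrite /= ltnS.
  have {}gy : tends (fun k => g k (y i0)) p.
    by apply: tends_eq gy; apply: filterS ii0 => k ->.
  have [[g0 Jg0 gg0]|[fg [a [b gab]]]] := conv_dich Mc dJ Jg.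
    apply: (yL (k := i0)); apply/(LinvP _ Jg0).
    rewrite (tends_const gy (a := g0 (y i0))) in Lp => //.
    by apply: filterS gg0 => k ->.
  have Lb : L b by exact: rep_limit_set gab.
  have pa : p = a.
    by apply: tends_uniq gy (attU_pt gab _) => yb; apply: (yL (k := i0)); rewrite yb.
  apply: (tends_neq r0 _ (attU_pt gab (y0b b Lb)) (esym pa)).
  by apply: nearW => k; have [] := Hi k.
(* Translates of [y0] approach [p] without reaching it, since [y0] is outside [L]. One of them is
   kept as the point between the radii in the last clause of [sparse]. *)
have [s [b [Js fs sab]]] := (limit_setP Mc J p).1 Lp.
have Lb : L b by exact: rep_limit_set sab.
have [k kr] := Uf_ex (attU_pt sab (y0b b Lb) r0).
have k0 : (0 < mdist (s k y0) p)%R.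
  apply: mdist_pos => sp; apply: (yL (k := 0%N)); apply/(LinvP _ (Js k)).
  by rewrite -/y0 sp.
exists (Num.min (Num.min r1 r2) (mdist (s k y0) p / 2)%R).
set r' := Num.min _ _.
have r'0 : (0 < r')%R by rewrite !lt_min r10 r20 divr_gt0.
have [r'1 r'2 r'3] : [/\ (r' <= r1)%R, (r' <= r2)%R & (r' <= mdist (s k y0) p / 2)%R].
  by rewrite /r' !ge_min !lexx !orbT.
have r'k : (r' < mdist (s k y0) p)%R by apply: le_lt_trans r'3 _; lra.
split.
- by rewrite r'0 (lt_trans r'k kr).
- move=> g Jg gr z w zw gz gw.
  exact: H1 Jg gr z w zw (le_trans gz r'1) (le_trans gw r'1).
- by move=> g Jg gr i ni gi; apply: H2 Jg gr i ni (le_trans gi r'2).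
- by exists (s k y0); rewrite r'k.
Qed.

Variables (Par : set M) (ParL : Par `<=` L) (Parc : countable Par).

Let parcode : M -> nat := sval (cid (elimT (countable_injP Par) Parc)).

Let parcode_inj p q : Par p -> Par q -> parcode p = parcode q -> p = q.
Proof.
by move=> Pp Pq; apply: (svalP (cid (elimT (countable_injP Par) Parc))); exact: mem_set.
Qed.

Let next_ex : exists f : M * R * nat -> R, forall p r n, Par p -> (0 < r)%R ->
  sparse p r (f (p, r, n)) n.
Proof.
have /choice[f Hf] : forall prn : M * R * nat, exists r', Par prn.1.1 ->
    (0 < prn.1.2)%R -> sparse prn.1.1 prn.1.2 r' prn.2.
  move=> [[p r] n] /=; have [[Pp r0]|nH] := EM (Par p /\ (0 < r)%R).
    by have [r' H] := sparse_exists n (ParL Pp) r0; exists r'.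
  by exists 0%R => Pp r0; case: nH.
by exists f => p r n Pp r0; exact: (Hf (p, r, n)).
Qed.

Let next := sval (cid next_ex).

(** Starting at the distance of [y0] lets the annuli around [p] begin a chain based at [y0]. *)
Fixpoint rho p (n : nat) : R := if n is m.+1 then next (p, rho p m, m) else mdist y0 p.

Lemma rho_gt0 p n : Par p -> (0 < rho p n)%R.
Proof.
move=> Pp; elim: n => [|n IHn] /=.
  by apply: mdist_pos => yp; apply: (yL (k := 0%N)); rewrite -/y0 yp; exact: ParL.
by have [/andP[]] := svalP (cid next_ex) p (rho p n) n Pp IHn.
Qed.

Lemma rho_sparse p n : Par p -> sparse p (rho p n) (rho p n.+1) n.
Proof. by move=> Pp; apply: (svalP (cid next_ex)) => //; exact: rho_gt0. Qed.

(* The separating pairs (P, Q), sorted by classes. Class 2n consists of the pairs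
   at distance at least 1/(n+1); class 2c+1 is the nested family of annuli
   around the parabolic point with code c. *)
Definition sep (i j : nat) (P Q : set M) : Prop :=
  if odd i then exists p, [/\ Par p, parcode p = i./2,
      P = [set z | (mdist z p <= rho p j.+1)%R] & Q = [set z | (rho p j <= mdist z p)%R]]
  else [/\ j = 0%N, forall x z, P x -> Q z -> (i./2.+1%:R^-1 <= mdist x z)%R,
      ~ P y0 & ~ Q y0].

Lemma sep_far i j : exists2 e : R, (0 < e)%R & forall P Q, sep i j P Q ->
  forall x z, P x -> Q z -> (e <= mdist x z)%R.
Proof.
rewrite /sep; case: (odd i); last first.
  exists (i./2.+1%:R^-1)%R; first by rewrite invr_gt0 ltr0n.
  by move=> P Q [].
have [[p [Pp pi]]|np] := EM (exists p, Par p /\ parcode p = i./2); last first.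
  by exists 1%R => // P Q [p [Pp pi _ _]]; case: np; exists p.
have [/andP[r0 r1] _ _ _] := rho_sparse j Pp.
exists (rho p j - rho p j.+1)%R; first by rewrite subr_gt0.
move=> P Q [q [Pq qi -> ->]] x z /=.
have -> : q = p by apply: parcode_inj => //; rewrite pi qi.
by move=> xp zp; have := mdist_tri x z p; rewrite (mdistC z x); lra.
Qed.

(** This prevents repetitions in a chain ([chain_uniq]): for nested members with equal keys, the
    complement of one far set would lie in the other near set. *)
Lemma sep_cover i j P Q P' Q' : sep i j P Q -> sep i j P' Q' ->
  exists z, ~ P z /\ ~ Q' z.
Proof.
rewrite /sep; case: ifP => _; last by move=> [_ _ yP _] [_ _ _ yQ]; exists y0.
move=> [p [Pp pi -> _]] [q [Pq qi _ ->]].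
have -> : q = p by apply: parcode_inj => //; rewrite pi qi.
have [_ _ _ [z /andP[z1 z2]]] := rho_sparse j Pp; exists z => /=.
by split; apply/negP; rewrite -ltNge.
Qed.

(** Only the index and the group element are recorded, and the sets are quantified away, so that
    finiteness bounds the number of keys occurring in a chain. *)
Definition bad2 m i := [set k : nat * homeo M | J k.2 /\ exists P Q z w,
  [/\ sep i k.1 P Q, Q ((k.2^-1)%g y0), (m.+1%:R^-1 <= mdist z w)%R,
      P ((k.2^-1)%g z) & P ((k.2^-1)%g w)]].

Definition bad1 m i := [set k : nat * homeo M | J k.2 /\ exists P Q,
  [/\ sep i k.1 P Q, Q ((k.2^-1)%g y0) & P ((k.2^-1)%g (y m))]].

Let fin_sub (m : nat) (A : nat -> set (homeo M)) (K : set (nat * homeo M)) :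
  (forall j, finite_set (A j)) -> (forall k, K k -> (k.1 <= m)%N /\ A k.1 k.2) ->
  finite_set K.
Proof.
move=> Afin KA.
apply: (@sub_finite_set _ _ (\bigcup_(j in `I_m.+1) [set (j, g) | g in A j])).
  by move=> [j g] /KA[/= jm Ajg]; exists j; [rewrite /= ltnS|exists g].
by apply: bigcup_finite => [|j _]; [exact: finite_II|exact: finite_image].
Qed.

(** Sparseness of the annuli rules out every index [j > m]; for each remaining [j] the gap from
    [sep_far] makes [fin_move3] applicable. *)
Lemma bad2_fin m i : finite_set (bad2 m i).
Proof.
have m0 : (0 < m.+1%:R^-1 :> R)%R by rewrite invr_gt0 ltr0n.
pose A (j : nat) := [set g : homeo M | J g /\ exists P Q z w,
  [/\ sep i j P Q, Q ((g^-1)%g y0), (m.+1%:R^-1 <= mdist z w)%R,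
      P ((g^-1)%g z) & P ((g^-1)%g w)]].
apply: (@fin_sub m A) => [j|[j g] [Jg H]] /=; last first.
  split=> //; have [P [Q [z [w [+ yQ zw zP wP]]]]] := H.
  rewrite /sep /=; case: ifP => _ [] => [p [Pp _ PE QE]|j0 _ _ _]; last by rewrite j0.
  rewrite leqNgt; apply/negP => mj.
  have [_ S1 _ _] := rho_sparse j Pp; move: yQ zP wP; rewrite PE QE /=.
  move=> /(S1 _ (subgV sJ Jg)) /(_ z w) + zP wP; apply => //.
  by apply: le_trans zw; rewrite lef_pV2 ?posrE ?ltr0n// ler_nat ltnS ltnW.
have [e e0 He] := sep_far i j.
apply: sub_finite_set (fin_move3 (yL (k := 0%N)) e0 m0) => g.
move=> [Jg [P [Q [z [w [sPQ yQ zw zP wP]]]]]]; split=> //; exists z, w; split=> //.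
  by rewrite mdistC; exact: He sPQ _ _ zP yQ.
by rewrite mdistC; exact: He sPQ _ _ wP yQ.
Qed.

Lemma bad1_fin m i : finite_set (bad1 m i).
Proof.
pose A (j : nat) := [set g : homeo M | J g /\ exists P Q,
  [/\ sep i j P Q, Q ((g^-1)%g y0) & P ((g^-1)%g (y m))]].
apply: (@fin_sub m A) => [j|[j g] [Jg H]] /=; last first.
  split=> //; have [P [Q [+ yQ zP]]] := H.
  rewrite /sep /=; case: ifP => _ [] => [p [Pp _ PE QE]|j0 _ _ _]; last by rewrite j0.
  rewrite leqNgt; apply/negP => mj.
  have [_ _ S2 _] := rho_sparse j Pp; move: yQ zP; rewrite PE QE /=.
  by move=> /(S2 _ (subgV sJ Jg)) /(_ _ (ltnW mj)).
have [e e0 He] := sep_far i j.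
apply: sub_finite_set (fin_move2 (yL (k := 0%N)) (yL (k := m)) e0) => g.
move=> [Jg [P [Q [sPQ yQ zP]]]]; split=> //.
by rewrite mdistC; exact: He sPQ _ _ zP yQ.
Qed.

Record elt := Elt {cls : nat; sub : nat; grp : homeo M; near_set : set M; far_set : set M}.

Implicit Types (e : elt) (c : seq elt) (S T : set M).

Definition inner e : set M := grp e @` near_set e.
Definition outer e : set M := grp e @` far_set e.
Definition valid e := J (grp e) /\ sep (cls e) (sub e) (near_set e) (far_set e).
Definition key e : nat * (nat * homeo M) := (cls e, (sub e, grp e)).

(* Nested separators inside [S] and around [T]. *)
Fixpoint chain S c T : Prop :=
  if c is e :: c' then [/\ valid e, ~` outer e `<=` S & chain (inner e) c' T]
  else T `<=` S.

Fixpoint allp (P : elt -> Prop) c : Prop := if c is e :: c' then P e /\ allp P c' else True.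

Lemma allpS (P Q : elt -> Prop) c : (forall e, P e -> Q e) -> allp P c -> allp Q c.
Proof. by move=> PQ; elim: c => //= e c IHc [/PQ Qe /IHc]. Qed.

Lemma allp_cat P c c' : allp P (c ++ c') <-> allp P c /\ allp P c'.
Proof. by elim: c => /= [|e c IHc]; [split=> [?|[]]|rewrite IHc; tauto]. Qed.

Lemma inner_outer e : valid e -> inner e `<=` ~` outer e.
Proof.
move=> [_ sPQ] x /him Px /him Qx; have [d d0 H] := sep_far (cls e) (sub e).
by have := H _ _ sPQ _ _ Px Qx; rewrite mdistxx leNgt d0.
Qed.

Lemma chain_sub S c T : chain S c T -> T `<=` S.
Proof.
elim: c S => //= e c IHc S [ve eS /IHc Te]; apply: subset_trans eS.
by apply: subset_trans Te _; exact: inner_outer.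
Qed.

Lemma chainS S S' c T : S `<=` S' -> chain S c T -> chain S' c T.
Proof.
by case: c => [|e c] SS' /= => [/subset_trans|[ve eS]]; [apply|split=> //; exact: subset_trans SS'].
Qed.

Lemma chain_cat S c T c' T' : chain S c T -> chain T c' T' -> chain S (c ++ c') T'.
Proof.
elim: c S => [|e c IHc] S /=; first by move=> TS; exact: chainS.
by move=> [ve eS ce] c'T; split=> //; exact: IHc.
Qed.

Lemma chain_allp S c T : chain S c T ->
  allp (fun e => [/\ valid e, T `<=` inner e & ~` outer e `<=` S]) c.
Proof.
elim: c S => //= e c IHc S [ve eS ce]; split; first by split=> //; exact: chain_sub ce.
apply: allpS (IHc _ ce) => e' [ve' Te' e'S]; split=> //.
apply: subset_trans e'S _; apply: subset_trans eS; exact: inner_outer.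
Qed.

Lemma chain_uniq S c T : chain S c T -> uniq (map key c).
Proof.
elim: c S => //= e c IHc S [ve eS ce]; rewrite (IHc _ ce) andbT.
apply/negP => ein; have := chain_allp ce; elim: c ein {IHc ce} => //= e' c IHc.
rewrite inE => /orP[/eqP ee'|/IHc H] [[ve' _ e'e]] //.
have [/= cc ss gg] : [/\ cls e = cls e', sub e = sub e' & grp e = grp e'] by case: ee'.
have [_ sPQ] := ve; have [_ sPQ'] := ve'; rewrite -cc -ss in sPQ'.
have [z [zP zQ]] := sep_cover sPQ sPQ'.
have /him : inner e (grp e z) by apply: e'e => /him; rewrite -gg hK.
by rewrite hK.
Qed.

Definition translate h e := Elt (cls e) (sub e) (h * grp e) (near_set e) (far_set e).

Lemma chain_translate h S c T : J h -> chain S c T ->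
  chain (h @` S) (map (translate h) c) (h @` T).
Proof.
move=> Jh; elim: c S => [|e c IHc] S /=; first by move=> TS _ [z /TS Sz <-]; exists z.
move=> [[Je sPQ] eS ce]; split.
- by split=> //=; exact: subgM.
- move=> x xe; apply/him; apply: eS => xo; apply: xe.
  by change (((h * grp e) @` far_set e) x); rewrite him_mul; exact/him.
- have <- : h @` inner e = inner (translate h e) by rewrite /inner -him_mul.
  exact: IHc.
Qed.

Section Potential.
Variable w : nat -> R.
Hypothesis w01 : forall i, (0 < w i <= 1)%R.

Definition weight c : R := (\sum_(e <- c) w (cls e))%R.

Lemma weight_cat c c' : weight (c ++ c') = (weight c + weight c')%R.
Proof. by rewrite /weight big_cat. Qed.

Lemma weight_translate h c : weight (map (translate h) c) = weight c.
Proof. by rewrite /weight big_map. Qed.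

(** Members are counted class by class: distinct keys within class [i] are distinct elements of
    [K i]. *)
Lemma weight_bound (K : nat -> set (nat * homeo M)) (C : nat -> nat) (B : R) c :
  (forall i (l : seq (nat * homeo M)), uniq l -> (forall k, k \in l -> K i k) ->
     (size l <= C i)%N) ->
  (forall N, \sum_(i < N) w i * (C i)%:R <= B)%R ->
  uniq (map key c) -> allp (fun e => K (cls e) (sub e, grp e)) c -> (weight c <= B)%R.
Proof.
move=> KC CB uc Kc.
pose N := (\max_(e <- c) cls e).+1.
have cN : forall e, allp (fun e' => cls e' < N)%N c.
  move=> _; rewrite /N; elim: (c) => //= e c' IHc'; split.
    by rewrite big_cons ltnS leq_maxl.
  by apply: allpS IHc' => e' /leq_trans; apply; rewrite big_cons ltnS leq_maxr.
apply: le_trans (CB N).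
have -> : (weight c = \sum_(i < N) w i * (count (fun e => cls e == i) c)%:R)%R.
  have {}cN : allp (fun e' => cls e' < N)%N c.
    by case: (c) cN => // e c' /(_ e).
  elim: (c) cN => [|e c' IHc'] /=.
    by rewrite /weight big_nil big1// => i _; rewrite mulr0.
  move=> [eN /IHc' c'N]; rewrite /weight big_cons -/(weight c') c'N.
  under [RHS]eq_bigr do rewrite natrD mulrDr.
  rewrite big_split/=; congr (_ + _)%R.
  rewrite (bigD1 (Ordinal eN))//= eqxx mulr1 big1 ?addr0// => i.
  by move=> /eqP ie; case: eqP => [ei|]; rewrite ?mulr0//; case: ie; apply: val_inj.
apply: ler_sum => i _; rewrite ler_pM2l; last by have /andP[] := w01 i.
rewrite ler_nat -size_filter -(size_map (fun e => (sub e, grp e))).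
apply: KC; [move: uc|move: Kc]; elim: (c) => //= e c' IHc'.
  move=> /andP[ec' /IHc' uc']; case: eqP => //= ei; rewrite uc' andbT.
  apply: contra ec'; rewrite -ei; elim: (c') => //= e' c'' IHc''.
  case: eqP => [ee'|_] /=; rewrite !inE; last by move=> /IHc'' ->; rewrite orbT.
  move=> /orP[/eqP[es eg]|/IHc'' ->]; last by rewrite orbT.
  by rewrite /key ee' es eg eqxx.
move=> [Ke /IHc' H] x; case: eqP => [ei|_] //=; last exact: H.
by rewrite inE => /orP[/eqP ->|/H //]; rewrite -ei.
Qed.

Hypothesis w_bad2 : forall m, exists2 B : R, (0 <= B)%R & forall c,
  uniq (map key c) -> allp (fun e => bad2 m (cls e) (sub e, grp e)) c -> (weight c <= B)%R.
Hypothesis w_bad1 : forall m, exists2 B : R, (0 <= B)%R & forall c,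
  uniq (map key c) -> allp (fun e => bad1 m (cls e) (sub e, grp e)) c -> (weight c <= B)%R.

(** An integer bound replaces the supremum of the weights: a least one exists, and a drop by 1
    contradicts its minimality. *)
Definition bounded_chains x (W : nat) :=
  forall c, chain (~` [set y0]) c [set x] -> (weight c <= W%:R)%R.

Lemma start_outer e S : S `<=` ~` [set y0] -> ~` outer e `<=` S -> outer e y0.
Proof. by move=> Sy eS; apply: contrapT => /eS/Sy; exact. Qed.

(** Every member of a chain to [y k] cuts [y k] off from [y0], hence is counted by [bad1 k]. *)
Lemma bounded_chains_exists k : exists W, bounded_chains (y k) W.
Proof.
have [B B0 HB] := w_bad1 k.
exists (Num.bound B) => c ch; apply: (@le_trans _ _ B); last by rewrite ltW// archi_boundP.
apply: HB; first exact: chain_uniq ch.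
apply: allpS (chain_allp ch) => e [[Je sPQ] ye eS]; split=> //.
exists (near_set e), (far_set e); split=> //; first exact/him/(start_outer _ eS).
exact/him/ye.
Qed.

(* The separators of [c] that do not lie inside [T] all have [v] and a common
   point outside [T] on their inner side, except possibly the last one. *)
Lemma chain_drop S T c (v : M) : T v -> chain S c [set v] -> exists c1 c2,
  [/\ c = c1 ++ c2, chain T c2 [set v] & c1 = [::] \/ exists c1' e u,
     [/\ c1 = rcons c1' e, ~ T u, S u & allp (fun e => inner e u) c1']].
Proof.
move=> Tv; elim: c S => [|e c IHc] S /=.
  by move=> _; exists [::], [::]; split=> //; [move=> _ ->|left].
move=> [ve eS ce]; have [eT|/existsNP[u /not_implyP[ue nTu]]] := EM (~` outer e `<=` T).
  by exists [::], (e :: c); split=> //; left.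
have [c1 [c2 [-> c2T [->|[c1' [e' [u' [-> nTu' Su' Hc1']]]]]]]] := IHc _ ce.
  exists [:: e], c2; split=> //; right; exists [::], e, u; split=> //; exact: eS.
exists (e :: rcons c1' e'), c2; split=> //; right; exists (e :: c1'), e', u'.
by split=> //; apply: eS; exact: inner_outer.
Qed.

(** A chain to [s x] splits into [c1] and a part [c2] inside [s T]. All members of [c1] but the last
    have both [s x] and a far point [u] on their inner side, so [c1] weighs at most [B + 1]. Moved
    back by [s^-1] and preceded by [c0], [c2] becomes a chain to [x], hence weighs at most
    [W - (B + 2)]. The margin 2 pays for the exceptional member and for the drop by 1. *)
Lemma chain_gain m (B : R) x s c0 T W :
  (forall c, uniq (map key c) -> allp (fun e => bad2 m (cls e) (sub e, grp e)) c ->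
     (weight c <= B)%R) -> (0 <= B)%R ->
  J s -> chain (~` [set y0]) c0 T -> (B + 2 <= weight c0)%R ->
  (forall u, ~ T (s^-1 u) -> (m.+1%:R^-1 <= mdist (s x) u)%R) ->
  bounded_chains x W -> (0 < W)%N /\ bounded_chains (s x) W.-1.
Proof.
move=> HB B0 Js ch0 w0 far bx.
have Tx : T x.
  apply: contrapT => nTx; have := far (s x); rewrite hK mdistxx => /(_ nTx).
  by rewrite leNgt invr_gt0 ltr0n.
have Tsx : (s @` T) (s x) by exists x.
have W0 : (0 < W)%N.
  rewrite -(ltr_nat R); apply: lt_le_trans (bx c0 _); first by apply: lt_le_trans w0; lra.
  rewrite -[c0]cats0; apply: chain_cat ch0 _.
  by move=> _ ->.
split=> // c ch.
have uc := chain_uniq ch.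
have [c1 [c2 [cE c2T H]]] := chain_drop Tsx ch.
have wc1 : (weight c1 <= B + 1)%R.
  case: H => [->|[c1' [e [u [c1E nTu Su Hc1']]]]].
    by rewrite /weight big_nil; lra.
  rewrite c1E -cats1 weight_cat lerD//; last first.
    by rewrite /weight big_seq1; have /andP[] := w01 (cls e).
  apply: HB.
    by move: uc; rewrite cE c1E -cats1 !map_cat -catA cat_uniq => /andP[].
  have : allp (fun e => inner e u /\ [/\ valid e, [set s x] `<=` inner e
                & ~` outer e `<=` ~` [set y0]]) c1'.
    have := chain_allp ch; rewrite cE c1E -cats1 -catA => /allp_cat[+ _].
    by elim: (c1') Hc1' => //= e' c' IHc' [ue' /IHc' c'H] [Ve' /c'H].
  apply: allpS => e' [ue' [[Je' sPQ] se' eS']]; split=> //.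
  exists (near_set e'), (far_set e'), (s x), u; split=> //.
  - exact/him/(start_outer _ eS').
  - by apply: far => nT; apply: nTu; exact/him.
  - exact/him/se'.
  - exact/him.
have := bx (c0 ++ map (translate s^-1) c2).
rewrite weight_cat weight_translate => H1.
have {}H1 : (weight c0 + weight c2 <= W%:R)%R.
  apply: H1; apply: chain_cat ch0 _.
  have := chain_translate (subgV sJ Js) c2T.
  have <- : T = (s^-1)%g @` (s @` T) by rewrite -him_mul mulVg him1.
  have <- // : [set x] = (s^-1)%g @` [set s x].
  by apply/seteqP; split=> [_ ->|_ [_ -> <-]]; [exists (s x); rewrite ?hK|rewrite hK].
have : (weight c = weight c1 + weight c2)%R by rewrite cE weight_cat.
have -> : (W.-1%:R = W%:R - 1 :> R)%R by rewrite -[in RHS](prednK W0) -[W.-1.+1]addn1 natrD addrK.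
lra.
Qed.

Lemma weight_const i c : allp (fun e => cls e = i) c -> weight c = (w i *+ size c)%R.
Proof.
elim: c => [|e c IHc] /=; first by rewrite /weight big_nil mulr0n.
by move=> [ei /IHc H]; rewrite /weight big_cons -/(weight c) H ei mulrS.
Qed.

Lemma enough i (B : R) : exists n, (B <= w i *+ n)%R.
Proof.
have /andP[w0 _] := w01 i; exists (Num.bound (B / w i)%R).
rewrite -mulr_natr mulrC -ler_pdivrMr//; have [B0|B0] := leP 0%R B.
  by rewrite ltW// archi_boundP// divr_ge0// ltW.
by apply: (@le_trans _ _ 0%R) => //; rewrite mulr_le0_ge0// ?invr_ge0 ltW.
Qed.

Definition conical_data q := exists (s : nat -> homeo M) a b,
  [/\ forall k, J (s k), ufree s, attU s b q, tends (fun k => s k q) a & a <> b].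

Definition parabolic_data q := Par q /\
  forall j : nat -> homeo M, (forall k, J (j k)) -> tends (fun k => j k (y k)) q ->
  exists (t : nat -> homeo M) q', [/\ forall k, J (t k), attU t q q,
    tends (fun k => t k (j k (y k))) q' & q' <> q].

(** Prepares [chain_gain]: [m] is fixed before the length because the loss [B] depends on it, and
    all members share a class, so their weights do not decay as the chain grows. *)
Definition gains q := forall j : nat -> homeo M, (forall k, J (j k)) ->
  tends (fun k => j k (y k)) q -> exists i m, forall n, exists k s c T,
  [/\ J s, chain (~` [set y0]) c T, size c = n.+1, allp (fun e => cls e = i) c &
     forall u, ~ T (s^-1 u) -> (m.+1%:R^-1 <= mdist (s (j k (y k))) u)%R].

(** Pull fixed balls at [a] and [b] back by [s k]. The complement of the second pullback shrinks to
    [q], while the first is a neighbourhood of [q] once [s k q] is close to [a]; so arbitrarily many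
    pairs nest around [q]. They are translates of one pair, hence of one class, and the last [s k]
    returns the inner set to the ball at [a]. *)
Lemma conical_gains q : L q -> conical_data q -> gains q.
Proof.
move=> Lq [s [a [b [Js fs sbq sqa ab]]]].
have Lb : L b by exact: att_limit_set sbq.
have La : L a.
  apply: (tends_closed (limit_set_closed Mc (G := J)) _ sqa).
  by apply: nearW => k; exact/(LinvP _ (Js k)).
have yLL x : L x -> (0 < mdist y0 x)%R.
  by move=> Lx; apply: mdist_pos => yx; apply: (yL (k := 0%N)); rewrite -/y0 yx.
have ab0 := mdist_pos ab.
pose r := (Num.min (mdist a b) (Num.min (mdist y0 a) (mdist y0 b)) / 3)%R.
have r0 : (0 < r)%R by rewrite divr_gt0// !lt_min ab0 !yLL.
have [rab rya ryb] : [/\ (3 * r <= mdist a b)%R, (3 * r <= mdist y0 a)%R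
                      & (3 * r <= mdist y0 b)%R].
  by rewrite /r mulrC mulfVK// !ge_min !lexx !orbT.
have r20 : (0 < r / 2)%R by rewrite divr_gt0.
have [n /(_ n (leqnn n)) nr] := inv_small r20.
pose P := [set z | (mdist z a <= r)%R]; pose Q := [set z | (mdist z b <= r)%R].
have sPQ : sep n.*2 0 P Q.
  rewrite /sep odd_double doubleK; split=> //.
  - rewrite /P /Q => x z /= xa zb; apply: le_trans (ltW nr) _.
    by have := mdist_tri x a b; have := mdist_tri z x b; rewrite (mdistC a x); lra.
  - by rewrite /P /=; apply/negP; rewrite -ltNge; lra.
  - by rewrite /Q /=; apply/negP; rewrite -ltNge; lra.
pose el k := Elt n.*2 0 (s k)^-1 P Q.
have Vel k : valid (el k) by split=> //; exact: subgV.
have outE k z : outer (el k) z <-> (mdist (s k z) b <= r)%R.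
  by have := him (s k)^-1 Q z; rewrite invgK.
have innE k z : inner (el k) z <-> (mdist (s k z) a <= r)%R.
  by have := him (s k)^-1 P z; rewrite invgK.
have nest S (e : R) : (0 < e)%R -> (forall z, (mdist z q < e)%R -> S z) ->
    exists k, (mdist (s k q) a < r / 2)%R /\ ~` outer (el k) `<=` S.
  move=> e0 eS; pose d := Num.min e r.
  have d0 : (0 < d)%R by rewrite lt_min e0 r0.
  have [k [k1 k2]] := Uf_ex2 (sqa _ r20) (sbq _ d0).
  exists k; split=> // z zo; apply: eS; rewrite ltNge; apply/negP => ez; apply: zo.
  apply/outE/ltW.
  have : (mdist (s k z) b < d)%R by apply: k2; rewrite ge_min ez.
  by rewrite lt_min => /andP[].
have innerP k : (mdist (s k q) a < r / 2)%R ->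
    exists2 e : R, (0 < e)%R & forall z, (mdist z q < e)%R -> inner (el k) z.
  move=> kq; have [e e0 He] := h_unif (s k) q r20; exists e => // z /He zq.
  by apply/innE; have := mdist_tri (s k q) (s k z) a; lra.
have prefix N : forall S (e : R), (0 < e)%R -> (forall z, (mdist z q < e)%R -> S z) ->
    exists c k, [/\ (mdist (s k q) a < r / 2)%R, chain S c (inner (el k)),
      size c = N.+1 & allp (fun e => cls e = n.*2) c].
  elim: N => [|N IHN] S e e0 eS.
    by have [k [kq kS]] := nest S e e0 eS; exists [:: el k], k; split=> //; split.
  have [k [kq kS]] := nest S e e0 eS; have [e' e'0 He'] := innerP k kq.
  have [c [k' [k'q ch cN cc]]] := IHN _ _ e'0 He'.
  by exists (el k :: c), k'; split=> //=; rewrite cN.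
move=> j Jj jq; exists n.*2, n => N.
have yq0 : (0 < mdist q y0)%R by rewrite mdistC yLL.
have [c [k0 [k0q ch cN cc]]] : exists c k, [/\ (mdist (s k q) a < r / 2)%R,
   chain (~` [set y0]) c (inner (el k)), size c = N.+1 & allp (fun e => cls e = n.*2) c].
  apply: (prefix N _ _ yq0) => z zq zy; move: zq; rewrite zy mdistC ltxx //.
have e0 : (0 < r / 2 - mdist (s k0 q) a)%R by rewrite subr_gt0.
have [k kk] := Uf_ex (tends_him (s k0) jq e0).
exists k, (s k0), c, (inner (el k0)); split=> // u nu.
have {nu} ur : (r < mdist u a)%R.
  by rewrite ltNge; apply/negP => ur; apply: nu; apply/innE; rewrite hVK.
apply: le_trans (ltW nr) _.
have := mdist_tri (s k0 (j k (y k))) u a; have := mdist_tri (s k0 q) (s k0 (j k (y k))) a.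
by rewrite (mdistC u (s k0 _)); lra.
Qed.

(** The annuli around [q] nest without being translated. The element [t k] squeezes everything
    outside a small ball at [q] towards [q], but brings [j k (y k)] close to [q']; the distance from
    [q] to [q'] yields [m]. *)
Lemma parabolic_gains q : parabolic_data q -> gains q.
Proof.
move=> [Pq H].
pose i := (parcode q).*2.+1.
pose P j := [set z | (mdist z q <= rho q j.+1)%R].
pose Q j := [set z | (rho q j <= mdist z q)%R].
have sPQ j : sep i j (P j) (Q j).
  by rewrite /sep /= odd_double /=; exists q; rewrite uphalf_double.
pose el j := Elt i j 1 (P j) (Q j).
have Vel j : valid (el j) by split=> //; exact: subg1.
have elP j : inner (el j) = P j by exact: him1.
have elQ j : outer (el j) = Q j by exact: him1.
have prefix N : forall j S, (forall z, (mdist z q < rho q j)%R -> S z) ->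
    exists c, [/\ chain S c (P (j + N)%N), size c = N.+1 & allp (fun e => cls e = i) c].
  elim: N => [|N IHN] j S jS.
    exists [:: el j]; rewrite addn0; split=> //; split=> //; last by rewrite elP.
    by move=> z; rewrite elQ => /negP; rewrite -ltNge; exact: jS.
  have [|c [ch cN cc]] := IHN j.+1 (inner (el j)).
    by move=> z /ltW; rewrite elP.
  exists (el j :: c); rewrite addnS -addSn; split=> //=; last by rewrite cN.
  by split=> // z; rewrite elQ => /negP; rewrite -ltNge; exact: jS.
move=> j Jj jq; have [t [q' [Jt tq tq' q'q]]] := H j Jj jq.
have d0 : (0 < mdist q' q / 3)%R by rewrite divr_gt0// mdist_pos.
have [m /(_ m (leqnn m)) md] := inv_small d0.
exists i, m => N; have [|c [ch cN cc]] := prefix N 0%N (~` [set y0]).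
  by move=> z /= + zy; rewrite zy ltxx.
have e0 : (0 < Num.min (rho q N.+1) (mdist q' q / 3))%R.
  by rewrite lt_min d0 andbT; exact: rho_gt0.
have [k [k1 k2]] := Uf_ex2 (tq _ e0) (tq' _ d0).
exists k, (t k), c, (P N); split=> // u /negP; rewrite -ltNge => ru.
have := k1 ((t k)^-1 u); rewrite hVK ge_min (ltW ru) => /(_ isT).
rewrite lt_min => /andP[_ uq]; apply: le_trans (ltW md) _.
have := mdist_tri (t k (j k (y k))) q' q; have := mdist_tri u (t k (j k (y k))) q.
by rewrite (mdistC q' (t k _)); lra.
Qed.

Lemma potential_limit : (forall q, L q -> conical_data q \/ parabolic_data q) ->
  exists j q, [/\ forall k, J (j k), tends (fun k => j k (y k)) q & ~ L q].
Proof.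
move=> Hq.
have /choice[jW HjW] : forall k, exists jW : homeo M * nat,
    [/\ J jW.1, bounded_chains (jW.1 (y k)) jW.2 &
      forall g W, J g -> bounded_chains (g (y k)) W -> (jW.2 <= W)%N].
  move=> k; pose P W := `[< exists2 g, J g & bounded_chains (g (y k)) W >].
  have exP : exists W, P W.
    have [W HW] := bounded_chains_exists k; exists W; apply/asboolP.
    by exists 1 => //; exact: subg1.
  case: (ex_minnP exP) => W /asboolP[g Jg gW] minW; exists (g, W); split=> //.
  by move=> g' W' Jg' gW'; apply: minW; apply/asboolP; exists g'.
pose j k := (jW k).1; have Jj k : J (j k) by have [] := HjW k.
have [q jq] := Uconv Mc (fun k => j k (y k)).
exists j, q; split=> // Lq.
have gq : gains q by case: (Hq q Lq); [exact: conical_gains|exact: parabolic_gains].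
have [i [m Him]] := gq j Jj jq.
have [B B0 HB] := w_bad2 m.
have [n Hn] := enough i (B + 2)%R.
have [k [s [c [T [Js ch cn ci far]]]]] := Him n.
have wc : (B + 2 <= weight c)%R.
  rewrite (weight_const ci) cn; apply: (le_trans Hn); rewrite mulrS lerDr ltW//.
  by have /andP[] := w01 i.
have [_ bW minW] := HjW k.
have [W0 bs] := chain_gain HB B0 Js ch wc far bW.
have := minW (s * j k) _ (subgM sJ Js (Jj k)) bs.
by rewrite leqNgt prednK// leqnn.
Qed.

End Potential.

Lemma sep_weights : exists w : nat -> R, [/\ forall i, (0 < w i <= 1)%R,
  forall m, exists2 B : R, (0 <= B)%R & forall c, uniq (map key c) ->
    allp (fun e => bad2 m (cls e) (sub e, grp e)) c -> (weight w c <= B)%R &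
  forall m, exists2 B : R, (0 <= B)%R & forall c, uniq (map key c) ->
    allp (fun e => bad1 m (cls e) (sub e, grp e)) c -> (weight w c <= B)%R].
Proof.
have /choice[C2 HC2] : forall mi : nat * nat, exists N,
    forall l : seq (nat * homeo M), uniq l -> (forall k, k \in l -> bad2 mi.1 mi.2 k) ->
    (size l <= N)%N by move=> [m i]; exact/fin_card/bad2_fin.
have /choice[C1 HC1] : forall mi : nat * nat, exists N,
    forall l : seq (nat * homeo M), uniq l -> (forall k, k \in l -> bad1 mi.1 mi.2 k) ->
    (size l <= N)%N by move=> [m i]; exact/fin_card/bad1_fin.
have [w w01 wB] := weights_exist R (fun m i => C2 (m, i) + C1 (m, i))%N.
exists w; split=> // m; have [B B0 HB] := wB m; exists B => // c.
- apply: (weight_bound w01 (C := fun i => C2 (m, i) + C1 (m, i))%N) HB => i l ul lb.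
  exact: leq_trans (HC2 (m, i) l ul lb) (leq_addr _ _).
- apply: (weight_bound w01 (C := fun i => C2 (m, i) + C1 (m, i))%N) HB => i l ul lb.
  exact: leq_trans (HC1 (m, i) l ul lb) (leq_addl _ _).
Qed.

(* The conclusion is what a cocompact action of J on the complement of L would
   give for the sequence [y]. *)
Lemma cocompact_limit : (forall q, L q -> conical_data q \/ parabolic_data q) ->
  exists j q, [/\ forall k, J (j k), tends (fun k => j k (y k)) q & ~ L q].
Proof.
by have [w [w01 wb2 wb1]] := sep_weights; exact: potential_limit w01 wb2 wb1.
Qed.

End Separators.

(** * Normal forms in HNN extensions *)

Section NormalForm.
Variables (H : groupType) (H0 : set H) (J : bool -> set H) (phi : bool -> H).
Hypotheses (sH0 : subgroup H0) (sJ : forall e, subgroup (J e)) (JH0 : forall e, J e `<=` H0).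
Hypotheses (phiN : forall e, phi (~~ e) = (phi e)^-1).
Hypotheses (Jphi : forall e j, J (~~ e) j -> J e (phi e * j * (phi e)^-1)).

(* [tl e n k e0 c]: phi e * c is reduced, [c] has [n] stable letters, and the
   word phi e * c ends with phi (~~ e0) * k^-1. *)
Inductive tl : bool -> nat -> H -> bool -> H -> Prop :=
| tl0 e h : H0 h -> tl e 0 h^-1 (~~ e) h
| tlS e e' n k e0 h c : H0 h -> (e' = ~~ e -> ~ J (~~ e) h) -> tl e' n k e0 c ->
    tl e n.+1 k e0 (h * phi e' * c).

Lemma tl_end e n k e0 c : tl e n k e0 c -> H0 k.
Proof. by elim=> // {}e h Hh; exact: subgV. Qed.

Lemma tl0P e n k e0 c : tl e n k e0 c -> n = 0%N -> [/\ H0 c, k = c^-1 & e0 = ~~ e].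
Proof. by case. Qed.

Lemma tlSP e n k e0 c : tl e n.+1 k e0 c -> exists e' h c',
  [/\ H0 h, e' = ~~ e -> ~ J (~~ e) h, tl e' n k e0 c' & c = h * phi e' * c'].
Proof.
move En : n.+1 => m tlc; case: tlc En => // {}e e' n' {}k {}e0 h {}c Hh eh tlc [->].
by exists e', h, c.
Qed.

Lemma tl_mulr e n k e0 c h : tl e n k e0 c -> H0 h -> tl e n (h^-1 * k) e0 (c * h).
Proof.
move=> tlc Hh; elim: tlc => {e n k e0 c} [e h' Hh'|e e' n k e0 h' c Hh' eh' _ IH].
  by rewrite -invgM; apply: tl0; exact: subgM.
by rewrite -mulgA; exact: tlS.
Qed.

(** The factor [k * phi e0] cancels the final [phi (~~ e0) * k^-1]. *)
Lemma tl_cancel e n k e0 c : tl e n.+1 k e0 c ->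
  exists k' e', tl e n k' e' (c * k * phi e0).
Proof.
move En : n.+1 => m tlc; elim: tlc n En => {e m k e0 c} // e e' n k e0 h c Hh eh tlc IH _ [->].
case: n tlc IH => [|n] tlc IH.
  have [Hc -> ->] := tl0P tlc erefl; rewrite phiN !mulgK.
  by exists h^-1, (~~ e); exact: tl0.
have [k' [e'' tlc']] := IH n erefl; exists k', e''.
by rewrite -!mulgA (mulgA c) mulgA; exact: tlS.
Qed.

Definition nf g := H0 g \/ exists h e n k e0 c, [/\ H0 h, tl e n k e0 c & g = h * phi e * c].

Lemma nf_mulH0 h g : H0 h -> nf g -> nf (h * g).
Proof.
move=> Hh [Hg|[h' [e [n [k [e0 [c [Hh' tlc ->]]]]]]]]; first by left; exact: subgM.
by right; exists (h * h'), e, n, k, e0, c; rewrite !mulgA; split=> //; exact: subgM.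
Qed.

Lemma tl_nf e n k e0 c : tl e n k e0 c -> nf c.
Proof.
case=> [{}e h Hh|{}e e' {}n {}k {}e0 h {}c Hh _ tlc]; first by left.
by right; exists h, e', n, k, e0, c.
Qed.

Lemma nf_mulphi e g : nf g -> nf (phi e * g).
Proof.
move=> [Hg|[h [e' [n [k [e0 [c [Hh tlc ->]]]]]]]].
  right; exists 1, e, 0%N, g^-1, (~~ e), g; rewrite mul1g; split=> //; first exact: subg1.
  exact: tl0.
have [[ee' Jh]|nr] := EM (e' = ~~ e /\ J (~~ e) h).
  subst e'; rewrite phiN !mulgA; apply: nf_mulH0 (tl_nf tlc).
  exact/JH0/Jphi.
right; exists 1, e, n.+1, k, e0, (h * phi e' * c); rewrite mul1g; split=> //.
  exact: subg1.
by apply: tlS tlc => // ee' Jh; exact: nr.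
Qed.

End NormalForm.

Section HnnInjective.
Variables (gT : groupType) (G0 : set gT) (Jm1 J1 : set gT) (f : gT).
Hypotheses (sG0 : subgroup G0) (sJ1 : subgroup J1) (sJm1 : subgroup Jm1).
Hypotheses (J1G : J1 `<=` G0) (Jm1G : Jm1 `<=` G0).
Hypothesis conjJ : [set f * j * f^-1 | j in Jm1] = J1.

Definition phi (e : bool) : gT := if e then f else f^-1.
Definition Jb (e : bool) : set gT := if e then J1 else Jm1.

Lemma phiN e : phi (~~ e) = (phi e)^-1.
Proof. by case: e => //=; rewrite invgK. Qed.

Lemma Jb_sub e : subgroup (Jb e). Proof. by case: e. Qed.
Lemma JbG e : Jb e `<=` G0. Proof. by case: e. Qed.

Lemma Jb_conj e j : Jb (~~ e) j -> Jb e (phi e * j * (phi e)^-1).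
Proof.
case: e => /=; first by rewrite -conjJ => ?; exists j.
by rewrite -conjJ => -[j' Jj' <-]; rewrite invgK !mulgA mulVg mul1g mulgVK.
Qed.

Local Notation hnnG := (hnn G0 Jm1 f).
Let pc (w : seq (bool * hnn_gen G0)) : hnnG := pres_class (hnn_rels Jm1 f) w.
Let iota (a : set_type G0) : hnnG := pc [:: hnn_of a].
Let tau : hnnG := pc [:: hnn_t G0].
Let nu : hnnG -> gT := @hnn_nat _ G0 Jm1 f.

Let pcM u v : pc (u ++ v) = pc u * pc v.
Proof. exact/esym/pres_mulE. Qed.

Let iotaM a b c : val a * val b = val c -> iota a * iota b = iota c.
Proof.
by move=> abc; rewrite -pcM; apply/pres_classP; apply: word_eq_rel; exact: hnn_rel_mul.
Qed.

Let nuM : {morph nu : x y / x * y}. Proof. exact: hnn_natM. Qed.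
Let nu1 : nu 1 = 1. Proof. by apply: (mulIg (nu 1)); rewrite -nuM !mul1g. Qed.
Let nuV x : nu x^-1 = (nu x)^-1.
Proof. by apply: (mulIg (nu x)); rewrite -nuM !mulVg. Qed.
Let nu_iota a : nu (iota a) = val a. Proof. exact: hnn_nat_of. Qed.
Let nu_tau : nu tau = f. Proof. exact: hnn_nat_t. Qed.

Let mkG a (Ga : G0 a) : set_type G0 := SigSub (mem_set Ga).

Let iota1 a : val a = 1 -> iota a = 1.
Proof.
by move=> a1; apply: (mulIg (iota a)); rewrite mul1g; apply: iotaM; rewrite a1 mulg1.
Qed.

Let H0 : set hnnG := range iota.
Let JH (e : bool) : set hnnG := [set iota a | a in [set a | Jb e (val a)]].
Let phiH (e : bool) : hnnG := if e then tau else tau^-1.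

Let nu_phi e : nu (phiH e) = phi e.
Proof. by case: e => /=; rewrite ?nuV nu_tau. Qed.

Let phiHN e : phiH (~~ e) = (phiH e)^-1.
Proof. by case: e => //=; rewrite invgK. Qed.

Let sub_iota (K : set gT) : K `<=` G0 -> subgroup K ->
  subgroup [set iota a | a in [set a | K (val a)]].
Proof.
move=> KG sK; split.
  apply/mem_set; exists (mkG (subg1 sG0)); first exact: subg1.
  exact: iota1.
move=> _ _ /set_mem[a Ka <-] /set_mem[b Kb <-]; apply/mem_set.
have Gab : G0 (val a * (val b)^-1) by apply: KG; exact: subgF.
exists (mkG Gab); first exact: subgF.
by apply: (mulIg (iota b)); rewrite mulgVK; apply: iotaM; rewrite /= mulgVK.
Qed.

Let sH0 : subgroup H0.
Proof.
suff -> : H0 = [set iota a | a in [set a | G0 (val a)]] by exact: sub_iota.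
apply/seteqP; split=> _ [a _ <-]; last by exists a.
by exists a => //=; exact: set_valP.
Qed.

Let sJH e : subgroup (JH e). Proof. exact: sub_iota (@JbG e) (Jb_sub e). Qed.

Let JHH e : JH e `<=` H0. Proof. by move=> _ [a _ <-]; exists a. Qed.

Let phiH_conj e j : JH (~~ e) j -> JH e (phiH e * j * (phiH e)^-1).
Proof.
have conj1 a b : Jm1 (val a) -> f * val a * f^-1 = val b -> tau * iota a * tau^-1 = iota b.
  move=> Ja ab.
  have -> : tau^-1 = pc [:: hnn_tV G0] by exact: pres_invE.
  rewrite -(pcM [:: _] [:: _]) -(pcM _ [:: _]); apply/pres_classP; apply: word_eq_rel; exact: hnn_rel_conj.
case: e => /= -[a Ja <-].
  have Jfa := @Jb_conj true _ Ja; have Gfa := JbG Jfa.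
  by exists (mkG Gfa) => //; apply/esym/conj1.
have Jfa := @Jb_conj false _ Ja; have Gfa := JbG Jfa.
exists (mkG Gfa) => //; set b := mkG Gfa.
have -> : phiH false * iota a * (phiH false)^-1 = tau^-1 * iota a * tau by rewrite /= invgK.
have <- := @conj1 b a Jfa; last by rewrite /= invgK !mulgA mulgV mul1g mulgK.
by rewrite !mulgA mulVg mul1g mulgVK.
Qed.

Let nfH (x : hnnG) : nf H0 JH phiH x.
Proof.
elim/pres_ind: x => w; rewrite -/(pc w).
elim: w => [|[b x] w IHw]; first by left; exact: (subg1 sH0).
rewrite -cat1s pcM; case: x => [a|].
  apply: nf_mulH0 => //; case: b; first by exists a.
  have <- : (iota a)^-1 = pc [:: (false, Some a)] by exact: pres_invE.
  by apply: subgV => //; exists a.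
case: b; first exact: (@nf_mulphi _ _ _ _ sH0 JHH phiHN phiH_conj true).
have <- : tau^-1 = pc [:: (false, None)] by exact: pres_invE.
exact: (@nf_mulphi _ _ _ _ sH0 JHH phiHN phiH_conj false).
Qed.

(** Reducedness survives: [JH e] consists of all [iota a] with [val a] in [J e], so a letter landing
    in [J e] was already in [JH e]. *)
Let tl_nu e n k e0 c : tl H0 JH phiH e n k e0 c ->
  tl G0 Jb phi e n (nu k) e0 (nu c).
Proof.
elim=> {e n k e0 c} [e _ [a _ <-]|e e' n k e0 _ c [a _ <-] ea _ IH].
  by rewrite nuV nu_iota; apply: tl0; exact: set_valP.
rewrite !nuM nu_iota nu_phi; apply: tlS IH; first exact: set_valP.
by move=> ee' Ja; apply: ea ee' _; exists a.
Qed.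

(** Normal forms are computed in the presented group itself; injectivity thus reduces to
    nontriviality of reduced words in [gT], which ping-pong supplies. *)
Lemma hnn_nat_inj : (forall h e n k e0 c, G0 h -> tl G0 Jb phi e n k e0 c ->
    h * phi e * c <> 1) -> injective nu.
Proof.
move=> H x y xy; apply: (mulIg y^-1); rewrite mulgV.
have : nu (x / y) = 1 by rewrite nuM nuV xy mulgV.
case: (nfH (x / y)) => [[a _ <-]|[_ [e [n [k [e0 [c [[a _ <-] tlc ->]]]]]]]].
  by rewrite nu_iota; exact: iota1.
rewrite !nuM nu_iota nu_phi => h1; exfalso; apply: H h1 => //; last exact: tl_nu tlc.
exact: set_valP.
Qed.

Lemma hnn_nat_image (G1 : set gT) : G1 = generated [set f] ->
  range nu = generated (G0 `|` G1).
Proof.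
move=> G1E; apply/seteqP; split=> [_ [x _ <-]|].
  have sG := generated_subgroup (G0 `|` G1).
  have Gf : generated (G0 `|` G1) f.
    by apply: sub_gen; right; rewrite G1E; apply: sub_gen.
  have Gphi e : generated (G0 `|` G1) (phi e) by case: e => //=; exact: (subgV sG).
  have GG0 : G0 `<=` generated (G0 `|` G1) by move=> g Gg; apply: sub_gen; left.
  have tlG e n k e0 c : tl G0 Jb phi e n k e0 c -> generated (G0 `|` G1) c.
    elim=> {e n k e0 c} [e h /GG0//|e e' n k e0 h c /GG0 Gh _ _ IH].
    by apply: (subgM sG _ IH); exact: (subgM sG).
  case: (nfH x) => [[a _ <-]|[_ [e [n [k [e0 [c [[a _ <-] tlc ->]]]]]]]].
    by rewrite nu_iota; apply: GG0; exact: set_valP.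
  rewrite !nuM nu_iota nu_phi; apply: (subgM sG _ (tlG _ _ _ _ _ (tl_nu tlc))).
  by apply: (subgM sG) => //; apply: GG0; exact: set_valP.
have sR : subgroup (range nu).
  split; first by apply/mem_set; exists 1.
  move=> _ _ /set_mem[x _ <-] /set_mem[y _ <-]; apply/mem_set.
  by exists (x / y) => //; rewrite nuM nuV.
apply: gen_subP => // g [Gg|].
  by exists (iota (mkG Gg)) => //; rewrite nu_iota.
rewrite G1E; apply: gen_subP => // _ ->; by exists tau.
Qed.

Lemma gen_nf (G1 : set gT) g : G1 = generated [set f] -> generated (G0 `|` G1) g ->
  nf G0 Jb phi g.
Proof.
move=> G1E; rewrite -(hnn_nat_image G1E) => -[x _ <-].
case: (nfH x) => [[a _ <-]|[_ [e [n [k [e0 [c [[a _ <-] tlc ->]]]]]]]].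
  by left; rewrite nu_iota; exact: set_valP.
right; exists (val a), e, n, (nu k), e0, (nu c).
by split; [exact: set_valP|exact: tl_nu|rewrite !nuM nu_iota nu_phi].
Qed.

End HnnInjective.

(** Lemmas such as [conv_dich] want membership at every index; the filler [t0] supplies it on a
    [Uf]-negligible set of indices. *)
Lemma near_seq (T : Type) (P : T -> Prop) (t0 : T) (s : nat -> T) : P t0 ->
  (\forall k \near Uf, P (s k)) ->
  exists s', (forall k, P (s' k)) /\ \forall k \near Uf, s k = s' k.
Proof.
move=> P0 Ps; exists (fun k => if `[< P (s k) >] then s k else t0); split=> [k|].
  by case: asboolP.
by apply: filterS Ps => k Pk; rewrite asboolT.
Qed.

(** * Convergent sequences of homeomorphisms *)

Section SeqLimits.
Variables (R : realType) (M : metricType R) (Mc : compact [set: M]).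
Implicit Types (x y z : M) (g h : homeo M).

Lemma cvg_homeo_tends (s : nat -> homeo M) (h : homeo M) (u : nat -> M) x :
  s @ \oo --> h -> tends u x -> tends (fun k => s k (u k)) (h x).
Proof.
move=> sh ux e e0; have e2 : (0 < e / 2)%R by rewrite divr_gt0.
have [d d0 Hd] := h_unif h x e2.
pose K := [set z | (mdist z x <= d / 2)%R].
have cK : compact K.
  apply: subclosed_compact Mc _ => //; apply: closedP_mdist => y H; rewrite /K /=.
  rewrite leNgt; apply/negP => yx.
  have [|z zK zy] := H (mdist y x - d / 2)%R; first by rewrite subr_gt0.
  have {}zK : (mdist z x <= d / 2)%R := zK.
  by have := mdist_tri z y x; rewrite (mdistC y z); lra.
pose V := [set z | (mdist z (h x) < e)%R].
have opV : open V.
  rewrite openE => z Vz; apply/nbhs_ballP; exists (e - mdist z (h x))%R => /=.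
    by rewrite subr_gt0.
  move=> w; rewrite ballEmdist/= /V/= => zw.
  by have := mdist_tri z w (h x); rewrite (mdistC w z); lra.
have hKV : h @` K `<=` V.
  move=> _ [z zK <-]; have {}zK : (mdist z x <= d / 2)%R := zK.
  have : (mdist z x < d)%R by lra.
  by move=> /Hd; rewrite /V/=; lra.
have FF : Filter (s @ \oo) by apply: fmap_filter.
have : \forall k \near \oo, (s k) @` K `<=` V := homeo_ev_cvg FF sh cK opV hKV.
move=> /Uf_eventually; have d2 : (0 < d / 2)%R by rewrite divr_gt0.
move=> H; apply: filterS2 H (ux _ d2) => k Hk /ltW uk; apply: Hk.
by exists (u k).
Qed.

Lemma cvg_homeo_quot (s : nat -> homeo M) (h : homeo M) x : s @ \oo --> h ->
  tends (fun k => ((s k)^-1 * s k.+1) x) x /\ tends (fun k => ((s k)^-1 * s k.+1)^-1 x) x.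
Proof.
move=> sh; have s1h : (fun k => s k.+1) @ \oo --> h.
  move=> A /sh[N _ HN]; exists N => // k /= Nk; apply: HN; exact: leqW.
have inv (t : nat -> homeo M) v y : t @ \oo --> h -> tends v (h y) ->
    tends (fun k => (t k)^-1 (v k)) y.
  move=> th vy; have [w Hw] := Uconv Mc (fun k => (t k)^-1 (v k)).
  suff -> : y = w by [].
  apply: (@h_inj _ h); apply: tends_uniq vy _.
  by apply: tends_eq (cvg_homeo_tends th Hw); apply: nearW => k; rewrite hVK.
split.
  exact: inv sh (cvg_homeo_tends s1h (tends_cst x)).
have := inv _ _ _ s1h (cvg_homeo_tends sh (tends_cst x)).
by apply: tends_eq; apply: nearW => k; rewrite invgM invgK.
Qed.

End SeqLimits.

(** * Ping-pong *)

Section Combination.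
Variables (R : realType) (M : metricType R) (Mc : compact [set: M]).
Implicit Types (x y z : M) (g h : homeo M).
Variables (G0 J1 Jm1 : set (homeo M)) (f : homeo M).
Hypotheses (sG0 : subgroup G0) (dG0 : discrete_convergence_group G0).
Hypotheses (sJ1 : subgroup J1) (J1G : J1 `<=` G0) (sJm1 : subgroup Jm1) (Jm1G : Jm1 `<=` G0).
Hypothesis conjJ : [set f * j * f^-1 | j in Jm1] = J1.
Variables (B : bool -> set M) (x0 : M).
Notation J := (Jb Jm1 J1).
Notation phi := (phi f).
Notation tl := (tl G0 J phi).
Hypotheses (cB : forall e, closed (B e)) (iB : forall e, (B e)° !=set0).
Hypothesis JB : forall e g, J e g -> g @` B e = B e.
Hypothesis GJB : forall e g, G0 g -> ~ J e g -> g @` B e `&` B e = set0.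
Hypothesis GBB : forall e e' g, e <> e' -> G0 g -> g @` B e `&` B e' = set0.
Hypothesis fAB : f @` (~` (B true `|` B false) `|` B true) = (B true)°.
Hypothesis Bx0 : forall g e, G0 g -> ~ (g @` B e) x0.
Variables (G : set (homeo M)) (G1 : set (homeo M)).
Hypotheses (G1E : G1 = generated [set f]) (GE : G = generated (G0 `|` G1)).
Hypothesis cG : convergence_group G.

(** The target of the letter [phi e] in ping-pong, defined alike for both signs although [fAB] only
    concerns [f]. In contrast to [B e], it never meets the limit set of [G0] ([limit_O]). *)
Definition O e : set M := phi e @` (~` B (~~ e)).

Lemma OB e : O e `<=` B e.
Proof.
case: e => _ [x /= nBx <-] /=.
  apply: interior_subset; rewrite -fAB; exists x => //.
  by have [Bx|Bx] := EM (B true x); [right|left => -[]].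
apply: contrapT => nB; apply: nBx; apply: interior_subset; rewrite -fAB.
exists (f^-1 x); last by rewrite hVK.
by have [Bx|Bx] := EM (B true (f^-1 x)); [right|left => -[]].
Qed.

Lemma translate_meet h k e e' x : G0 h -> G0 k -> (h @` B e) x -> (k @` B e') x ->
  e = e' /\ J e (h^-1 * k).
Proof.
move=> Gh Gk /him hx /him kx.
have Ghk : G0 (h^-1 * k) by apply: subgM => //; exact: subgV.
have inter : ((h^-1 * k) @` B e' `&` B e) (h^-1 x).
  by split=> //; apply/him; rewrite invgM invgK hM hVK.
have [ee|ee] := EM (e' = e); last by have := GBB ee Ghk => H; move: inter; rewrite H.
subst e'; split=> //; apply: contrapT => nJ.
by have := GJB Ghk nJ => H; move: inter; rewrite H.
Qed.

Lemma meetBB h e e' x : G0 h -> (h @` B e) x -> B e' x -> e = e' /\ J e h.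
Proof.
move=> Gh hx Bx; have [||-> ] := @translate_meet 1 h e' e x (subg1 sG0) Gh.
- by rewrite him1.
- by [].
- by rewrite invg1 mul1g.
Qed.

(** By induction on the word: reducedness keeps the intermediate translate of [B e'] by [h] disjoint
    from [B (~~ e)], so the next letter can be applied. *)
Lemma tl_pp e n k e0 c x : tl e n k e0 c -> ~ (k @` B e0) x -> O e (phi e (c x)).
Proof.
move=> tlc; elim: tlc x => {e n k e0 c} [e h Gh|e e' n k e0 h c Gh eh _ IH] x nV.
  by exists (h x) => // hx; apply: nV; apply/him; rewrite invgK.
exists ((h * phi e' * c) x) => // Bx.
have /OB Be' := IH x nV.
have hB : (h @` B e') ((h * phi e' * c) x) by exists (phi e' (c x)).
have [ee' Jh] := meetBB Gh hB Bx.
by apply: eh => //; rewrite -ee'.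
Qed.

Lemma word_pp h e n k e0 c x : tl e n k e0 c -> ~ (k @` B e0) x ->
  (h @` B e) ((h * phi e * c) x).
Proof. by move=> tlc /(tl_pp tlc)/OB Bx; exists (phi e (c x)). Qed.

Lemma word_neq1 h e n k e0 c : G0 h -> tl e n k e0 c -> h * phi e * c <> 1.
Proof.
move=> Gh tlc w1; have := word_pp h tlc (Bx0 (e := e0) (tl_end sG0 tlc)).
by rewrite w1 => /(Bx0 Gh).
Qed.

Lemma hnn_bij : set_bij [set: hnn G0 Jm1 f] G (@hnn_nat _ G0 Jm1 f).
Proof.
split.
- move=> x _; rewrite GE -(hnn_nat_image sG0 J1G Jm1G conjJ G1E).
  by exists x.
- move=> x y _ _; apply: (hnn_nat_inj sG0 J1G Jm1G conjJ) => h e n k e0 c.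
  exact: word_neq1.
- by move=> g; rewrite GE -(hnn_nat_image sG0 J1G Jm1G conjJ G1E).
Qed.

Lemma sG : subgroup G. Proof. by rewrite GE; exact: generated_subgroup. Qed.
Lemma G0G : G0 `<=` G. Proof. by move=> g Gg; rewrite GE; apply: sub_gen; left. Qed.
Lemma Gphi e : G (phi e).
Proof.
have Gf : G f by rewrite GE; apply: sub_gen; right; rewrite G1E; exact: sub_gen.
by case: e => //=; exact: (subgV sG).
Qed.
Lemma tlG e n k e0 c : tl e n k e0 c -> G c.
Proof.
elim=> {e n k e0 c} [e h /G0G//|e e' n k e0 h c /G0G Gh _ _ IH].
by apply: (subgM sG _ IH); exact: (subgM sG Gh (Gphi _)).
Qed.

Lemma GnfP g : G g -> nf G0 J phi g.
Proof. by rewrite GE; exact: gen_nf. Qed.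

Lemma M3 : exists x y z : M, [/\ x <> y, y <> z & x <> z].
Proof.
have [b1 b1B] := iB true; have [b2 b2B] := iB false.
move/interior_subset: b1B => b1B; move/interior_subset: b2B => b2B.
have ne e b : B e b -> x0 <> b.
  by move=> Bb xb; apply: (Bx0 (e := e) (subg1 sG0)); rewrite him1 xb.
exists x0, b1, b2; split; [exact: ne b1B| |exact: ne b2B].
move=> b12; have [] // := meetBB (subg1 sG0) (e := true) (e' := false) (x := b1).
  by rewrite him1.
by rewrite b12.
Qed.

Lemma G_discrete : discrete_convergence_group G.
Proof.
split=> // s [si Gs] [h0 sh].
have [b1 b1i] := iB true; have [b2 b2i] := iB false.
pose g k := (s k)^-1 * s k.+1.
have gx x : tends (fun k => g k x) x by have [] := cvg_homeo_quot Mc x sh.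
have gVx x : tends (fun k => (g k)^-1 x) x by have [] := cvg_homeo_quot Mc x sh.
have Gg k : G (g k) by apply: (subgM sG) => //; exact: (subgV sG).
have g1 k : g k <> 1.
  move=> /(congr1 (fun u => s k * u)); rewrite mulVKg mulg1 => /si/eqP.
  by rewrite gtn_eqF.
have [gG0|] : (\forall k \near Uf, G0 (g k)) \/ (\forall k \near Uf, exists h e n k' e0 c,
    [/\ G0 h, tl e n k' e0 c & g k = h * phi e * c]).
  by apply: Uf_or; apply: nearW => k; exact: GnfP.
  have [g' [Gg' gg']] := near_seq (subg1 sG0) gG0.
  have g'x x : tends (fun k => g' k x) x.
    by apply: tends_eq (gx x); apply: filterS gg' => k ->.
  have [[h Gh g'h]|[_ [a [b ab]]]] := conv_dich Mc dG0 Gg'.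
    have [k [gk g'k]] := Uf_ex2 gg' g'h.
    apply: (g1 k); rewrite gk g'k; apply: homeo_ext => x.
    by apply/esym/(tends_const (g'x x)); apply: filterS g'h => j ->.
  have [x [xb xa]] := pick_neq2 M3 b a.
  by apply: xa; exact: tends_uniq (g'x x) (attU_pt ab xb).
move=> Hg.
have near_B e b : (B e)° b -> \forall k \near Uf, B e ((g k)^-1 b).
  move=> /nbhs_ballP[d /= d0 bd]; apply: filterS (gVx b d d0) => k kb.
  by apply: bd; rewrite ballEmdist /= mdistC.
(* If [b1] or [b2] lies in the translate of [B e] by [h], that translate is one of the [B i], and it
   contains [g k x0]. Otherwise ping-pong puts both preimages into the translate of [B e0] by [k'];
   being close to [b1] and [b2] they also lie in [B true] and [B false], so [e0] would take both
   values. *)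
have : \forall k \near Uf, (B true `|` B false) (g k x0).
  apply: filterS3 Hg (near_B _ _ b1i) (near_B _ _ b2i) => k.
  move=> [h [e [n [k' [e0 [c [Gh tlc gk]]]]]]] B1 B2.
  have Gk' := tl_end sG0 tlc.
  have Ux0 := word_pp h tlc (Bx0 (e := e0) Gk'); rewrite -gk in Ux0.
  have notU b e' : ~ (h @` B e) b -> B e' ((g k)^-1 b) -> e0 = e' /\ J e0 k'.
    move=> nU; apply: meetBB Gk' _; apply: contrapT => /(word_pp h tlc).
    by rewrite -gk hVK.
  have isU b e' : (h @` B e) b -> (B e')° b -> (B true `|` B false) (g k x0).
    move=> Ub /interior_subset Bb; have [ee' Jh] := meetBB Gh Ub Bb.
    by move: Ux0; rewrite JB//; case: (e); [left|right].
  have [U1|U1] := EM ((h @` B e) b1); first exact: isU U1 b1i.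
  have [U2|U2] := EM ((h @` B e) b2); first exact: isU U2 b2i.
  by have [e01 _] := notU _ _ U1 B1; have [e02 _] := notU _ _ U2 B2; rewrite e01 in e02.
move=> H; have cBB : closed (B true `|` B false) by exact: closedU.
have : (B true `|` B false) x0 by exact: tends_closed cBB H (gx x0).
have nB e : ~ B e x0 by move=> Bx; apply: (Bx0 (e := e) (subg1 sG0)); rewrite him1.
by case=> /nB.
Qed.

Lemma loxodromic_conj g h : G g -> G h -> loxodromic g -> loxodromic (h * g * h^-1).
Proof.
move=> Gg Gh [eg [x [y [xy gxy]]]]; split.
  move=> /(@elliptic_conj _ _ Mc M3 _ sG G_discrete _ h^-1).
  rewrite invgK !mulgA mulVg mul1g mulgVK => H; apply: eg; apply: H.
  by apply: (subgM sG _ (subgV sG Gh)); exact: (subgM sG).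
exists (h x), (h y); split; first by move=> /h_inj.
rewrite fixed_points_conj gxy; apply/seteqP; split=> [_ [_ [->|->] <-]|_ [->|->]].
- by left.
- by right.
- by exists x => //; left.
- by exists y => //; right.
Qed.

Lemma word_loxodromic n : forall h e k e0 c, G0 h -> tl e n k e0 c ->
  ~ (exists2 p, G p & G0 (p * (h * phi e * c) * p^-1)) -> loxodromic (h * phi e * c).
Proof.
elim/ltn_ind: n => n IHn h e k e0 c Gh tlc nconj.
have Gk := tl_end sG0 tlc; have Gc := tlG tlc.
have Gw : G (h * phi e) by apply: (subgM sG (G0G Gh)); exact: Gphi.
have Gg : G (h * phi e * c) by exact: (subgM sG).
have [[x [Ux Vx]]|dis] := EM (exists x, (h @` B e) x /\ (k @` B e0) x); last first.
  apply: (@pp_loxodromic _ _ Mc M3 _ sG G_discrete _ (h @` B e) (k @` B e0) x0 Gg).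
  - exact: closed_him.
  - exact: closed_him.
  - by move=> x Ux Vx; apply: dis; exists x.
  - by move=> x; exact: word_pp tlc.
  - exact: Bx0.
  - exact: Bx0.
have [ee0 Jhk] := translate_meet Gh Gk Ux Vx; subst e0.
case: n IHn tlc => [|n] IHn tlc.
  by have [_ _] := tl0P tlc erefl; case: (e).
have [k' [e' tlc']] := tl_cancel (phiN f) tlc.
have Jhk' : J e (k^-1 * h) by rewrite -[k^-1 * h]invgK invgM invgK; exact: (subgV (Jb_sub sJ1 sJm1 e)).
(* Conjugation by [h * phi e] moves the first stable letter to the end, where only the element
   [k^-1 * h] of [J e] stands between it and the last one. Both letters disappear, and the word has
   two stable letters fewer. *)
have Jj : J (~~ e) ((phi e)^-1 * (k^-1 * h) * phi e).
  have := @Jb_conj _ Jm1 J1 f conjJ (~~ e) (k^-1 * h).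
  by rewrite negbK phiN invgK; exact.
have {tlc'} := tl_mulr sG0 tlc' (JbG J1G Jm1G Jj).
have -> : c * k * phi e * ((phi e)^-1 * (k^-1 * h) * phi e) = c * (h * phi e).
  by rewrite !mulgA mulgK mulgK.
set c' := c * (h * phi e) => tlc'.
have gE : h * phi e * c = (h * phi e) * c' * (h * phi e)^-1.
  by rewrite /c' !mulgA -(mulgA _ h) mulgK.
have Gc' := tlG tlc'.
rewrite gE; apply: loxodromic_conj => //.
have nconj' : ~ (exists2 p, G p & G0 (p * c' * p^-1)).
  move=> [p Gp Hp]; apply: nconj; exists (p * (h * phi e)^-1).
    by apply: (subgM sG Gp); exact: (subgV sG).
  have conjE q : p * q^-1 * (q * c' * q^-1) * (p * q^-1)^-1 = p * c' * p^-1.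
    by rewrite invgM invgK !mulgA !mulgVK.
  by rewrite gE conjE.
case: n IHn tlc tlc' => [|m] IHn tlc tlc'.
  have [Gc0 _ _] := tl0P tlc' erefl; case: nconj'; exists 1; first exact: (subg1 sG).
  by rewrite mul1g invg1 mulg1.
have [e1 [h1 [c1 [Gh1 _ tlc1 cE]]]] := tlSP tlc'.
by rewrite cE; apply: IHn tlc1 _ => //; rewrite -cE.
Qed.

Lemma G_loxodromic g : G g -> ~ (exists2 h, G h & G0 (h * g * h^-1)) -> loxodromic g.
Proof.
move=> /GnfP[Gg nconj|[h [e [n [k [e0 [c [Gh tlc ->]]]]]]]]; last exact: word_loxodromic tlc.
by case: nconj; exists 1; [exact: (subg1 sG)|rewrite mul1g invg1 mulg1].
Qed.

(** * Geometrical finiteness *)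

Local Notation L := (limit_set (M := M)).
Hypothesis LB : forall e, L G0 `&` B e = L (J e).

Lemma J_conjE e : [set phi e * j * (phi e)^-1 | j in J (~~ e)] = J e.
Proof.
apply/seteqP; split=> [_ [j Jj <-]|j Jj]; first exact: Jb_conj.
exists ((phi e)^-1 * j * phi e); last by rewrite !mulgA mulgV mul1g mulgK.
have := @Jb_conj _ Jm1 J1 f conjJ (~~ e) j.
by rewrite negbK phiN invgK; exact.
Qed.

Lemma limit_J_phi e x : L (J e) (phi e x) <-> L (J (~~ e)) x.
Proof.
by rewrite -{1}(J_conjE e) limit_set_conj//; split=> [/him|Lx]; [rewrite hK|exists x].
Qed.

Lemma limit_J e x : L (J e) x <-> L G0 x /\ B e x.
Proof. by rewrite -LB; split=> -[]. Qed.

(** Conjugation by [phi e] carries the limit set of [J (~~ e)] onto that of [J e], so a limit point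
    in [B e] comes from a point of [B (~~ e)]. *)
Lemma limit_O e x : O e x -> ~ L G0 x.
Proof.
move=> /[dup] /OB Bx [y nBy yx] Lx; apply: nBy.
by have /limit_J_phi/limit_J[] : L (J e) (phi e y) by rewrite yx; exact/limit_J.
Qed.

Lemma limit_G0_inv g x : G0 g -> L G0 (g x) <-> L G0 x.
Proof. exact: limit_set_inv. Qed.

Lemma J_sub e : subgroup (J e). Proof. exact: Jb_sub. Qed.
Lemma J_G0 e : J e `<=` G0. Proof. exact: JbG. Qed.
Lemma J_discrete e : discrete_convergence_group (J e).
Proof. exact: discrete_sub (J_G0 (e := e)) dG0. Qed.
Lemma limit_G0_G : L G0 `<=` L G. Proof. exact/limit_setS/G0G. Qed.

(** If [c x] were in [B (~~ e)], reducedness would keep [phi e' (c' x)] out of [B e'], so [c' x]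
    would be in [O (~~ e')]. This contradicts [limit_O] when [c'] is in [G0], and the induction
    hypothesis otherwise. *)
Lemma tl_limit n : forall e k e0 c x, tl e n.+1 k e0 c -> L G0 x -> ~ B (~~ e) (c x).
Proof.
elim: n => [|n IHn] e k e0 c x tlc Lx Bcx;
  have [e' [h [c' [Gh eh tlc' cE]]]] := tlSP tlc.
all: have nB : ~ B e' (phi e' (c' x)).
1,3: by move=> Bu; have [|ee' Jh] := @meetBB h e' (~~ e) (c x) Gh _ Bcx;
  [rewrite cE; exists (phi e' (c' x))|apply: eh => //; rewrite -ee'].
all: have Oc : O (~~ e') (c' x) by
  (exists (phi e' (c' x)); [rewrite negbK|rewrite phiN hK]).
- have [Gc' _ _] := tl0P tlc' erefl.
  by apply: (limit_O Oc); exact/limit_G0_inv.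
- exact: IHn tlc' Lx (OB Oc).
Qed.

(** For a reduced word fixing [x], [limit_O] forces [c x] into [B (~~ e)], and then [tl_limit]
    leaves a single stable letter. In that case [x] would lie in translates of both [B e] and
    [B (~~ e)], which are disjoint. *)
Lemma stab_G0 g x : L G0 x -> G g -> g x = x -> G0 g.
Proof.
move=> Lx /GnfP[//|[h [e [n [k [e0 [c [Gh tlc gE]]]]]]]] gx; exfalso.
have [Bc|nBc] := EM (B (~~ e) (c x)); last first.
  have Oc : O e (phi e (c x)) by exists (c x).
  by apply: (limit_O Oc); apply/(limit_G0_inv _ Gh); rewrite -!hM -gE gx.
case: n tlc => [|n] tlc; last exact: tl_limit tlc Lx Bc.
have [Gc _ _] := tl0P tlc erefl.
have Lc : L (J (~~ e)) (c x) by apply/limit_J; split=> //; exact/limit_G0_inv.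
have Bpc : B e (phi e (c x)) by have /limit_J_phi/limit_J[] := Lc.
have Ux : (h @` B e) x by rewrite -gx gE; exists (phi e (c x)).
have Vx : ((c^-1)%g @` B (~~ e)) x by apply/him; rewrite invgK.
by have [] := translate_meet Gh (subgV sG0 Gc) Ux Vx; case: (e).
Qed.

Lemma stab_J e g x : L (J e) x -> G0 g -> g x = x -> J e g.
Proof.
move=> /limit_J[_ Bx] Gg gx; have gB : (g @` B e) x by exists x.
by have [] := meetBB Gg gB Bx.
Qed.

Lemma bdd_G_G0 x : L G0 x -> bdd G x -> bdd G0 x.
Proof.
move=> Lx [d d0 Hd]; exists d => // y Ly yx.
have [t [Gt tx dt]] := Hd y (limit_G0_G Ly) yx.
by exists t; split=> //; exact: stab_G0 Lx Gt tx.
Qed.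

Lemma O_nonempty e : exists y, O e y.
Proof.
exists (phi e x0); exists x0 => // Bx; apply: (Bx0 (e := ~~ e) (subg1 sG0)).
by rewrite him1.
Qed.

Lemma rep_neq_O s a b y e : (forall k, G0 (s k)) -> ufree s -> attU s a b -> O e y -> y <> b.
Proof.
move=> Gs fs sab /limit_O Oy yb; apply: Oy; rewrite yb.
exact: rep_limit_set sG0 Gs fs sab.
Qed.

Section BoundedParabolic.
Hypothesis J_gf : forall e, geometrically_finite (J e).
Hypothesis J_bp : forall e p, parabolic_point (J e) p -> bounded_parabolic_point G0 p.

Lemma J_push e (s : nat -> homeo M) : (forall k, G0 (s k)) ->
  exists j : nat -> homeo M, (forall k, J e (j k)) /\
    ((exists2 h, G0 h & \forall k \near Uf, j k * s k = h) \/
     (exists a b, [/\ ufree (fun k => j k * s k), attU (fun k => j k * s k) a b,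
        L G0 a & ~ B e a])).
Proof.
move=> Gs; have [GJ|/existsNP[g1 /not_implyP[Gg1 nJg1]]] := EM (G0 `<=` J e).
  exists (fun k => (s k)^-1); split=> [k|]; first exact: (subgV (J_sub e) (GJ _ (Gs k))).
  by left; exists 1; [exact: subg1|apply: nearW => k; rewrite mulVg].
have [y Oy] := O_nonempty e; have nLy := limit_O Oy.
have nLsy k : ~ L (J e) (s k y) by move=> /limit_J[+ _] => /(limit_G0_inv _ (Gs k)).
have ParL : [set p | parabolic_point (J e) p] `<=` L (J e) by move=> p [].
have [|j [q [Jj jq nLq]]] := cocompact_limit Mc (J_sub e) (J_discrete e) nLsy ParL
    (parabolic_countable Mc M3 (J_discrete e)).
  move=> q Lq; case: (J_gf Lq) => [/(conicalP Mc M3 (J_discrete e))|[pq _]].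
    by move=> [_ [s' [b [c [Js' fs' s'bq s'c bc]]]]]; left; exists s', c, b; split=> //; exact/nesym.
  right; split=> // j Jj jq.
  (* Boundedness comes from [G0], but the elements found by [bdd_push] fix [q] and so belong to
     [J e] by [stab_J]; the same lemma shows that [g1] moves [q]. *)
  have [pGq bGq] := (boundedP Mc sG0 q).1 (J_bp pq).
  have g1q : g1 q <> q by move=> /(stab_J Lq Gg1).
  have Gjs k : G0 (j k * s k) by apply: subgM => //; exact: J_G0.
  have [t [Gt tq H]] := bdd_push Mc M3 sG0 dG0 pGq bGq Gg1 g1q Gjs.
  have Lq0 := ParL _ pq; have /limit_J[LGq _] := Lq0.
  have Jt k : J e (t k) by exact: stab_J Lq0 (Gt k) (tq k).
  have [q' tq' q'q] : exists2 q', tends (fun k => t k (j k (s k y))) q' & q' <> q.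
    case: H => [[h Gh hE]|[a [b [ft ab aq]]]].
      exists (h y); last by move=> hyq; apply: nLy; apply/(limit_G0_inv _ Gh); rewrite hyq.
      by apply: tends_eq (tends_cst (h y)); apply: filterS hE => k hk; rewrite -hk.
    have Gts k : G0 (t k * (j k * s k)) by exact: subgM.
    by exists a => //; exact: attU_pt ab (rep_neq_O Gts ft ab Oy).
  exists t, q'; split=> //.
  have tq1 : tends (fun k => t k q) q by apply: tends_eq (tends_cst q); apply: nearW => k.
  have [[h0 _ th0]|[ft [a [b tab]]]] := conv_dich Mc (J_discrete e) Jt.
    case: q'q; apply: tends_uniq tq' _.
    have -> : q = h0 q by have [k <-] := Uf_ex th0; rewrite tq.
    by apply: tends_eq (tends_him h0 jq); apply: filterS th0 => k ->.
  (* [t k] fixes [q] yet moves a sequence tending to [q] to a different limit, so [q] is repelling.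
     It is attracting as well, since otherwise it would be conical. *)
  have qb : q = b.
    apply: contrapT => qb; apply: q'q.
    by rewrite (tends_uniq tq' (attU_lim tab jq qb)) (tends_uniq tq1 (attU_pt tab qb)).
  suff qa : a = q by rewrite qa -qb in tab.
  apply: contrapT => aq; apply: (parabolic_not_conical Mc M3 (J_sub e) (J_discrete e) pq).
  apply/(conicalP Mc M3 (J_discrete e)); split=> //.
  by exists t, a, q; split=> //; rewrite qb.
exists j; split=> //.
have Gjs k : G0 (j k * s k) by apply: subgM => //; exact: J_G0.
have [|[fjs [a [b ab]]]] := conv_dich Mc dG0 Gjs; [by left|right; exists a, b].
have La : L G0 a by exact: att_limit_set ab.
split=> // Ba; apply: nLq; have -> : q = a; last exact/limit_J.
exact: tends_uniq jq (attU_pt ab (rep_neq_O Gjs fjs ab Oy)).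
Qed.

(** Apply [J_push] to the inverses. In the attracting case, points of [B e] remain in [B e] under
    [j k], hence stay off [a], which is the repelling point of the inverse sequence. *)
Lemma translates_null e (s : nat -> homeo M) : (forall k, G0 (s k)) ->
  (exists2 h, G0 h & \forall k \near Uf, s k @` B e = h @` B e) \/
  (exists2 z, L G0 z & forall u, (\forall k \near Uf, B e (u k)) ->
     tends (fun k => s k (u k)) z).
Proof.
move=> Gs; have GsV k : G0 (s k)^-1 by exact: subgV.
have [j [Jj H]] := J_push e GsV.
case: H => [[h Gh jh]|[a [b [fj ab La nBa]]]].
  left; exists h^-1; first exact: subgV.
  apply: filterS jh => k <-; rewrite invgM invgK him_mul.
  by rewrite (JB (subgV (J_sub e) (Jj k))).
have Gjs k : G0 (j k * (s k)^-1) by apply: subgM => //; exact: (J_G0 (Jj k)).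
right; exists b => [|u uB]; first exact: rep_limit_set sG0 Gjs fj ab.
have [l jl] := Uconv Mc (fun k => j k (u k)).
have Bl : B e l.
  apply: (tends_closed (cB (e := e)) _ jl); apply: filterS uB => k uB.
  by rewrite -(JB (Jj k)); exists (u k).
have la : l <> a by move=> la; apply: nBa; rewrite -la.
apply: tends_eq (attU_lim (attUV ab) jl la).
by apply: nearW => k; rewrite invgM invgK hM hK.
Qed.

(** After the push, the translates either stabilize at a closed set disjoint from [B e], or shrink
    to the attracting point [a], which [J_push] keeps outside [B e]. *)
Lemma translates_avoid e e' (s : nat -> homeo M) :
  (\forall k \near Uf, G0 (s k) /\ ~ (e' = e /\ J e (s k))) ->
  exists j : nat -> homeo M, (forall k, J e (j k)) /\
    forall u l, (\forall k \near Uf, (s k @` B e') (u k)) ->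
      tends (fun k => j k (u k)) l -> ~ B e l.
Proof.
move=> Hs0; have [i Hi] := Uf_ex Hs0.
have [s' [Hs ss']] := near_seq (P := fun g => G0 g /\ ~ (e' = e /\ J e g)) Hi Hs0.
have [j [Jj H]] := J_push e (fun k => (Hs k).1).
exists j; split=> // u l su0 jl Bl.
have su : \forall k \near Uf, (s' k @` B e') (u k).
  by apply: filterS2 ss' su0 => k ->.
have Gjs k : G0 (j k * s' k) by apply: subgM (Hs k).1 => //; exact: J_G0 (Jj k).
have const h : (\forall k \near Uf, (j k * s' k) @` B e' = h @` B e') -> False.
  move=> hE; have hl : (h @` B e') l.
    have clh : closed (h @` B e') by exact: closed_him.
    apply: (tends_closed clh _ jl).
    by apply: filterS2 hE su => k <- sk; rewrite him_mul; exists (u k).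
  have [k kE] := Uf_ex hE; move: hl; rewrite -kE => hl.
  have : (s' k @` B e') ((j k)^-1 l) by move: hl; rewrite him_mul => /him.
  have : B e ((j k)^-1 l).
    by rewrite -(JB (subgV (J_sub e) (Jj k))); exists l.
  by move=> Bjl sjl; have [ee' Js] := meetBB (Hs k).1 sjl Bjl; apply: (Hs k).2; rewrite -ee'.
case: H => [[h _ jh]|[a [b [fj ab La nBa]]]].
  by apply: (const h); apply: filterS jh => k ->.
have [[h _]|[z Lz Hz]] := translates_null e' Gjs; first exact: const.
have [v Ov] := O_nonempty e'.
have za : z = a.
  have vB : \forall k \near Uf, B e' v by apply: nearW => k; exact: OB.
  exact: tends_uniq (Hz _ vB) (attU_pt ab (rep_neq_O Gjs fj ab Ov)).
apply: nBa; rewrite -za; suff -> : z = l by [].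
have vB : \forall k \near Uf, B e' ((s' k)^-1 (u k)) by apply: filterS su => k /him.
apply: tends_uniq (Hz _ vB) _.
by apply: tends_eq jl; apply: nearW => k; rewrite hM hVK.
Qed.

(** [x0] serves unless it equals [b]. In that case a point of [B true] or one of [B false] does: a
    translate containing both would be of both types. *)
Lemma pick_outside (s : nat -> homeo M) (e : nat -> bool) b :
  (\forall k \near Uf, G0 (s k)) ->
  exists2 y, y <> b & \forall k \near Uf, ~ (s k @` B (e k)) y.
Proof.
move=> Gs; have [x0b|x0b] := EM (x0 = b); last first.
  by exists x0 => //; apply: filterS Gs => k Gk; exact: Bx0.
have [b1 /interior_subset B1] := iB true; have [b2 /interior_subset B2] := iB false.
have nb c e' : B e' c -> c <> b.
  by move=> Bc cb; apply: (Bx0 (e := e') (subg1 sG0)); rewrite him1 x0b -cb.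
have [H1|/Uf_N H1] := EM (\forall k \near Uf, ~ (s k @` B (e k)) b1).
  by exists b1 => //; exact: nb B1.
exists b2; first exact: nb B2.
apply: filterS2 Gs H1 => k Gk /contrapT V1 V2.
have [e1 _] := meetBB Gk V1 B1; have [e2 _] := meetBB Gk V2 B2.
by rewrite e1 in e2.
Qed.

(* The condition [C] on the first letters is there for the second application,
   in [limit_G_cases], where it excludes the cancellation of [phi e]. *)
Lemma limit_step (C : homeo M -> bool -> Prop) (c : nat -> homeo M) x b :
  ufree c -> attU c x b ->
  (\forall k \near Uf, G0 (c k) \/ exists h e n k' e0 c', [/\ G0 h, C h e,
     tl e n k' e0 c' & c k = h * phi e * c']) ->
  L G0 x \/ exists h e, [/\ G0 h, C h e, (h @` B e) x &
    \forall k \near Uf, exists j n k' e0 c', [/\ J e j, tl e n k' e0 c' &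
       c k = h * j * phi e * c']].
Proof.
move=> fc cx /Uf_or[Gc|Hc].
  left; have [c' [Gc' cc']] := near_seq (subg1 sG0) Gc.
  apply/(limit_setP Mc); exists c', b; split=> //; last exact: attU_eq cc' cx.
  by move=> a; apply: filterS2 cc' (fc a) => k ->.
pose T := (homeo M * bool * homeo M * bool)%type.
pose P (c : homeo M) (d : T) := exists n c', [/\ G0 d.1.1.1, C d.1.1.1 d.1.1.2,
  tl d.1.1.2 n d.1.2 d.2 c' & c = d.1.1.1 * phi d.1.1.2 * c'].
have /choice[d Hd] : forall k, exists d : T, (exists d, P (c k) d) -> P (c k) d.
  move=> k; have [[d Pd]|nd] := EM (exists d, P (c k) d); first by exists d.
  by exists (1, true, 1, true).
have {}Hd : \forall k \near Uf, P (c k) (d k).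
  apply: filterS Hc => k [h [e [n [k' [e0 [c' [Gh Ch tlc cE]]]]]]]; apply: Hd.
  by exists (h, e, k', e0), n, c'.
have [e eE] := Uf_bool (fun k => (d k).1.1.2).
have Gd : \forall k \near Uf, G0 (d k).1.1.1 by apply: filterS Hd => k [n [c' []]].
have Gk : \forall k \near Uf, G0 (d k).1.2.
  by apply: filterS Hd => k [n [c' [_ _ /(tl_end sG0)]]].
have [y yb yV] := pick_outside (fun k => (d k).2) b Gk.
have Uy : \forall k \near Uf, ((d k).1.1.1 @` B e) (c k y).
  apply: filterS3 Hd eE yV => k [n [c' [_ _ tlc cE]]] ek nV.
  by rewrite cE -ek; exact: word_pp tlc nV.
have cy := attU_pt cx yb.
have [h [Gh hd]] := near_seq (subg1 sG0) Gd.
have [[h0 Gh0 hE]|[z Lz Hz]] := translates_null e Gh; last first.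
  left; suff -> : x = z by [].
  have uB : \forall k \near Uf, B e ((h k)^-1 (c k y)).
    by apply: filterS2 hd Uy => k <- /him.
  by apply: tends_uniq cy _; apply: tends_eq (Hz _ uB); apply: nearW => k; rewrite hVK.
right; have Hd' : \forall k \near Uf, [/\ (d k).1.1.1 @` B e = h0 @` B e, P (c k) (d k)
    & (d k).1.1.2 = e].
  by apply: filterS2 eE (filterI hE (filterI hd Hd)) => k ek [hE' [-> Pd]].
have [i [iE [n [c' [Gi Ci _ _]]] ei]] := Uf_ex Hd'.
exists (d i).1.1.1, e; split=> //; first by rewrite -ei.
  have clh : closed ((d i).1.1.1 @` B e) by exact: closed_him.
  apply: (tends_closed clh _ cy).
  by apply: filterS2 Hd' Uy => k [kE _ _]; rewrite kE iE.
(* Equal translates differ by an element of [J e], so the varying first letter is a fixed [h] times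
   such an element. *)
apply: filterS Hd' => k [kE [n' [c'' [Gdk _ tlk ck]]] ek].
have [v Ov] := O_nonempty e.
have U1 : ((d i).1.1.1 @` B e) ((d i).1.1.1 v) by exists v => //; exact: OB.
have U2 := U1; rewrite iE -kE in U2.
have [_ Jik] := translate_meet Gi Gdk U1 U2.
exists ((d i).1.1.1^-1 * (d k).1.1.1), n', (d k).1.2, (d k).2, c''.
by split; [exact: Jik|rewrite -ek|rewrite mulVKg -ek].
Qed.

(** [limit_step] puts [x] into a translate of [B e]. If [x] is not in the translate of [O e], then
    [x1] lies in [B (~~ e)]. The first letters of the shortened sequence [c1] do not cancel [phi e],
    so a second [limit_step] can only put [x1] into a translate disjoint from [B (~~ e)], unless
    [x1] is a limit point of [G0]. *)
Lemma limit_G_cases x : L G x -> L G0 x \/ exists h e, G0 h /\ (h @` O e) x.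
Proof.
move=> /(limit_setP Mc)[c [b [Gc fc cx]]].
have Hc : \forall k \near Uf, G0 (c k) \/ exists h e n k' e0 c', [/\ G0 h, True,
     tl e n k' e0 c' & c k = h * phi e * c'].
  apply: nearW => k; case: (GnfP (Gc k)) => [|[h [e [n [k' [e0 [c' [? ? ?]]]]]]]]; first by left.
  by right; exists h, e, n, k', e0, c'.
have [|[h [e [Gh _ /him hx Hc1]]]] := limit_step (C := fun _ _ => True) fc cx Hc; first by left.
have [Bx|nBx] := EM (B (~~ e) ((phi e)^-1 (h^-1 x))); last first.
  right; exists h, e; split=> //; apply/him.
  by exists ((phi e)^-1 (h^-1 x)) => //; rewrite hVK.
left; pose q := h * phi e; pose x1 := q^-1 x.
have x1E : x1 = (phi e)^-1 (h^-1 x) by rewrite /x1 invgM.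
pose c1 k := q^-1 * c k.
have fc1 : ufree c1 by apply: (@free_comp _ _ (fun g => q^-1 * g)) fc => g g' /mulgI.
have c1x : attU c1 x1 b by exact: attU_mull.
pose C h' e' := e' = ~~ e -> ~ J (~~ e) h'.
have Hc2 : \forall k \near Uf, G0 (c1 k) \/ exists h e n k' e0 c', [/\ G0 h, C h e,
     tl e n k' e0 c' & c1 k = h * phi e * c'].
  apply: filterS Hc1 => k [j [n [k' [e0 [c' [Jj tlc cE]]]]]].
  pose j' := (phi e)^-1 * j * phi e.
  have Jj' : J (~~ e) j'.
    have := @Jb_conj _ Jm1 J1 f conjJ (~~ e) j.
    by rewrite negbK phiN invgK; exact.
  have c1E : c1 k = j' * c' by rewrite /c1 cE /q /j' invgM !mulgA mulgVK.
  case: n tlc => [|n] tlc.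
    have [Gc' _ _] := tl0P tlc erefl; left; rewrite c1E; apply: subgM => //.
    exact: J_G0 Jj'.
  have [e1 [h1' [c'' [Gh1 eh1 tlc'' c'E]]]] := tlSP tlc; right.
  exists (j' * h1'), e1, n, k', e0, c''; rewrite c1E c'E !mulgA; split=> //.
    by apply: subgM => //; exact: J_G0 Jj'.
  by move=> ee1; rewrite (subgMl (J_sub (~~ e)) _ Jj'); exact: eh1.
suff Lx1 : L G0 x1.
  have : L (J (~~ e)) x1 by apply/limit_J; split=> //; rewrite x1E.
  move=> /limit_J_phi/limit_J[]; rewrite x1E hVK => Lhx _.
  exact/(limit_G0_inv _ (subgV sG0 Gh)).
have [//|[h2 [e2 [Gh2 C2 hx2 _]]]] := limit_step fc1 c1x Hc2.
have [|e2E Jh2] := @meetBB h2 e2 (~~ e) x1 Gh2 hx2; first by rewrite x1E.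
by exfalso; apply: C2 => //; rewrite -e2E.
Qed.
Lemma limit_G_inv g x : G g -> L G (g x) <-> L G x.
Proof. by move=> Gg; exact: limit_set_inv sG Gg. Qed.

Lemma end_conical x : L G x -> (forall g, G g -> ~ L G0 (g x)) ->
  conical_limit_point G x.
Proof.
move=> Lx nLx.
have /choice[he Hhe] : forall g, exists he : homeo M * bool, G g ->
    G0 he.1 /\ (he.1 @` O he.2) (g^-1 x).
  move=> g; have [Gg|nGg] := EM (G g); last by exists (1, true).
  have GgV := subgV sG Gg.
  have [/(nLx _ GgV)//|[h [e [Gh Ox]]]] := limit_G_cases ((limit_G_inv _ GgV).2 Lx).
  by exists (h, e).
(* Follows [x] into nested translates: its preimage under [K n] lies in a translate of some [O e],
   and the next step undoes the corresponding letter. *)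
pose fix K (n : nat) : homeo M := if n is m.+1 then K m * (he (K m)).1 * phi (he (K m)).2 else 1.
pose h n := (he (K n)).1; pose e n := (he (K n)).2.
have GK n : G (K n).
  elim: n => [|n IHn] /=; first exact: (subg1 sG).
  by apply: (subgM sG _ (Gphi _)); apply: (subgM sG IHn); apply: G0G; have [] := Hhe _ IHn.
have Gh n : G0 (h n) by have [] := Hhe _ (GK n).
pose s n := (K n * h n)^-1.
have Gs n : G (s n) by apply: (subgV sG); apply: (subgM sG (GK n)); exact: G0G.
have sx n : O (e n) (s n x).
  by rewrite /s invgM hM; have [_ /him] := Hhe _ (GK n).
have sS n z : s n.+1 z = (h n.+1)^-1 ((phi (e n))^-1 (s n z)).
  have KS : K n.+1 = K n * h n * phi (e n) by [].
  by rewrite /s KS !invgM !hM.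
have back n z : ~ B (e n) (s n z) -> ((h n.+1)^-1%g @` B (~~ e n)) (s n.+1 z).
  move=> nB; rewrite sS; exists ((phi (e n))^-1 (s n z)) => //; apply: OB.
  by exists (s n z); rewrite ?negbK// phiN.
(* If the two sets met, [h n.+1] would belong to [J (e n.+1)], and the preimage of [s n x] under
   [phi (e n)] would lie in [B (~~ e n)], against [sx n]. Hence a point that has left the nested
   sequence never returns to it ([out]). *)
have dis n z : ((h n.+1)^-1%g @` B (~~ e n)) z -> ~ B (e n.+1) z.
  move=> hz Bz; have [een Jh] := meetBB (subgV sG0 (Gh n.+1)) hz Bz.
  have {}Jh := subgVK (J_sub _) Jh.
  have : B (e n.+1) (h n.+1 (s n.+1 x)).
    by rewrite -een -(JB Jh); exists (s n.+1 x) => //; rewrite een; exact: OB.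
  have -> : h n.+1 (s n.+1 x) = (phi (e n))^-1 (s n x) by rewrite sS hVK.
  by rewrite -een; have [w nBw <-] := sx n; rewrite hK.
have out m n z : (m < n)%N -> ~ B (e m) (s m z) ->
    ((h n)^-1%g @` B (~~ e n.-1)) (s n z).
  move=> + nB; elim: n => // n IHn; rewrite ltnS leq_eqVlt => /orP[/eqP <-|mn].
    exact: back.
  by apply: back; case: n IHn mn => // n IHn /IHn; exact: dis.
have [e1 e1E] := Uf_bool (fun n => e n.+1).
have [e2 e2E] := Uf_bool (fun n => ~~ e n).
have Hs : \forall n \near Uf, G0 (h n.+1)^-1 /\ ~ (e2 = e1 /\ J e1 (h n.+1)^-1).
  apply: filterS2 e1E e2E => n e1n e2n; split; first exact: (subgV sG0).
  move=> [e21 Jh]; have Bsx : B (e n.+1) (s n.+1 x) by exact: OB.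
  apply: dis Bsx; rewrite -e1n in Jh; rewrite e2n e21 -e1n (JB Jh).
  exact: OB.
have [j [Jj avoid]] := translates_avoid Hs.
pose t n := j n * s n.+1.
have Gt n : G (t n) by apply: (subgM sG _ (Gs _)); apply: G0G; exact: J_G0 (Jj n).
have tBz n z : e n.+1 = e1 -> B (e n.+1) (s n.+1 z) -> B e1 (t n z).
  by move=> en; rewrite en -{2}(JB (Jj n)) => Bz; exists (s n.+1 z).
have tB : \forall n \near Uf, B e1 (t n x).
  by apply: filterS e1E => n en; apply: tBz => //; exact: OB.
have nBx0 e' : ~ B e' x0 by move=> Bx; apply: (Bx0 (e := e') (subg1 sG0)); rewrite him1.
have [[t0 Gt0 tt0]|[ft [a [b tab]]]] := conv_dich Mc G_discrete Gt.
  have [n [tn en]] := Uf_ex2 tt0 e1E.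
  have [m [nm tm]] := Uf_ex2 (Uf_ge n.+1) tt0.
  (* No translate contains [x0], so by [out] this point is still in [B (e n.+1)] at stage [n.+1]. As
     [t n] and [t m] coincide, [x0] would be in [B e1]. *)
  pose z := (s m.+1)^-1 x0; have sz : s m.+1 z = x0 by rewrite /z hVK.
  have : B (e n.+1) (s n.+1 z).
    have nm' : (n.+1 < m.+1)%N by [].
    apply: contrapT => /(out n.+1 m.+1 z nm'); rewrite sz.
    exact: Bx0 (subgV sG0 (Gh m.+1)).
  move=> /(tBz _ _ en); rewrite tn -tm /t hM sz -(JB (Jj m)) => /him.
  by rewrite hK => /nBx0.
have Gh0 : \forall k \near Uf, G0 (h 0%N) by apply: nearW => k; exact: Gh.
have [z zb znV] := pick_outside (fun=> e 0%N) b Gh0.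
have nB0 : ~ B (e 0%N) (s 0%N z).
  by have [_ nV] := Uf_ex znV; move=> Bz; apply: nV; apply/him; move: Bz; rewrite /s mul1g.
have tza := attU_pt tab zb.
have nBa : ~ B e1 a.
  apply: (avoid (fun n => s n.+1 z)) tza; apply: filterS e2E => n <-.
  exact: (out 0%N n.+1).
have [c tc] := Uconv Mc (fun n => t n x).
have Bc : B e1 c by exact: tends_closed (cB (e := e1)) tB tc.
have ca : c <> a by move=> ca; apply: nBa; rewrite -ca.
have xb : x = b := attU_rep tab (tends_cst x) tc ca.
apply/(conicalP Mc M3 G_discrete); split=> //; exists t, a, c; split=> //.
  by rewrite xb.
exact/nesym.
Qed.

(** Translates are moved as a whole by [bdd_push]: they either stabilize at a closed set missing
    [x], or shrink to the attracting point, which is not [x]. *)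
Lemma push_away x (y : nat -> M) : parabolic_point G0 x -> bdd G0 x ->
  (\forall k \near Uf, (L G0 (y k) /\ y k <> x) \/
     exists h e, [/\ G0 h, (h @` B e) (y k) & ~ (h @` B e) x]) ->
  exists t l, [/\ forall k, G0 (t k), forall k, t k x = x,
    tends (fun k => t k (y k)) l & l <> x].
Proof.
move=> px bx /Uf_or[Ly|Hy].
  have [d d0 Hd] := bx.
  have /choice[t Ht] : forall k, exists t, [/\ G0 t, t x = x &
      L G0 (y k) /\ y k <> x -> (d <= mdist (t (y k)) x)%R].
    move=> k; have [[Lk yk]|nk] := EM (L G0 (y k) /\ y k <> x); last first.
      by exists 1; split=> //; exact: subg1.
    by have [t [Gt tx dt]] := Hd _ Lk yk; exists t.
  have [l tl] := Uconv Mc (fun k => t k (y k)).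
  exists t, l; split=> [k|k||]; [by have [] := Ht k|by have [] := Ht k|by []|].
  by apply: (tends_neq d0 _ tl); apply: filterS Ly => k /(let: And3 _ _ H := Ht k in H).
pose P k (d : homeo M * bool) := [/\ G0 d.1, (d.1 @` B d.2) (y k) & ~ (d.1 @` B d.2) x].
have /choice[d Hd] : forall k, exists d, (exists d, P k d) -> P k d.
  move=> k; have [[d Pd]|nd] := EM (exists d, P k d); first by exists d.
  by exists (1, true).
have {Hy}Hd : \forall k \near Uf, P k (d k).
  by apply: filterS Hy => k [h [e Hhe]]; apply: Hd; exists (h, e).
have [e eE] := Uf_bool (fun k => (d k).2).
have {}Hd : \forall k \near Uf, P k ((d k).1, e).
  by apply: filterS2 eE Hd => k <-; case: (d k).
have [i0 [Gi0 _ nx0]] := Uf_ex Hd.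
have [h [Hh hd]] := @near_seq _ (fun g => G0 g /\ ~ (g @` B e) x) _ (fun k => (d k).1)
  (conj Gi0 nx0) (filterS (fun k H => let: And3 a _ c := H in conj a c) Hd).
have hy : \forall k \near Uf, (h k @` B e) (y k).
  by apply: filterS2 hd Hd => k <- [].
have {Hd hd d P eE i0 Gi0 nx0} Gh k := (Hh k).1.
(* If all of [G0] fixes [x], [bdd_push] has no second point to follow; then [h k] itself can be
   undone, which brings [y k] into the closed set [B e] missing [x]. *)
have [[g [Gg gx]]|nog] := EM (exists g, G0 g /\ g x <> x); last first.
  have [l hl] := Uconv Mc (fun k => (h k)^-1 (y k)).
  have fx g : G0 g -> g x = x.
    by move=> Gg; apply: contrapT => gx; apply: nog; exists g.
  have GV k : G0 (h k)^-1 by exact: subgV.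
  exists (fun k => (h k)^-1), l; split=> // [k|lx]; first exact: fx.
  have Bl : B e l.
    by apply: (tends_closed (cB (e := e)) _ hl); apply: filterS hy => k /him.
  by apply: (Hh 0%N).2; apply/him; rewrite fx// -lx.
have [t [Gt tx H]] := bdd_push Mc M3 sG0 dG0 px bx Gg gx Gh.
have [l tl] := Uconv Mc (fun k => t k (y k)).
exists t, l; split=> // lx.
have Gth k : G0 (t k * h k) by exact: subgM.
have const (q : homeo M) : (\forall k \near Uf, (t k * h k) @` B e = q @` B e) -> False.
  move=> qE; have cq : closed (q @` B e) by exact: closed_him.
  have : (q @` B e) l.
    apply: (tends_closed cq _ tl); apply: filterS2 qE hy => k <- hk.
    by rewrite him_mul; exists (y k).
  have [k <-] := Uf_ex qE; rewrite him_mul lx => /him.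
  rewrite -{1}(tx k) hK; exact: (Hh k).2.
have [[q _ qE]|[z Lz Hz]] := translates_null e Gth; first exact: const qE.
case: H => [[q _ qE]|[a [b [fth ab ax]]]].
  by apply: (const q); apply: filterS qE => k ->.
apply: ax; rewrite -lx; have [v Ov] := O_nonempty e.
have vB : \forall k \near Uf, B e v by apply: nearW => k; exact: OB.
have za := tends_uniq (Hz _ vB) (attU_pt ab (rep_neq_O Gth fth ab Ov)).
have uB : \forall k \near Uf, B e ((h k)^-1 (y k)) by apply: filterS hy => k /him.
rewrite -za; apply: tends_uniq (Hz _ uB) _.
by apply: tends_eq tl; apply: nearW => k; rewrite hM hVK.
Qed.

Lemma bounded_G x : geometrically_finite G0 -> parabolic_point G0 x -> bdd G0 x -> bdd G x.
Proof.
move=> gf px bx; have [Lx [g [Gg pg gx]]] := px.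
have pGx : parabolic_point G x.
  by split; [exact: limit_G0_G|exists g; split=> //; exact: G0G].
apply: contrapT => nb.
have /choice[y Hy] : forall n : nat, exists y, [/\ L G y, y <> x &
    forall t, G t -> t x = x -> (mdist (t y) x < n.+1%:R^-1)%R].
  move=> n; apply: contrapT => nn; apply: nb.
  exists (n.+1%:R^-1)%R; first by rewrite invr_gt0 ltr0n.
  move=> y Ly yx; apply: contrapT => nt; apply: nn; exists y; split=> // t Gt tx.
  by rewrite ltNge; apply/negP => ty; apply: nt; exists t.
have contra t l : (forall k, G (t k)) -> (forall k, t k x = x) ->
    tends (fun k => t k (y k)) l -> l <> x -> False.
  move=> Gt tx tl lx; apply: lx; apply: tends_uniq tl _ => e /Uf_inv_small He.
  by apply: filterS He => k; apply: lt_trans; have [_ _] := Hy k; apply.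
have : \forall k \near Uf, ((L G0 (y k) /\ y k <> x) \/
     exists h e, [/\ G0 h, (h @` B e) (y k) & ~ (h @` B e) x]) \/
   exists h e, [/\ G0 h, (h @` O e) (y k) & (h @` B e) x].
  apply: nearW => k; have [Lk yk _] := Hy k.
  have [L0|[h [e [Gh Ok]]]] := limit_G_cases Lk; first by left; left.
  have [Bx|nBx] := EM ((h @` B e) x); first by right; exists h, e.
  by left; right; exists h, e; split=> //; move: Ok => [w /OB Bw <-]; exists w.
move=> /Uf_or[H|H].
  have [t [l [Gt tx tl lx]]] := push_away px bx H.
  by apply: contra tl lx => // k; exact: G0G.
pose P k (d : homeo M * bool) := [/\ G0 d.1, (d.1 @` O d.2) (y k) & (d.1 @` B d.2) x].
have /choice[d Hd] : forall k, exists d, (exists d, P k d) -> P k d.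
  move=> k; have [[d Pd]|nd] := EM (exists d, P k d); first by exists d.
  by exists (1, true).
have {H}Hd : \forall k \near Uf, P k (d k).
  by apply: filterS H => k [h [e Hhe]]; apply: Hd; exists (h, e).
(* The translates containing [x] all coincide. Undoing [q] moves [x] to a point [x1] of [B (~~ e)]
   and the [y k] out of [B (~~ e)], so [push_away] applies at [x1]. *)
have [i [Gi _ xi]] := Uf_ex Hd.
pose h := (d i).1; pose e := (d i).2; pose q := h * phi e.
have Gq : G q by apply: (subgM sG (G0G Gi)); exact: Gphi.
have qV z : q^-1 z = (phi e)^-1 (h^-1 z) by rewrite /q invgM.
pose x1 := q^-1 x; have qx1 : q x1 = x by rewrite /x1 hVK.
have Lx1 : L (J (~~ e)) x1.
  rewrite -limit_J_phi /x1 qV hVK; apply/limit_J; split; last exact/him.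
  by apply/(limit_G0_inv _ (subgV sG0 Gi)).
have [LGx1 Bx1] := (limit_J _ _).1 Lx1.
(* A conical [x1] would make [x] conical for [G], although it is parabolic. *)
have [px1 bx1] : parabolic_point G0 x1 /\ bdd G0 x1.
  case: (gf x1 LGx1) => [cx1|/(boundedP Mc sG0)//].
  have : conical_limit_point G x1.
    have [_ [s [si sG0'] Hs]] := cx1; split; first exact: limit_G0_G.
    by exists s => //; split=> // k; exact: G0G.
  move=> /(conical_transl Mc M3 sG G_discrete Gq); rewrite qx1.
  by move=> /(parabolic_not_conical Mc M3 sG G_discrete pGx).
pose y1 k := q^-1 (y k).
have y1B : \forall k \near Uf, ~ B (~~ e) (y1 k).
  apply: filterS Hd => k [Gk [w [v nBv vw] wy] xk].
  have [ek Jk] := translate_meet Gi Gk xi xk.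
  have [e' e'E] : exists e', e' = (d k).2 by exists (d k).2.
  rewrite /y1 qV -wy -vw; move: nBv; rewrite -ek -/e => nBv.
  pose j := (phi e)^-1 * (h^-1 * (d k).1) * phi e.
  have Jj : J (~~ e) j.
    have := @Jb_conj _ Jm1 J1 f conjJ (~~ e) (h^-1 * (d k).1).
    by rewrite negbK phiN invgK; exact.
  have -> : (phi e)^-1 (h^-1 ((d k).1 (phi e v))) = j v by [].
  by rewrite -(JB Jj) => /him; rewrite hK.
have H1 : \forall k \near Uf, (L G0 (y1 k) /\ y1 k <> x1) \/
     exists h e, [/\ G0 h, (h @` B e) (y1 k) & ~ (h @` B e) x1].
  apply: filterS y1B => k nB; have [Lk yk _] := Hy k.
  have y1x1 : y1 k <> x1 by move=> /h_inj.
  have Ly1 : L G (y1 k) by apply/(limit_G_inv _ (subgV sG Gq)).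
  have [L0|[h1 [e1 [Gh1 [w /OB Bw wy]]]]] := limit_G_cases Ly1; first by left.
  right; exists h1, e1; split=> //; first by exists w.
  move=> hx1; have [ee1 Jh1] := meetBB Gh1 hx1 Bx1.
  by apply: nB; rewrite -ee1 -(JB Jh1); exists w.
have [t [l [Gt tx1 tl lx1]]] := push_away px1 bx1 H1.
apply: (contra (fun k => q * t k * q^-1) (q l)).
- move=> k; apply: (subgM sG _ (subgV sG Gq)); apply: (subgM sG Gq); exact: G0G.
- by move=> k; rewrite (hM (q * t k)) (hM q) -/x1 tx1 qx1.
- by apply: tends_eq (tends_him q tl); apply: nearW => k; rewrite (hM (q * t k)) (hM q).
- by rewrite -qx1 => /h_inj.
Qed.
Lemma parabolic_G0_G x : parabolic_point G0 x -> parabolic_point G x.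
Proof.
by move=> [Lx [g [Gg pg gx]]]; split; [exact: limit_G0_G|exists g; split=> //; exact: G0G].
Qed.

Lemma conical_G0_G x : conical_limit_point G0 x -> conical_limit_point G x.
Proof.
move=> [Lx [s [si Gs] H]]; split; first exact: limit_G0_G.
by exists s => //; split=> // k; exact: G0G.
Qed.

Lemma parabolic_J_G0 e x : parabolic_point (J e) x -> parabolic_point G0 x.
Proof.
move=> [/limit_J[Lx _] [g [Jg pg gx]]]; split=> //.
by exists g; split=> //; exact: J_G0 Jg.
Qed.

Lemma conical_G_translate e h x : geometrically_finite (J e) -> G0 h -> L G0 x ->
  (h @` B e) x -> conical_limit_point G x -> conical_limit_point G0 x.
Proof.
move=> Jgf Gh Lx /him Bx cx; rewrite -[x](hVK h).
have Lhx : L G0 (h^-1 x) by apply/(limit_G0_inv _ (subgV sG0 Gh)).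
apply: (conical_transl Mc M3 sG0 dG0 Gh).
have [[_ [s [si Js] H]]|[px _]] := Jgf _ ((limit_J _ _).2 (conj Lhx Bx)).
  by split=> //; exists s => //; split=> // k; exact: J_G0 (Js k).
exfalso; have := parabolic_G0_G (parabolic_J_G0 px).
move=> /(parabolic_not_conical Mc M3 sG G_discrete); apply.
exact: (conical_transl Mc M3 sG G_discrete (subgV sG (G0G Gh))).
Qed.
(** From [s k] in [G] a sequence in [G0] is made: [t k] undoes the first letter of the normal form
    of [(s k)^-1], corrected by [J_push]. It still has [x] as repelling point, because [t k] sends
    points tending to [x] into [B e], away from its attracting point. *)
Lemma conical_G_G0 x : L G0 x -> conical_limit_point G x -> conical_limit_point G0 x.
Proof.
move=> Lx cx.
have [[h [e [Gh hx]]]|nx] := EM (exists h e, G0 h /\ (h @` B e) x).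
  exact: conical_G_translate hx cx.
have {nx}nx h e : G0 h -> ~ (h @` B e) x by move=> Gh hx; apply: nx; exists h, e.
have [_ [s [b [c [Gs fs sbx sc bc]]]]] := (conicalP Mc M3 G_discrete x).1 cx.
have G0c (s' : nat -> homeo M) b' c' : (forall k, G0 (s' k)) -> ufree s' ->
    attU s' b' x -> tends (fun k => s' k x) c' -> b' <> c' -> conical_limit_point G0 x.
  by move=> *; apply/(conicalP Mc M3 dG0); split=> //; exists s', b', c'; split.
have : (\forall k \near Uf, G0 (s k)^-1) \/ (\forall k \near Uf, exists h e n k' e0 c',
    [/\ G0 h, tl e n k' e0 c' & (s k)^-1 = h * phi e * c']).
  by apply: Uf_or; apply: nearW => k; apply: GnfP; exact: (subgV sG).
case=> [G0s|Hs].
  have {}G0s : \forall k \near Uf, G0 (s k).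
    by apply: filterS G0s => k /(subgV sG0); rewrite invgK.
  have [s' [Gs' ss']] := near_seq (subg1 sG0) G0s.
  apply: (G0c s' b c) => //; last 1 first.
  - by apply: tends_eq sc; apply: filterS ss' => k ->.
  - by move=> a; apply: filterS2 ss' (fs a) => k ->.
  - exact: attU_eq ss' sbx.
pose T := (homeo M * bool * homeo M * bool)%type.
pose P g (d : T) := exists n c', [/\ G0 d.1.1.1,
  tl d.1.1.2 n d.1.2 d.2 c' & g^-1 = d.1.1.1 * phi d.1.1.2 * c'].
have /choice[d Hd] : forall k, exists d : T, (exists d, P (s k) d) -> P (s k) d.
  move=> k; have [[d Pd]|nd] := EM (exists d, P (s k) d); first by exists d.
  by exists (1, true, 1, true).
have {Hs}Hd : \forall k \near Uf, P (s k) (d k).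
  apply: filterS Hs => k [h [e [n [k' [e0 [c' [Gh tlc sE]]]]]]]; apply: Hd.
  by exists (h, e, k', e0), n, c'.
have [e eE] := Uf_bool (fun k => (d k).1.1.2).
have Gd : \forall k \near Uf, G0 (d k).1.1.1 by apply: filterS Hd => k [n [c' []]].
have Gk : \forall k \near Uf, G0 (d k).1.2.
  by apply: filterS Hd => k [n [c' [_ /(tl_end sG0)]]].
have [h [Gh hd]] := near_seq (subg1 sG0) Gd.
have [j [Jj H]] := J_push e (fun k => subgV sG0 (Gh k)).
pose t k := j k * (h k)^-1.
have Gt k : G0 (t k) by apply: subgM (subgV sG0 (Gh k)) => //; exact: J_G0 (Jj k).
have tB z : (\forall k \near Uf, ~ ((d k).1.2 @` B (d k).2) z) ->
    \forall k \near Uf, B e (t k ((s k)^-1 z)).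
  move=> zV; apply: filterS2 (filterI zV eE) (filterI Hd hd) => k [nV ek].
  move=> [[n [c' [_ tlc sE]]] hk].
  have := word_pp (d k).1.1.1 tlc nV; rewrite -sE hk ek => /him hB.
  by rewrite /t hM -(JB (Jj k)); exists ((h k)^-1 ((s k)^-1 z)).
have [z zb zV] := pick_outside (fun k => (d k).2) b Gk.
have Bz := tB _ zV; have sVz := attU_pt (attUV sbx) zb.
case: H => [[t0 Gt0 tt0]|[a [b' [ft tab La nBa]]]].
  exfalso; apply: (nx t0^-1 e (subgV sG0 Gt0)); apply/him; rewrite invgK.
  apply: (tends_closed (cB (e := e)) _ (tends_him t0 sVz)).
  by apply: filterS2 tt0 Bz => k <-.
have xb' : x = b'.
  have [l tlx] := Uconv Mc (fun k => t k ((s k)^-1 z)).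
  apply: (attU_rep tab sVz tlx) => la; apply: nBa; rewrite -la.
  exact: tends_closed (cB (e := e)) Bz tlx.
rewrite -xb' in tab.
have [l tlx] := Uconv Mc (fun k => t k x).
have [al|al] := EM (a = l); last exact: G0c Gt ft tab tlx al.
(* Now [r k] takes [t k x] and [t k y], both tending to [a], to sequences with distinct limits [c]
   and [b]. So [r] is not constant, and [a] is its repelling point; the inverses then send some [w]
   towards [a] while keeping it in [B e], which does not contain [a]. *)
exfalso; rewrite -al in tlx.
pose r k := s k * (t k)^-1.
have Gr k : G (r k) by apply: (subgM sG (Gs k)); apply: (subgV sG); exact: G0G.
have rt k y : r k (t k y) = s k y by rewrite /r hM hK.
have [y [yx _]] := pick_neq2 M3 x x.
have ty := attU_pt tab yx; have sy := attU_pt sbx yx.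
have [[r0 Gr0 rr0]|[_ [u [v ruv]]]] := conv_dich Mc G_discrete Gr.
  have rlim w q p : tends (fun k => t k w) q -> tends (fun k => s k w) p -> p = r0 q.
    move=> tw sw; apply: tends_uniq sw _; apply: tends_eq (tends_him r0 tw).
    by apply: filterS rr0 => k rk; rewrite -rt rk.
  by apply: bc; rewrite (rlim _ _ _ ty sy) (rlim _ _ _ tlx sc).
have [av|av] := EM (a = v); last first.
  have rlim w p : tends (fun k => t k w) a -> tends (fun k => s k w) p -> p = u.
    move=> tw sw; apply: tends_uniq sw _; apply: tends_eq (attU_lim ruv tw av).
    by apply: nearW => k; rewrite rt.
  by apply: bc; rewrite (rlim _ _ ty sy) (rlim _ _ tlx sc).
have [w wu wV] := pick_outside (fun k => (d k).2) u Gk.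
apply: nBa; apply: (tends_closed (cB (e := e)) (tB _ wV)).
rewrite av; apply: tends_eq (attU_pt (attUV ruv) wu).
by apply: nearW => k; rewrite /r invgM invgK hM.
Qed.

End BoundedParabolic.

Lemma G_geometrically_finite : (forall e, geometrically_finite (J e)) ->
  geometrically_finite G0 -> geometrically_finite G.
Proof.
move=> J_gf gf.
have J_bp e p : parabolic_point (J e) p -> bounded_parabolic_point G0 p.
  move=> pp; have pG := parabolic_J_G0 pp.
  by have [/(parabolic_not_conical Mc M3 sG0 dG0 pG)|] := gf p pG.1.
move=> x Lx.
have [[g [Gg Lgx]]|nx] := EM (exists g, G g /\ L G0 (g x)); last first.
  left; apply: end_conical => // g Gg Lgx; apply: nx; exists g; split=> //.
have GgV := subgV sG Gg; rewrite -[x](hK g).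
have [cx|/(boundedP Mc sG0)[px bx]] := gf _ Lgx; [left|right].
  exact: (conical_transl Mc M3 sG G_discrete GgV (conical_G0_G cx)).
apply/(boundedP Mc sG); split.
  exact: (parabolic_point_transl Mc M3 sG G_discrete GgV (parabolic_G0_G px)).
exact: (bdd_transl Mc sG GgV (bounded_G J_gf J_bp gf px bx)).
Qed.

Lemma G0_geometrically_finite : (forall e, geometrically_finite (J e)) ->
  geometrically_finite G -> geometrically_finite G0.
Proof.
move=> J_gf gf.
(* Stabilizers in [G] of limit points of [G0] lie in [G0], so both the parabolic element and the
   bound are inherited. *)
have bd x : L G0 x -> bounded_parabolic_point G x -> bounded_parabolic_point G0 x.
  move=> Lx /(boundedP Mc sG)[[_ [g [Gg pg gx]]] bx]; apply/(boundedP Mc sG0); split.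
    by split=> //; exists g; split=> //; exact: stab_G0 gx.
  exact: bdd_G_G0.
have J_bp e p : parabolic_point (J e) p -> bounded_parabolic_point G0 p.
  move=> pp; have pG := parabolic_J_G0 pp; apply: bd; first by have [] := pG.
  have pGG := parabolic_G0_G pG.
  by have [/(parabolic_not_conical Mc M3 sG G_discrete pGG)|] := gf p pGG.1.
move=> x Lx; have [cx|bx] := gf x (limit_G0_G Lx); [left|right; exact: bd].
exact: (conical_G_G0 J_gf J_bp).
Qed.
End Combination.

Theorem theoremB (R : realType) (M : metricType R)
  (M_compact : compact [set: M])
  (G0 J1 Jm1 : set (homeo M)) (f : homeo M)
  (G0_subgroup : subgroup G0)
  (G0_discrete : discrete_convergence_group G0)
  (J1_subgroup : subgroup J1) (J1_sub : J1 `<=` G0)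
  (Jm1_subgroup : subgroup Jm1) (Jm1_sub : Jm1 `<=` G0)
  (J1_gf : geometrically_finite J1) (Jm1_gf : geometrically_finite Jm1)
  (G1 : set (homeo M)) (G1_def : G1 = generated [set f])
  (G1_infinite : infinite_set G1)
  (G1_discrete : discrete_convergence_group G1)
  (conj_J : [set f * j * f^-1 | j in Jm1] = J1)
  (ping_pong : hnn_ping_pong G0 f J1 Jm1)
  (G : set (homeo M)) (G_def : G = generated (G0 `|` G1))
  (G_convergence : convergence_group G) :
  [/\ set_bij [set: hnn G0 Jm1 f] G (@hnn_nat _ G0 Jm1 f),
      discrete_convergence_group G,
      forall g, G g -> ~ (exists2 h, G h & G0 (h * g * h^-1)) -> loxodromic g &
      geometrically_finite G <-> geometrically_finite G0].
Proof.
have [B [[cB iB _] [JB GJB GBB] fAB LB [x0 nx0]]] := ping_pong.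
have Bx0 g e : G0 g -> ~ (g @` B e) x0.
  move=> Gg [y By yx]; apply: nx0; exists g => //; exists y => //.
  by case: e By; [left|right].
have J_gf e : geometrically_finite (Jb Jm1 J1 e) by case: e.
split.
- exact: (hnn_bij G0_subgroup J1_sub Jm1_sub conj_J GJB GBB fAB Bx0 G1_def).
- exact: (G_discrete M_compact G0_subgroup G0_discrete J1_sub Jm1_sub conj_J
    cB iB JB GJB GBB fAB Bx0 G1_def).
- exact: (G_loxodromic M_compact G0_subgroup G0_discrete J1_subgroup J1_sub
    Jm1_subgroup Jm1_sub conj_J cB iB JB GJB GBB fAB Bx0 G1_def).
- split; first exact: (G0_geometrically_finite M_compact G0_subgroup G0_discrete J1_subgroup
    J1_sub Jm1_subgroup Jm1_sub conj_J cB iB JB GJB GBB fAB Bx0 G1_def).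
  exact: (G_geometrically_finite M_compact G0_subgroup G0_discrete J1_subgroup
    J1_sub Jm1_subgroup Jm1_sub conj_J cB iB JB GJB GBB fAB Bx0 G1_def).
Qed.
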